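(* Let $T$ be one of $C_2,C_3^0,C_3,C_4,\dots,C_{10},C_{12},C_2\times C_2,C_2\times C_4,C_2\times C_6,C_2\times C_8$ and let $E_T$ be the corresponding Weierstrass model with integer parameters satisfying the parameter conditions (P). Let $u_T$ be as defined below, and let $E_T'$ be the elliptic curve obtained from $E_T$ by the admissible change of variables $x\mapsto u_T^2x+r_T$, $y\mapsto u_T^3y+u_T^2s_Tx$, where $r_T=1$ if $T=C_2$ with $v_2(b)\ge 3$ and $a\equiv 7\pmod 8$; $r_T=-3$ if $T=C_2$ with $v_2(b)\ge 3$ and $a\equiv 3\pmod 8$; $r_T=0$ otherwise; and $s_T=0$ if (i) $T\neq C_2,C_4,C_2\times C_2$, or (ii) $T=C_4$ with $u_T=c$, or (iii) $T=C_2$ or $C_2\times C_2$ with $u_T=1$; $s_T=1$ if $T=C_2\times C_2$ with $u_T=2$, or $T=C_2$ with $v_2(b)\ge 3$ and $a\equiv 3\pmod 4$; $s_T=2$ if $T=C_2$ with $u_T\neq 1$ and $v_2(b)=1$; $s_T=2c$ if $T=C_4$ with $u_T=2c$. Then $E_T'$ is a global minimal model for $E_T$.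
   Context: For each $T$, $E_T$ is the Weierstrass model $y^2+a_1xy+a_3y=x^3+a_2x^2+a_4x$ with coefficients (with $a_4=0$ unless stated): $T=C_2$ (parameters $a,b,d$): $a_1=a_3=0$, $a_2=2a$, $a_4=a^2-b^2d$. $T=C_3^0$ (parameter $a$): $y^2+ay=x^3$. $T=C_3$: $a_1=a$, $a_2=0$, $a_3=a^2b$. $T=C_4$: $a_1=a$, $a_2=-ab$, $a_3=-a^2b$. $T=C_5$: $a_1=a-b$, $a_2=-ab$, $a_3=-a^2b$. $T=C_6$: $a_1=a-b$, $a_2=-ab-b^2$, $a_3=-a^2b-ab^2$. $T=C_7$: $a_1=a^2+ab-b^2$, $a_2=a^2b^2-ab^3$, $a_3=a^4b^2-a^3b^3$. $T=C_8$: $a_1=-a^2+4ab-2b^2$, $a_2=-a^2b^2+3ab^3-2b^4$, $a_3=-a^3b^3+3a^2b^4-2ab^5$. $T=C_9$: $a_1=a^3+ab^2-b^3$, $a_2=a^4b^2-2a^3b^3+2a^2b^4-ab^5$, $a_3=a^3a_2$. $T=C_{10}$: $a_1=a^3-2a^2b-2ab^2+2b^3$, $a_2=-a^3b^3+3a^2b^4-2ab^5$, $a_3=(a^3-3a^2b+ab^2)a_2$. $T=C_{12}$: $a_1=-a^4+2a^3b+2a^2b^2-8ab^3+6b^4$, $a_2=b(a-2b)(a-b)^2(a^2-3ab+3b^2)(a^2-2ab+2b^2)$, $a_3=a(b-a)^3a_2$. $T=C_2\times C_2$ (parameters $a,b,d$): $a_1=a_3=0$, $a_2=ad+bd$, $a_4=abd^2$.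 $T=C_2\times C_4$: $a_1=a$, $a_2=-ab-4b^2$, $a_3=-a^2b-4ab^2$. $T=C_2\times C_6$: $a_1=-19a^2+2ab+b^2$, $a_2=-10a^4+22a^3b-14a^2b^2+2ab^3$, $a_3=90a^6-198a^5b+116a^4b^2+4a^3b^3-14a^2b^4+2ab^5$. $T=C_2\times C_8$: $a_1=-a^4-8a^3b-24a^2b^2+64b^4$, $a_2=-4ab^2(a+2b)(a+4b)^2(a^2+4ab+8b^2)$, $a_3=-2b(a+4b)(a^2-8b^2)a_2$. Parameter conditions (P): all parameters are integers with nonzero discriminant of $E_T$; for $T\in\{C_3,\dots,C_{12},C_2\times C_4,C_2\times C_6,C_2\times C_8\}$: $\gcd(a,b)=1$, $a>0$; for $T=C_2$: $b\neq0$, $d\neq 1$, $d$ squarefree, $\gcd(a,b)$ squarefree; for $T=C_3^0$: $a$ positive cubefree; for $T=C_2\times C_2$: $\gcd(a,b)=1$, $a$ even, $d$ positive squarefree. Definition of $u_T$: $u_T=1$ for $T=C_5,C_7,C_9,C_3^0$. For $T=C_3$, writing $a=c^3d^2e$ ($c$ positive integer, $d,e$ coprime positive squarefree), $u_T=c^2d$. For $T=C_4$, writing $a=c^2d$ ($c$ positive integer, $d$ squarefree), $u_T=2c$ if $v_2(a)\ge 8$ is even and $bd\equiv 3\pmod 4$, else $u_T=c$. For $T=C_2$: $u_T=4$ iff $v_2(b^2d-a^2)\ge8$, $v_2(a)=v_2(b)=1$, $a\equiv 2\pmod 8$; $u_T=2$ iff (i) $v_2(b^2d-a^2)\ge 8$,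 $v_2(a)=v_2(b)=1$, $a\equiv 6\pmod 8$, or (ii) $4\le v_2(b^2d-a^2)\le 7$ with $v_2(a)=v_2(b)=1$, or (iii) $v_2(b)\ge 3$ and $a\equiv 3\pmod 4$; otherwise $u_T=1$. For $C_6$: $u_T=2$ iff $v_2(a+b)\ge 3$, else $1$. For $C_8$: $2$ iff $v_2(a)=1$, else $1$. For $C_{10},C_{12}$: $2$ iff $a$ even, else $1$. For $C_2\times C_2$: $2$ iff $v_2(a)\ge 4$ and $bd\equiv 1\pmod 4$, else $1$. For $C_2\times C_4$: $4$ iff $v_2(a)=2$ and $v_2(a+4b)\ge 4$; $2$ iff $v_2(a)\ge 2$ and $v_2(a+4b)\le 3$; $1$ iff $v_2(a)\le 1$. For $C_2\times C_6$: $16$ iff $v_2(a+b)=1$; $4$ iff $v_2(a+b)\ge2$; $1$ iff $v_2(a+b)=0$. For $C_2\times C_8$: $64$ iff $v_2(a)\ge 2$; $16$ iff $v_2(a)=1$; $1$ iff $v_2(a)=0$. A global minimal model of a rational elliptic curve is an integral Weierstrass model whose discriminant has minimal $p$-adic valuation at every prime $p$.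
   Formalization: For T=C_4 with u_T=2c the formal statement takes s_T=c instead of s_T=2c; with s_T=2c the model is never integral (e.g. a=256, b=3 gives a_2'=-39/4), so the printed value is false. *)

(* Defs.v *)
(* Mathematical Components *)
From HB Require Import structures.
From mathcomp Require Import all_boot all_order all_algebra.
From mathcomp Require Import ring.

Set Implicit Arguments.
Unset Strict Implicit.
Unset Printing Implicit Defensive.

Import Order.TTheory GRing.Theory Num.Theory.
Local Open Scope ring_scope.

(* y^2 + a1 x y + a3 y = x^3 + a2 x^2 + a4 x + a6 *)
Record weierstrass (R : Type) := Weierstrass {
  wa1 : R; wa2 : R; wa3 : R; wa4 : R; wa6 : R
}.

Definition map_weierstrass (R S : Type) (h : R -> S) (W : weierstrass R) :
    weierstrass S :=
  Weierstrass (h (wa1 W)) (h (wa2 W)) (h (wa3 W)) (h (wa4 W)) (h (wa6 W)).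

Definition to_rat (W : weierstrass int) : weierstrass rat :=
  map_weierstrass (fun n : int => n%:~R) W.

Definition discriminant (R : comNzRingType) (W : weierstrass R) : R :=
  let: Weierstrass a1 a2 a3 a4 a6 := W in
  let b2 := a1 ^+ 2 + 4 * a2 in
  let b4 := 2 * a4 + a1 * a3 in
  let b6 := a3 ^+ 2 + 4 * a6 in
  let b8 := a1 ^+ 2 * a6 + 4 * a2 * a6 - a1 * a3 * a4 + a2 * a3 ^+ 2
            - a4 ^+ 2 in
  - (b2 ^+ 2 * b8) - 8 * b4 ^+ 3 - 27 * b6 ^+ 2 + 9 * b2 * b4 * b6.

Definition weierstrass_eval (R : comNzRingType) (W : weierstrass R) (x y : R) :
    R :=
  y ^+ 2 + wa1 W * x * y + wa3 W * y
  - (x ^+ 3 + wa2 W * x ^+ 2 + wa4 W * x + wa6 W).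

(* The model obtained by x |-> u^2 x + r, y |-> u^3 y + u^2 s x + t and
   division by u^6; see change_variables_eval. *)
Definition change_variables (F : fieldType) (W : weierstrass F) (u r s t : F) :
    weierstrass F :=
  let: Weierstrass a1 a2 a3 a4 a6 := W in
  Weierstrass
    ((a1 + 2 * s) / u)
    ((a2 - s * a1 + 3 * r - s ^+ 2) / u ^+ 2)
    ((a3 + r * a1 + 2 * t) / u ^+ 3)
    ((a4 - s * a3 + 2 * r * a2 - (t + r * s) * a1 + 3 * r ^+ 2 - 2 * s * t)
      / u ^+ 4)
    ((a6 + r * a4 + r ^+ 2 * a2 + r ^+ 3 - t * a3 - t ^+ 2 - r * t * a1)
      / u ^+ 6).

Lemma change_variables_eval (F : fieldType) (W : weierstrass F)
    (u r s t x y : F) : u != 0 ->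
  weierstrass_eval W (u ^+ 2 * x + r) (u ^+ 3 * y + u ^+ 2 * s * x + t)
  = u ^+ 6 * weierstrass_eval (change_variables W u r s t) x y.
Proof.
by case: W => a1 a2 a3 a4 a6 u0; rewrite /weierstrass_eval /=; field.
Qed.

Definition is_model_of (E W : weierstrass rat) : Prop :=
  exists u r s t : rat, u != 0 /\ W = change_variables E u r s t.

(* E is meant to have nonzero discriminant, so that all the discriminants
   below are nonzero and logn is their p-adic valuation. *)
Definition global_minimal_model (E W : weierstrass rat) : Prop :=
  is_model_of E W /\
  exists2 W0 : weierstrass int, W = to_rat W0 &
    forall W1 : weierstrass int, is_model_of E (to_rat W1) ->
    forall p : nat, prime p ->
      (logn p `|discriminant W0| <= logn p `|discriminant W1|)%N.

(* The 2-adic valuation, with None for v_2(0) = +oo.  The infinite value does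
   occur: a = 1, b = -1 is allowed for C2xC6, where v_2(a + b) is used. *)
Definition v2 (n : int) : option nat :=
  if n == 0 then None else Some (logn 2 `|n|).

Definition v2_ge (n : int) (k : nat) : bool :=
  if v2 n is Some m then (k <= m)%N else true.

Definition v2_le (n : int) (k : nat) : bool :=
  if v2 n is Some m then (m <= k)%N else false.

Definition v2_eq (n : int) (k : nat) : bool := v2 n == Some k.

Definition v2_even (n : int) : bool :=
  if v2 n is Some m then ~~ odd m else false.

Definition squarefree (n : int) : Prop :=
  forall p : nat, prime p -> ~~ ((p ^ 2)%N%:Z %| n)%Z.

Definition cubefree (n : int) : Prop :=
  forall p : nat, prime p -> ~~ ((p ^ 3)%N%:Z %| n)%Z.

Inductive torsion_type : Set :=
  | C2 | C3_0 | C3 | C4 | C5 | C6 | C7 | C8 | C9 | C10 | C12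
  | C2xC2 | C2xC4 | C2xC6 | C2xC8.

(* The parameters b and d are ignored by the families that do not use them. *)
Definition E_ (T : torsion_type) (a b d : int) : weierstrass int :=
  match T with
  | C2 => Weierstrass 0 (2 * a) 0 (a ^+ 2 - b ^+ 2 * d) 0
  | C3_0 => Weierstrass 0 0 a 0 0
  | C3 => Weierstrass a 0 (a ^+ 2 * b) 0 0
  | C4 => Weierstrass a (- (a * b)) (- (a ^+ 2 * b)) 0 0
  | C5 => Weierstrass (a - b) (- (a * b)) (- (a ^+ 2 * b)) 0 0
  | C6 =>
      Weierstrass (a - b) (- (a * b) - b ^+ 2)
        (- (a ^+ 2 * b) - a * b ^+ 2) 0 0
  | C7 =>
      Weierstrass (a ^+ 2 + a * b - b ^+ 2)
        (a ^+ 2 * b ^+ 2 - a * b ^+ 3)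
        (a ^+ 4 * b ^+ 2 - a ^+ 3 * b ^+ 3) 0 0
  | C8 =>
      Weierstrass (- a ^+ 2 + 4 * a * b - 2 * b ^+ 2)
        (- (a ^+ 2 * b ^+ 2) + 3 * a * b ^+ 3 - 2 * b ^+ 4)
        (- (a ^+ 3 * b ^+ 3) + 3 * a ^+ 2 * b ^+ 4 - 2 * a * b ^+ 5) 0 0
  | C9 =>
      let a2 := a ^+ 4 * b ^+ 2 - 2 * a ^+ 3 * b ^+ 3
                + 2 * a ^+ 2 * b ^+ 4 - a * b ^+ 5 in
      Weierstrass (a ^+ 3 + a * b ^+ 2 - b ^+ 3) a2 (a ^+ 3 * a2) 0 0
  | C10 =>
      let a2 := - (a ^+ 3 * b ^+ 3) + 3 * a ^+ 2 * b ^+ 4 - 2 * a * b ^+ 5 in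
      Weierstrass (a ^+ 3 - 2 * a ^+ 2 * b - 2 * a * b ^+ 2 + 2 * b ^+ 3) a2
        ((a ^+ 3 - 3 * a ^+ 2 * b + a * b ^+ 2) * a2) 0 0
  | C12 =>
      let a2 := b * (a - 2 * b) * (a - b) ^+ 2
                * (a ^+ 2 - 3 * a * b + 3 * b ^+ 2)
                * (a ^+ 2 - 2 * a * b + 2 * b ^+ 2) in
      Weierstrass
        (- a ^+ 4 + 2 * a ^+ 3 * b + 2 * a ^+ 2 * b ^+ 2 - 8 * a * b ^+ 3
          + 6 * b ^+ 4)
        a2 (a * (b - a) ^+ 3 * a2) 0 0
  | C2xC2 => Weierstrass 0 (a * d + b * d) 0 (a * b * d ^+ 2) 0
  | C2xC4 =>
      Weierstrass a (- (a * b) - 4 * b ^+ 2)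
        (- (a ^+ 2 * b) - 4 * a * b ^+ 2) 0 0
  | C2xC6 =>
      Weierstrass (- (19 * a ^+ 2) + 2 * a * b + b ^+ 2)
        (- (10 * a ^+ 4) + 22 * a ^+ 3 * b - 14 * a ^+ 2 * b ^+ 2
          + 2 * a * b ^+ 3)
        (90 * a ^+ 6 - 198 * a ^+ 5 * b + 116 * a ^+ 4 * b ^+ 2
          + 4 * a ^+ 3 * b ^+ 3 - 14 * a ^+ 2 * b ^+ 4 + 2 * a * b ^+ 5) 0 0
  | C2xC8 =>
      let a2 := - (4 * a * b ^+ 2 * (a + 2 * b) * (a + 4 * b) ^+ 2
                  * (a ^+ 2 + 4 * a * b + 8 * b ^+ 2)) in
      Weierstrass
        (- a ^+ 4 - 8 * a ^+ 3 * b - 24 * a ^+ 2 * b ^+ 2 + 64 * b ^+ 4)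
        a2
        (- (2 * b * (a + 4 * b) * (a ^+ 2 - 8 * b ^+ 2) * a2)) 0 0
  end.

Definition parameter_conditions (T : torsion_type) (a b d : int) : Prop :=
  discriminant (E_ T a b d) != 0 /\
  match T with
  | C2 => [/\ b != 0, d != 1, squarefree d & squarefree (gcdz a b)]
  | C3_0 => 0 < a /\ cubefree a
  | C2xC2 => [/\ coprimez a b, (2 %| a)%Z, 0 < d & squarefree d]
  | _ => coprimez a b /\ 0 < a
  end.

(* For C3, a = c^3 f^2 g; for C4, a = c^2 f.  These decompositions exist and
   are unique for every a > 0.  For the other families c, f, g are not used. *)
Definition power_decomposition (T : torsion_type) (a c f g : int) : Prop :=
  match T with
  | C3 =>
      [/\ a = c ^+ 3 * f ^+ 2 * g, 0 < c, 0 < f /\ 0 < g, coprimez f g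
        & squarefree f /\ squarefree g]
  | C4 => [/\ a = c ^+ 2 * f, 0 < c & squarefree f]
  | _ => True
  end.

Definition u_ (T : torsion_type) (a b d c f : int) : int :=
  match T with
  | C5 | C7 | C9 | C3_0 => 1
  | C3 => c ^+ 2 * f
  | C4 =>
      if [&& v2_ge a 8, v2_even a & (b * f == 3 %[mod 4])%Z] then 2 * c
      else c
  | C2 =>
      let w := b ^+ 2 * d - a ^+ 2 in
      if [&& v2_ge w 8, v2_eq a 1, v2_eq b 1 & (a == 2 %[mod 8])%Z] then 4
      else if [|| [&& v2_ge w 8, v2_eq a 1, v2_eq b 1 & (a == 6 %[mod 8])%Z],
                  [&& v2_ge w 4, v2_le w 7, v2_eq a 1 & v2_eq b 1]
                | v2_ge b 3 && (a == 3 %[mod 4])%Z] then 2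
      else 1
  | C6 => if v2_ge (a + b) 3 then 2 else 1
  | C8 => if v2_eq a 1 then 2 else 1
  | C10 | C12 => if (2 %| a)%Z then 2 else 1
  | C2xC2 => if v2_ge a 4 && (b * d == 1 %[mod 4])%Z then 2 else 1
  | C2xC4 =>
      if v2_eq a 2 && v2_ge (a + 4 * b) 4 then 4
      else if v2_ge a 2 && v2_le (a + 4 * b) 3 then 2
      else 1
  | C2xC6 =>
      if v2_eq (a + b) 1 then 16
      else if v2_ge (a + b) 2 then 4
      else 1
  | C2xC8 => if v2_ge a 2 then 64 else if v2_eq a 1 then 16 else 1
  end.

Definition r_ (T : torsion_type) (a b : int) : int :=
  match T with
  | C2 =>
      if v2_ge b 3 && (a == 7 %[mod 8])%Z then 1
      else if v2_ge b 3 && (a == 3 %[mod 8])%Z then -3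
      else 0
  | _ => 0
  end.

(* For C4 with u = 2c the value is s = c, i.e. y |-> 8c^3 y + 4c^3 x.  The
   source prints s = 2c there, which is a misprint: it gives the coefficient
   a2' = - bf/4 - cf/2 - 1 with bf odd and c even, so the model would never be
   integral (for instance -39/4 for a = 256, b = 3). *)
Definition s_ (T : torsion_type) (a b d c f : int) : int :=
  let u := u_ T a b d c f in
  match T with
  | C2 =>
      if u == 1 then 0
      else if v2_ge b 3 && (a == 3 %[mod 4])%Z then 1
      else if v2_eq b 1 then 2
      else 0
  | C4 => if u == 2 * c then c else 0
  | C2xC2 => if u == 2 then 1 else 0
  | _ => 0
  end.

Definition E' (T : torsion_type) (a b d c f : int) : weierstrass rat :=
  change_variables (to_rat (E_ T a b d)) (u_ T a b d c f)%:~R (r_ T a b)%:~R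
    (s_ T a b d c f)%:~R 0.

(* Main.v *)
(* Two integral models of a curve are related by a rational change of variables
   whose scaling factor v satisfies c4 = v^4 c4', c6 = v^6 c6' and
   D = v^12 D'.  A model is therefore minimal at p as soon as p^4, p^6 and p^12
   do not simultaneously divide c4, c6 and D or, for p = 2, as soon as the
   quotients c4 / 2^4 and c6 / 2^6 violate the congruences of Kraus, which hold
   for every integral model.  For the families with coprime parameters, a prime
   p > 3 dividing c4 and c6 makes the reduction a cuspidal cubic through (0, 0);
   this makes two forms of small degree in a and b vanish modulo p, which
   Bezout identities exclude except at p = 5 or 7.  The remaining primes are
   handled by expanding c4, c6 or D with a = i b + p k.  For C2, C3, C4 and
   C2xC2 the squarefree parts of the parameters bound the valuations of c4, c6
   and D directly. *)

Require Import Defs.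
From mathcomp Require Import all_boot all_order all_algebra.
From mathcomp Require Import ring zify.

Set Implicit Arguments.
Unset Strict Implicit.
Unset Printing Implicit Defensive.

Import Order.TTheory GRing.Theory Num.Theory.
Local Open Scope ring_scope.

(** The obstacle is the prime 2, where a scaling may keep [c4], [c6] and the discriminant integral
    without coming from an integral model. Kraus's congruences serve only as a necessary condition;
    no model is built from them, since [u_T], [r_T], [s_T] already give one whose integrality is
    checked coefficient by coefficient. At 3 no congruence is called for: one of the invariants
    always fails the plain divisibility.

    The long polynomials are certificates. Those of the Bezout identities are what the extended
    Euclidean algorithm yields for two binary forms with one variable set to 1, after clearing
    denominators and homogenising again; the constant left over has no prime factors but 2, 3 and
    sometimes 5 or 7. Those of the residue arguments are quotients: on a class [a = i b + p k], once
    the exact power of [p] is removed, all of the form but one term is divisible by [p], and that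
    term is a unit times a power of the parameter prime to [p]. The moduli of the classes are taken
    large enough for [u_T] to be constant and for every quotient to have integer coefficients. *)

Definition c4 (R : comNzRingType) (W : weierstrass R) : R :=
  let: Weierstrass a1 a2 a3 a4 a6 := W in
  (a1 ^+ 2 + 4 * a2) ^+ 2 - 24 * (2 * a4 + a1 * a3).

Definition c6 (R : comNzRingType) (W : weierstrass R) : R :=
  let: Weierstrass a1 a2 a3 a4 a6 := W in
  let b2 := a1 ^+ 2 + 4 * a2 in
  36 * b2 * (2 * a4 + a1 * a3) - b2 ^+ 3 - 216 * (a3 ^+ 2 + 4 * a6).

Lemma c4_change_variables (F : fieldType) (W : weierstrass F) (u r s t : F) :
  u != 0 -> c4 W = u ^+ 4 * c4 (change_variables W u r s t).
Proof. by case: W => a1 a2 a3 a4 a6 u0 /=; field. Qed.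

Lemma c6_change_variables (F : fieldType) (W : weierstrass F) (u r s t : F) :
  u != 0 -> c6 W = u ^+ 6 * c6 (change_variables W u r s t).
Proof. by case: W => a1 a2 a3 a4 a6 u0 /=; field. Qed.

Lemma discriminant_change_variables (F : fieldType) (W : weierstrass F)
    (u r s t : F) : u != 0 ->
  discriminant W = u ^+ 12 * discriminant (change_variables W u r s t).
Proof. by case: W => a1 a2 a3 a4 a6 u0 /=; field. Qed.

Lemma c4_to_rat (W : weierstrass int) : c4 (to_rat W) = (c4 W)%:~R.
Proof. by case: W => a1 a2 a3 a4 a6 /=; ring. Qed.

Lemma c6_to_rat (W : weierstrass int) : c6 (to_rat W) = (c6 W)%:~R.
Proof. by case: W => a1 a2 a3 a4 a6 /=; ring. Qed.

Lemma discriminant_to_rat (W : weierstrass int) :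
  discriminant (to_rat W) = (discriminant W)%:~R.
Proof. by case: W => a1 a2 a3 a4 a6 /=; ring. Qed.

(* Kraus's congruences: the 2-adic restriction on the invariants (c4, c6) of an
   integral model. *)
Definition kraus (x y : int) : Prop :=
  (exists i j, x = 2 * i + 1 /\ y = 4 * j + 3) \/
  (exists i, x = 16 * i /\
    ((exists j, y = 32 * j) \/ exists j, y = 32 * j + 8)).

Lemma even_or_odd (n : int) : exists k, n = 2 * k \/ n = 2 * k + 1.
Proof. by exists (n %/ 2)%Z; lia. Qed.

(** For odd [a1], [b2] is 1 modulo 4, so [c4 = b2^2 - 24 b4] is odd and [c6] is [- b2^3], that is 3,
    modulo 4. For even [a1], [b2 = 4 B] and [b4 = 2 C] make [c4] divisible by 16 and every term of
    [c6] divisible by 32 except [- 216 a3^2], which is 0 or 8 modulo 32 according to the parity of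
    [a3]. *)
Lemma kraus_c4_c6 (W : weierstrass int) : kraus (c4 W) (c6 W).
Proof.
case: W => a1 a2 a3 a4 a6 /=.
have [k [->|->]] := even_or_odd a1; last first.
  left; pose B := k ^+ 2 + k + a2; pose b4 := 2 * a4 + (2 * k + 1) * a3.
  exists (8 * B ^+ 2 + 4 * B - 12 * b4),
    (9 * (4 * B + 1) * b4 - 16 * B ^+ 3 - 12 * B ^+ 2 - 3 * B
     - 54 * (a3 ^+ 2 + 4 * a6) - 1).
  by rewrite /B /b4; split; ring.
right; pose B := k ^+ 2 + a2; pose C := a4 + k * a3.
exists (B ^+ 2 - 3 * C); have [l El] := even_or_odd a3.
split; first by rewrite /B /C; ring.
case: El => El; [left|right].
  by exists (9 * B * C - 2 * B ^+ 3 - 27 * a6 - 27 * l ^+ 2);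
    rewrite /B /C El; ring.
by exists (9 * B * C - 2 * B ^+ 3 - 27 * a6 - 27 * (l ^+ 2 + l) - 7);
  rewrite /B /C El; ring.
Qed.

Lemma odd_sqr_mod8 (l : int) : exists m, (2 * l + 1) ^+ 2 = 8 * m + 1.
Proof.
have [j [->|->]] := even_or_odd l.
  by exists (2 * j ^+ 2 + j); ring.
by exists (2 * j ^+ 2 + 3 * j + 1); ring.
Qed.

(** For even [k] the factors [k^4] and [k^6] bring multiples of 16 and 64 by themselves. For odd
    [k], [k^2] is 1 modulo 8, which fixes every residue class in the condition. *)
Lemma kraus_scale (k x y : int) :
  kraus x y -> kraus (k ^+ 4 * x) (k ^+ 6 * y).
Proof.
have [l [->|->]] := even_or_odd k => H.
  right; exists (l ^+ 4 * x); split; first by ring.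
  by left; exists (2 * l ^+ 6 * y); ring.
have [m Em] := odd_sqr_mod8 l; rewrite (exprM _ 2 2) (exprM _ 2 3) Em.
case: H => [[i [j [-> ->]]]|[i [-> Ey]]]; [left|right].
  exists ((8 * m + 1) ^+ 2 * i + 32 * m ^+ 2 + 8 * m).
  exists ((8 * m + 1) ^+ 3 * j + 384 * m ^+ 3 + 144 * m ^+ 2 + 18 * m).
  by split; ring.
exists ((8 * m + 1) ^+ 2 * i); split; first by ring.
case: Ey => -[j ->]; [left|right].
  by exists ((8 * m + 1) ^+ 3 * j); ring.
by exists ((8 * m + 1) ^+ 3 * j + 128 * m ^+ 3 + 48 * m ^+ 2 + 6 * m); ring.
Qed.

(* k^8 = 1 modulo 32, so scaling by k^7 undoes scaling by k. *)
Lemma kraus_unscale (k x y : int) : ~~ (2 %| k)%Z ->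
  kraus (k ^+ 4 * x) (k ^+ 6 * y) -> kraus x y.
Proof.
move=> k_odd /(kraus_scale (k ^+ 7)).
have -> : (k ^+ 7) ^+ 4 * (k ^+ 4 * x) = ((k ^+ 2) ^+ 4) ^+ 4 * x by ring.
have -> : (k ^+ 7) ^+ 6 * (k ^+ 6 * y) = ((k ^+ 2) ^+ 4) ^+ 6 * y by ring.
have [l ->] : exists l, k = 2 * l + 1 by exists (k %/ 2)%Z; lia.
have [m ->] := odd_sqr_mod8 l.
have -> : (8 * m + 1) ^+ 4 = 32 * (128 * m ^+ 4 + 64 * m ^+ 3 + 12 * m ^+ 2
    + m) + 1 by ring.
move: (128 * _ + _ + _ + _) => n.
have -> : (32 * n + 1) ^+ 4 * x
    = x + 32 * (n * ((32 * n) ^+ 3 + 4 * (32 * n) ^+ 2 + 6 * (32 * n) + 4) * x).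
  by ring.
have [q ->] : exists q, (32 * n + 1) ^+ 6 * y = y + 32 * q.
  pose z := 32 * n; rewrite -/z.
  exists (n * (z ^+ 5 + 6 * z ^+ 4 + 15 * z ^+ 3 + 20 * z ^+ 2 + 15 * z
      + 6) * y).
  by rewrite /z; ring.
move: (_ * x) => r [[i [j [Ex Ey]]]|[i [Ex Ey]]]; [left|right].
  by exists (i - 16 * r), (j - 8 * q); lia.
exists (i - 2 * r); split; first lia.
by case: Ey => -[j Ey]; [left|right]; exists (j - q); lia.
Qed.

(* x, y and z are the invariants of the model that a further scaling by p would
   produce. *)
Definition reducible_at (p : nat) (E : weierstrass int) (u : int) : Prop :=
  exists x y z : int,
    [/\ c4 E = u ^+ 4 * (p%:Z ^+ 4 * x), c6 E = u ^+ 6 * (p%:Z ^+ 6 * y),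
        discriminant E = u ^+ 12 * (p%:Z ^+ 12 * z) & p = 2 -> kraus x y].

(** * Comparison of integral models and the minimality criterion *)

Lemma coprimez_exp_cancel (m n x y : int) (k : nat) : coprimez m n ->
  m ^+ k * x = n ^+ k * y -> exists z, x = n ^+ k * z.
Proof.
move=> cop E; have : (n ^+ k %| m ^+ k * x)%Z by rewrite E dvdz_mulr.
rewrite Gauss_dvdzr; last by rewrite coprimezXl // coprimezXr // coprimez_sym.
by case/dvdzP=> z ->; exists z; rewrite mulrC.
Qed.

(** With [v = m / n] in lowest terms, [n^4], [n^6] and [n^12] divide the invariants of the second
    model, and the quotients times [m^4], [m^6], [m^12] are those of the first. A strict drop of the
    discriminant at [p] puts a factor [p] into [m]. *)
Lemma scaling_logn (p : nat) (x0 y0 z0 x1 y1 z1 : int) (v : rat) :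
  prime p -> v != 0 -> z0 != 0 ->
  x0%:~R = v ^+ 4 * x1%:~R -> y0%:~R = v ^+ 6 * y1%:~R ->
  z0%:~R = v ^+ 12 * z1%:~R -> kraus x1 y1 ->
  (logn p `|z1| < logn p `|z0|)%N ->
  exists x y z : int, [/\ x0 = p%:Z ^+ 4 * x, y0 = p%:Z ^+ 6 * y,
                          z0 = p%:Z ^+ 12 * z & p = 2 -> kraus x y].
Proof.
move=> p_pr v0 z00 Ex Ey Ez kr lt_z.
pose m := numq v; pose n := denq v.
have n0 : (n%:~R : rat) != 0 by rewrite intr_eq0 denq_eq0.
have Ev : v = m%:~R / n%:~R by rewrite divq_num_den.
have cop : coprimez n m by rewrite coprimez_sym /coprimez /gcdz;
    exact: coprime_num_den.
have clear_den k (s t : int) : s%:~R = v ^+ k * t%:~R -> n ^+ k * s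
    = m ^+ k * t.
  rewrite Ev expr_div_n => Est; apply: (@intr_inj rat).
  rewrite !rmorphM !rmorphXn /= Est.
  by rewrite mulrA [_ ^+ k * _]mulrC divfK ?expf_neq0.
have {}Ex := clear_den _ _ _ Ex; have {}Ey := clear_den _ _ _ Ey.
have {}Ez := clear_den _ _ _ Ez.
have m0 : m != 0 by rewrite numq_eq0.
have z10 : z1 != 0.
  apply: contraNneq z00 => z1E; move/eqP: Ez; rewrite z1E mulr0 mulf_eq0.
  by rewrite expf_eq0 /= denq_eq0.
(* If [p] did not divide [m], then [n^12 z0 = m^12 z1] would give [z1] at least the valuation of
   [z0]. *)
have [m' Em] : exists m', m = p%:Z * m'.
  suff /dvdzP[m' ->] : (p%:Z %| m)%Z by exists m'; rewrite mulrC.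
  rewrite dvdzE /=; apply: contraLR lt_z => pm; rewrite -leqNgt.
  have : logn p `|n ^+ 12 * z0| = logn p `|m ^+ 12 * z1| by rewrite Ez.
  rewrite (abszM (n ^+ 12)) (abszM (m ^+ 12)) !abszX.
  rewrite [LHS]lognM ?[RHS]lognM ?expn_gt0 ?absz_gt0 ?m0 ?denq_eq0 //.
  rewrite [in RHS]lognX (logn_coprime (m := `|m|)) ?prime_coprime // add0n.
  by move=> <-; exact: leq_addl.
have [x Ex1] := coprimez_exp_cancel (etrans (coprimez_sym m n) cop) (esym Ex).
have [y Ey1] := coprimez_exp_cancel (etrans (coprimez_sym m n) cop) (esym Ey).
have [z Ez1] := coprimez_exp_cancel (etrans (coprimez_sym m n) cop) (esym Ez).
have n0' k : n ^+ k != 0 by rewrite expf_neq0 ?denq_eq0.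
exists (m' ^+ 4 * x), (m' ^+ 6 * y), (m' ^+ 12 * z); split.
- by apply: (mulfI (n0' 4%N)); rewrite Ex Ex1 Em; ring.
- by apply: (mulfI (n0' 6%N)); rewrite Ey Ey1 Em; ring.
- by apply: (mulfI (n0' 12%N)); rewrite Ez Ez1 Em; ring.
(* For [p = 2] the denominator [n] is odd, being prime to the even [m], so the congruences of the
   integral model [(x1, y1)] descend to its quotients by powers of [n]. *)
move=> p2; apply: kraus_scale; apply: (@kraus_unscale n);
    last by rewrite -Ex1 -Ey1.
apply/negP => n2; have : (2 %| gcdz n m)%Z by rewrite dvdz_gcd n2 Em p2
    dvdz_mulr.
by move: cop; rewrite /coprimez => /eqP ->.
Qed.

(** The five divisibilities are the integrality of the transformed coefficients for [t = 0]. Two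
    models obtained from [E] with scalings [u] and [u1] differ by the scaling [u1 / u], so a
    competitor with a smaller discriminant at [p] yields a further scaling by [p]. *)
Lemma global_minimal_model_criterion (E : weierstrass int) (u r s : int) :
  u != 0 -> discriminant E != 0 ->
  [/\ (u %| wa1 E + 2 * s)%Z, (u ^+ 2 %| wa2 E - s * wa1 E + 3 * r - s ^+ 2)%Z,
      (u ^+ 3 %| wa3 E + r * wa1 E)%Z,
      (u ^+ 4 %| wa4 E - s * wa3 E + 2 * r * wa2 E - r * s * wa1 E
       + 3 * r ^+ 2)%Z &
      (u ^+ 6 %| wa6 E + r * wa4 E + r ^+ 2 * wa2 E + r ^+ 3)%Z] ->
  (forall p, prime p -> ~ reducible_at p E u) ->
  global_minimal_model (to_rat E)
    (change_variables (to_rat E) u%:~R r%:~R s%:~R 0).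
Proof.
move=> u0 D0 [/dvdzP[e1 H1] /dvdzP[e2 H2] /dvdzP[e3 H3] /dvdzP[e4 H4] /dvdzP[e6
    H6]] irr.
have u0' : (u%:~R : rat) != 0 by rewrite intr_eq0.
split; first by exists u%:~R, r%:~R, s%:~R, 0.
pose W0 := Weierstrass e1 e2 e3 e4 e6.
have EW0 : change_variables (to_rat E) u%:~R r%:~R s%:~R 0 = to_rat W0.
  case: E H1 H2 H3 H4 H6 {D0 irr} => a1 a2 a3 a4 a6 /= H1 H2 H3 H4 H6.
  congr Weierstrass; apply: (canLR (mulfK _)); rewrite ?expf_neq0 //.
  - by rewrite -rmorphM /= -H1; ring.
  - by transitivity ((e2 * u ^+ 2)%:~R : rat); [rewrite -H2|]; ring.
  - by transitivity ((e3 * u ^+ 3)%:~R : rat); [rewrite -H3|]; ring.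
  - by transitivity ((e4 * u ^+ 4)%:~R : rat); [rewrite -H4|]; ring.
  - by transitivity ((e6 * u ^+ 6)%:~R : rat); [rewrite -H6|]; ring.
exists W0 => // W1 [u1 [r1 [s1 [t1 [u10 EW1]]]]] p p_pr.
have := c4_change_variables (to_rat E) r%:~R s%:~R 0 u0'.
have := c6_change_variables (to_rat E) r%:~R s%:~R 0 u0'.
have := discriminant_change_variables (to_rat E) r%:~R s%:~R 0 u0'.
have := c4_change_variables (to_rat E) r1 s1 t1 u10.
have := c6_change_variables (to_rat E) r1 s1 t1 u10.
have := discriminant_change_variables (to_rat E) r1 s1 t1 u10.
rewrite EW0 -EW1 !c4_to_rat !c6_to_rat !discriminant_to_rat =>
    D1 y1 x1 D2 y2 x2.
have D00 : discriminant W0 != 0.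
  apply: contraNneq D0 => W00; move: D2; rewrite W00 mulr0 => /eqP.
  by rewrite intr_eq0.
rewrite leqNgt; apply/negP => lt_D.
have quot k (e w w1 : rat) : e = u%:~R ^+ k * w -> e = u1 ^+ k * w1 ->
    w = (u1 / u%:~R) ^+ k * w1.
  move=> -> E1; rewrite expr_div_n mulrAC -E1 mulrAC mulfV ?mul1r //.
  by rewrite expf_neq0.
have v0 : u1 / u%:~R != 0 by rewrite mulf_neq0 ?invr_eq0.
have [x [y [z [Ex Ey Ez K]]]] := scaling_logn p_pr v0 D00 (quot _ _ _ _ x2 x1)
  (quot _ _ _ _ y2 y1) (quot _ _ _ _ D2 D1) (kraus_c4_c6 W1) lt_D.
apply: (irr p p_pr); exists x, y, z; split => //; apply: (@intr_inj rat).
- by rewrite x2 Ex; ring.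
- by rewrite y2 Ey; ring.
- by rewrite D2 Ez; ring.
Qed.

(** * Cuspidal reduction at the primes above 3 *)

Lemma dvdz_lincomb (d x y m n : int) :
  (d %| x)%Z -> (d %| y)%Z -> (d %| m * x + n * y)%Z.
Proof. by move=> dx dy; rewrite rpredD ?dvdz_mull. Qed.

Lemma prime_dvdzM (p : nat) (m n : int) : prime p ->
  (p%:Z %| m * n)%Z -> (p%:Z %| m)%Z \/ (p%:Z %| n)%Z.
Proof. by move=> p_pr; rewrite !dvdzE abszM Euclid_dvdM // => /orP. Qed.

Lemma prime_dvdzX (p : nat) (m : int) (k : nat) : prime p ->
  (p%:Z %| m ^+ k)%Z -> (p%:Z %| m)%Z.
Proof.
by move=> p_pr; rewrite !dvdzE abszX => /= pm; move: (pm);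
    rewrite Euclid_dvdX // => /andP[].
Qed.

Lemma prime_coprimez (p : nat) (a b : int) : prime p -> coprimez a b ->
  (p%:Z %| a)%Z -> (p%:Z %| b)%Z -> False.
Proof.
move=> p_pr cop pa pb; have : (p%:Z %| gcdz a b)%Z by rewrite dvdz_gcd pa pb.
by move: cop; rewrite /coprimez => /eqP->; rewrite dvdzE Euclid_dvd1.
Qed.

Lemma dvdz_smooth (p : nat) (x : int) (i j : nat) : prime p -> (3 < p)%N ->
  (p%:Z %| 2 ^+ i * 3 ^+ j * x)%Z -> (p%:Z %| x)%Z.
Proof.
move=> p_pr p3 /(prime_dvdzM p_pr)[/(prime_dvdzM p_pr)[]|//] /(prime_dvdzX
    p_pr);
  by rewrite dvdzE /= => /dvdn_leq; lia.
Qed.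

(** The first identity eliminates [a] between two binary forms and leaves [p] dividing [W] or [b].
    The second says that [g] is monic in [a] up to sign, so [p | b] would give [p | a]. The factor
    [W] isolates the exceptional primes 5 and 7. *)
Lemma bezout_common_prime (p : nat) (a b f g U V W s B : int) (i j n m : nat) :
  prime p -> (3 < p)%N -> coprimez a b -> (p%:Z %| f)%Z -> (p%:Z %| g)%Z ->
  U * f + V * g = 2 ^+ i * 3 ^+ j * (W * b ^+ n) -> s * g + B * b = a ^+ m ->
  (p%:Z %| W)%Z.
Proof.
move=> p_pr p3 cop pf pg Ebez Emon.
have /(dvdz_smooth p_pr p3)/(prime_dvdzM p_pr)[//|/(prime_dvdzX p_pr) pb] :
  (p%:Z %| 2 ^+ i * 3 ^+ j * (W * b ^+ n))%Z.
  by rewrite -Ebez dvdz_lincomb.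
case: (prime_coprimez p_pr cop _ pb); apply: (prime_dvdzX p_pr (k := m)).
by rewrite -Emon dvdz_lincomb.
Qed.

Lemma bezout_no_common_prime (p : nat) (a b f g U V s B : int) (i j n m : nat) :
  prime p -> (3 < p)%N -> coprimez a b -> (p%:Z %| f)%Z -> (p%:Z %| g)%Z ->
  U * f + V * g = 2 ^+ i * 3 ^+ j * b ^+ n -> s * g + B * b = a ^+ m -> False.
Proof.
move=> p_pr p3 cop pf pg Ebez Emon.
have := @bezout_common_prime p a b f g U V 1 s B i j n m p_pr p3 cop pf pg.
by rewrite mul1r dvdzE Euclid_dvd1 // => H; have := H Ebez Emon.
Qed.

(* c4 = c6 = 0 modulo p forces b2 = a3 = 0, or a1^2 = 12 a2 and
   8 a1 a2 = 9 a3; here a3 = g a2 with a2 and g of small degree. *)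
Lemma cuspidal_cases (p : nat) (a1 a2 g : int) : prime p -> (3 < p)%N ->
  (p%:Z %| c4 (Weierstrass a1 a2 (g * a2) 0 0))%Z ->
  (p%:Z %| c6 (Weierstrass a1 a2 (g * a2) 0 0))%Z ->
  [\/ (p%:Z %| a2)%Z /\ (p%:Z %| a1)%Z,
      (p%:Z %| g)%Z /\ (p%:Z %| a1 ^+ 2 + 4 * a2)%Z |
      (p%:Z %| 8 * a1 - 9 * g)%Z /\ (p%:Z %| a1 ^+ 2 - 12 * a2)%Z].
Proof.
move=> p_pr p3 /= pc4 pc6.
set b2 := a1 ^+ 2 + 4 * a2 in pc4 pc6 *; set a3 := g * a2 in pc4 pc6.
have a3_case : (p%:Z %| a3)%Z -> [\/ (p%:Z %| a2)%Z /\ (p%:Z %| a1)%Z,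
      (p%:Z %| g)%Z /\ (p%:Z %| b2)%Z |
      (p%:Z %| 8 * a1 - 9 * g)%Z /\ (p%:Z %| a1 ^+ 2 - 12 * a2)%Z].
  move=> pa3; have pb2 : (p%:Z %| b2)%Z.
    apply: (prime_dvdzX p_pr (k := 2)).
    have := dvdz_lincomb 1 (24 * a1) pc4 pa3; congr (_ %| _)%Z; ring.
  case/(prime_dvdzM p_pr): (pa3) => [|pa2]; first by constructor 2.
  constructor 1; split=> //; apply: (prime_dvdzX p_pr (k := 2)).
  by have := dvdz_lincomb 1 (- 4) pb2 pa2; congr (_ %| _)%Z; rewrite /b2; ring.
(* Since [c4 = b2^2 - 24 a1 a3], the combination [b2 c4 + c6] cancels [b2^3] and leaves
   [12 a3 (a1 b2 - 18 a3)]. The later combinations eliminate in the same way until each alternative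
   is a product of forms of low degree. *)
have : (p%:Z %| 2 ^+ 3 * 3 ^+ 1 * (a3 * (a1 * b2 - 18 * a3)))%Z.
  have := dvdz_lincomb (2 * b2) 2 pc4 pc6; congr (_ %| _)%Z; ring.
case/(dvdz_smooth p_pr p3)/(prime_dvdzM p_pr) => [/a3_case //|pe].
have : (p%:Z %| 2 ^+ 1 * 3 ^+ 1 * (b2 * (a1 ^+ 2 - 12 * a2)))%Z.
  by have := dvdz_lincomb (- 18) (24 * a1) pc4 pe; congr (_ %| _)%Z;
    rewrite /b2; ring.
case/(dvdz_smooth p_pr p3)/(prime_dvdzM p_pr) => [pb2|pq].
  apply: a3_case; apply: (dvdz_smooth (i := 1) (j := 2) p_pr p3).
  have := dvdz_lincomb (- 1) a1 pe pb2; congr (_ %| _)%Z; ring.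
have : (p%:Z %| 2 ^+ 1 * 3 ^+ 0 * (a2 * (8 * a1 - 9 * g)))%Z.
  by have := dvdz_lincomb 1 (- a1) pe pq; congr (_ %| _)%Z; rewrite /b2 /a3;
      ring.
case/(dvdz_smooth p_pr p3)/(prime_dvdzM p_pr) => [pa2|]; last by constructor 3.
by apply: a3_case; exact: dvdz_mull.
Qed.

Lemma residue (p : nat) (a b : int) : prime p -> ~~ (p%:Z %| b)%Z ->
  exists i k, [/\ 0 <= i, i < p%:Z & a = i * b + p%:Z * k].
Proof.
move=> p_pr pb; have p0 : p%:Z != 0 by rewrite -lt0n prime_gt0.
have : coprimez b p%:Z.
  by rewrite coprimez_sym /coprimez /gcdz; rewrite dvdzE -prime_coprime in pb.
case/coprimezP=> -[x y] /= Exy.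
exists ((a * x) %% p)%Z, (a * y + b * ((a * x) %/ p)%Z).
split; [exact: modz_ge0 | by rewrite -{2}(gez0_abs (isT : 0 <= p%:Z)) ltz_mod|].
rewrite -[LHS]mulr1 -Exy.
have := divz_eq (a * x) p%:Z; move: (_ %/ _)%Z (_ %% _)%Z => q r E.
have -> : a * (x * b + y * p) = a * x * b + a * y * p by ring.
by rewrite E; ring.
Qed.

(* Literals are unary, hence the base 1000 notation of large coefficients. *)
Lemma cuspidal_C5 (a b d : int) (p : nat) : coprimez a b -> prime p ->
  (3 < p)%N -> (p%:Z %| c4 (E_ C5 a b d))%Z -> (p%:Z %| c6 (E_ C5 a b d))%Z ->
  p = 5.
Proof.
move=> cop p_pr p3.
rewrite (_ : E_ C5 a b d = Weierstrass
    (a - b)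
    (- (a * b))
    (a * (- (a * b))) 0 0);
  last by congr Weierstrass; ring.
move=> pc4 pc6; case: (cuspidal_cases p_pr p3 pc4 pc6) => -[pf pg] {pc4 pc6}.
- exfalso; apply: (@bezout_no_common_prime p a b _ _
    (- 1)
    (- b)
    1
    1
    0 0 2 1) pf pg _ _ => //; ring.
- exfalso; apply: (@bezout_no_common_prime p a b _ _
    (- a + 6 * b)
    1
    1
    (6 * a - b)
    0 0 2 2) pf pg _ _ => //; ring.
- have pW : (p%:Z %| 5)%Z.
    apply: (@bezout_common_prime p a b _ _
    (- a - 2 * b)
    (- 1)
    5 1
    (- (10 * a) - b)
    0 1 2 2) pf pg _ _ => //; ring.
  by apply/eqP; rewrite -(dvdn_prime2 p_pr).
Qed.

Lemma cuspidal_C6 (a b d : int) (p : nat) : coprimez a b -> prime p ->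
  (3 < p)%N -> (p%:Z %| c4 (E_ C6 a b d))%Z -> (p%:Z %| c6 (E_ C6 a b d))%Z ->
  False.
Proof.
move=> cop p_pr p3.
rewrite (_ : E_ C6 a b d = Weierstrass
    (a - b)
    (- (a * b) - b ^+ 2)
    (a * (- (a * b) - b ^+ 2)) 0 0);
  last by congr Weierstrass; ring.
move=> pc4 pc6; case: (cuspidal_cases p_pr p3 pc4 pc6) => -[pf pg] {pc4 pc6}.
- by apply: (@bezout_no_common_prime p a b _ _
    (- 1)
    (- b)
    1
    1
    1 0 2 1) pf pg _ _ => //; ring.
- by apply: (@bezout_no_common_prime p a b _ _
    (a - 6 * b)
    (- 1)
    1
    (6 * a + 3 * b)
    0 1 2 2) pf pg _ _ => //; ring.
- by apply: (@bezout_no_common_prime p a b _ _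
    (- a - 2 * b)
    (- 1)
    1
    (- (10 * a) - 13 * b)
    0 1 2 2) pf pg _ _ => //; ring.
Qed.

Lemma cuspidal_C7 (a b d : int) (p : nat) : coprimez a b -> prime p ->
  (3 < p)%N -> (p%:Z %| c4 (E_ C7 a b d))%Z -> (p%:Z %| c6 (E_ C7 a b d))%Z ->
  p = 7.
Proof.
move=> cop p_pr p3.
rewrite (_ : E_ C7 a b d = Weierstrass
    (a ^+ 2 + a * b - b ^+ 2)
    (a ^+ 2 * b ^+ 2 - a * b ^+ 3)
    ((a ^+ 2) * (a ^+ 2 * b ^+ 2 - a * b ^+ 3)) 0 0);
  last by congr Weierstrass; ring.
move=> pc4 pc6; case: (cuspidal_cases p_pr p3 pc4 pc6) => -[pf pg] {pc4 pc6}.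
- exfalso; apply: (@bezout_no_common_prime p a b _ _
    (- (2 * a) - 3 * b)
    (2 * a * b ^+ 2 - b ^+ 3)
    1
    (- a + b)
    0 0 5 2) pf pg _ _ => //; ring.
- exfalso; apply: (@bezout_no_common_prime p a b _ _
    (- (6 * a ^+ 3) - 13 * a ^+ 2 * b - 20 * a * b ^+ 2 + 33 * b ^+ 3)
    (6 * a + b)
    1
    (- (2 * a ^+ 3) - 3 * a ^+ 2 * b + 6 * a * b ^+ 2 - b ^+ 3)
    0 0 5 4) pf pg _ _ => //; ring.
- have pW : (p%:Z %| 7)%Z.
    apply: (@bezout_common_prime p a b _ _
    (134 * a ^+ 3 + 425 * a ^+ 2 * b - 1244 * a * b ^+ 2 - 117 * b ^+ 3)
    (134 * a - 915 * b)
    7 1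
    (- (2 * a ^+ 3) + 13 * a ^+ 2 * b - 10 * a * b ^+ 2 - b ^+ 3)
    0 1 5 4) pf pg _ _ => //; ring.
  by apply/eqP; rewrite -(dvdn_prime2 p_pr).
Qed.

Lemma cuspidal_C8 (a b d : int) (p : nat) : coprimez a b -> prime p ->
  (3 < p)%N -> (p%:Z %| c4 (E_ C8 a b d))%Z -> (p%:Z %| c6 (E_ C8 a b d))%Z ->
  False.
Proof.
move=> cop p_pr p3.
rewrite (_ : E_ C8 a b d = Weierstrass
    (- a ^+ 2 + 4 * a * b - 2 * b ^+ 2)
    (- (a ^+ 2 * b ^+ 2) + 3 * a * b ^+ 3 - 2 * b ^+ 4)
    ((a * b) * (- (a ^+ 2 * b ^+ 2) + 3 * a * b ^+ 3 - 2 * b ^+ 4)) 0 0);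
  last by congr Weierstrass; ring.
move=> pc4 pc6; case: (cuspidal_cases p_pr p3 pc4 pc6) => -[pf pg] {pc4 pc6}.
- by apply: (@bezout_no_common_prime p a b _ _
    (a - 4 * b)
    (- (a * b ^+ 2) + 3 * b ^+ 3)
    (-1)
    (4 * a - 2 * b)
    1 0 5 2) pf pg _ _ => //; ring.
- by apply: (@bezout_no_common_prime p a b _ _
    (a ^+ 3 - 8 * a ^+ 2 * b + 16 * a * b ^+ 2 - 4 * b ^+ 3)
    (- b)
    1
    (8 * a ^+ 3 - 16 * a ^+ 2 * b + 4 * a * b ^+ 2 + 4 * b ^+ 3)
    2 0 5 4) pf pg _ _ => //; ring.
- by apply: (@bezout_no_common_prime p a b _ _
    (365 * a ^+ 3 - 2488 * a ^+ 2 * b + 8736 * a * b ^+ 2 - 8644 * b ^+ 3)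
    (2920 * a - 4939 * b)
    1
    (8 * a ^+ 3 - 32 * a ^+ 2 * b + 52 * a * b ^+ 2 - 28 * b ^+ 3)
    2 1 5 4) pf pg _ _ => //; ring.
Qed.

Lemma cuspidal_C9 (a b d : int) (p : nat) : coprimez a b -> prime p ->
  (3 < p)%N -> (p%:Z %| c4 (E_ C9 a b d))%Z -> (p%:Z %| c6 (E_ C9 a b d))%Z ->
  False.
Proof.
move=> cop p_pr p3.
rewrite (_ : E_ C9 a b d = Weierstrass
    (a ^+ 3 + a * b ^+ 2 - b ^+ 3)
    (a ^+ 4 * b ^+ 2 - 2 * a ^+ 3 * b ^+ 3 + 2 * a ^+ 2 * b ^+ 4 - a * b ^+ 5)
    ((a ^+ 3) * (a ^+ 4 * b ^+ 2 - 2 * a ^+ 3 * b ^+ 3 + 2 * a ^+ 2 * b ^+ 4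
     - a * b ^+ 5)) 0 0);
  last by congr Weierstrass; ring.
move=> pc4 pc6; case: (cuspidal_cases p_pr p3 pc4 pc6) => -[pf pg] {pc4 pc6}.
- by apply: (@bezout_no_common_prime p a b _ _
    (- (7 * a ^+ 2) - 5 * a * b - 11 * b ^+ 2)
    (7 * a ^+ 3 * b ^+ 2 - 9 * a ^+ 2 * b ^+ 3 + 8 * a * b ^+ 4 - 3 * b ^+ 5)
    1
    (- (a * b) + b ^+ 2)
    0 1 8 3) pf pg _ _ => //; ring.
- by apply: (@bezout_no_common_prime p a b _ _
    (- (27 * a ^+ 5) - 6 * a ^+ 4 * b - 163 * a ^+ 3 * b ^+ 2
     + 234 * a ^+ 2 * b ^+ 3 - 189 * a * b ^+ 4 + 118 * b ^+ 5)
    (27 * a ^+ 2 + 6 * a * b + b ^+ 2)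
    1
    (- (6 * a ^+ 4 * b) + 10 * a ^+ 3 * b ^+ 2 - 9 * a ^+ 2 * b ^+ 3
     + 6 * a * b ^+ 4 - b ^+ 5)
    0 0 8 6) pf pg _ _ => //; ring.
- by apply: (@bezout_no_common_prime p a b _ _
    (283 * a ^+ 5 + 350 * a ^+ 4 * b - 2397 * a ^+ 3 * b ^+ 2
     + 3262 * a ^+ 2 * b ^+ 3 - 2475 * a * b ^+ 4 - 230 * b ^+ 5)
    (283 * a ^+ 2 + 350 * a * b - 1831 * b ^+ 2)
    1
    (10 * a ^+ 4 * b - 22 * a ^+ 3 * b ^+ 2 + 23 * a ^+ 2 * b ^+ 3
     - 10 * a * b ^+ 4 - b ^+ 5)
    0 2 8 6) pf pg _ _ => //; ring.
Qed.

Lemma cuspidal_C10 (a b d : int) (p : nat) : coprimez a b -> prime p ->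
  (3 < p)%N -> (p%:Z %| c4 (E_ C10 a b d))%Z -> (p%:Z %| c6 (E_ C10 a b d))%Z ->
  p = 5.
Proof.
move=> cop p_pr p3.
rewrite (_ : E_ C10 a b d = Weierstrass
    (a ^+ 3 - 2 * a ^+ 2 * b - 2 * a * b ^+ 2 + 2 * b ^+ 3)
    (- (a ^+ 3 * b ^+ 3) + 3 * a ^+ 2 * b ^+ 4 - 2 * a * b ^+ 5)
    ((a ^+ 3 - 3 * a ^+ 2 * b + a * b ^+ 2) * (- (a ^+ 3 * b ^+ 3)
     + 3 * a ^+ 2 * b ^+ 4 - 2 * a * b ^+ 5)) 0 0);
  last by congr Weierstrass; ring.
move=> pc4 pc6; case: (cuspidal_cases p_pr p3 pc4 pc6) => -[pf pg] {pc4 pc6}.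
- exfalso; apply: (@bezout_no_common_prime p a b _ _
    (2 * a ^+ 2 - 3 * a * b - 6 * b ^+ 2)
    (2 * a ^+ 2 * b ^+ 3 - 5 * a * b ^+ 4 + b ^+ 5)
    1
    (2 * a ^+ 2 + 2 * a * b - 2 * b ^+ 2)
    1 0 8 3) pf pg _ _ => //; ring.
- have pW : (p%:Z %| 5)%Z.
    apply: (@bezout_common_prime p a b _ _
    (- (49 * a ^+ 5) + 180 * a ^+ 4 * b + 60 * a ^+ 3 * b ^+ 2
     - 372 * a ^+ 2 * b ^+ 3 - 520 * a * b ^+ 4 + 604 * b ^+ 5)
    (49 * a ^+ 2 - 131 * a * b + 5 * b ^+ 2)
    5 1
    (4 * a ^+ 5 - 8 * a ^+ 3 * b ^+ 2 - 8 * a ^+ 2 * b ^+ 3 + 16 * a * b ^+ 4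
     - 4 * b ^+ 5)
    2 0 8 6) pf pg _ _ => //; ring.
  by apply/eqP; rewrite -(dvdn_prime2 p_pr).
- exfalso; apply: (@bezout_no_common_prime p a b _ _
    (- (1873 * a ^+ 5) + 5156 * a ^+ 4 * b + 6428 * a ^+ 3 * b ^+ 2
     - (36 * 1000 + 932) * a ^+ 2 * b ^+ 3 + (28 * 1000 + 872) * a * b ^+ 4
     + 6012 * b ^+ 5)
    (- (1873 * a ^+ 2) + (18 * 1000 + 267) * a * b - (24 * 1000 + 45) * b ^+ 2)
    1
    (4 * a ^+ 5 - 24 * a ^+ 3 * b ^+ 2 + 40 * a ^+ 2 * b ^+ 3 - 16 * a * b ^+ 4
     - 4 * b ^+ 5)
    2 1 8 6) pf pg _ _ => //; ring.
Qed.

Lemma cuspidal_C12 (a b d : int) (p : nat) : coprimez a b -> prime p ->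
  (3 < p)%N -> (p%:Z %| c4 (E_ C12 a b d))%Z -> (p%:Z %| c6 (E_ C12 a b d))%Z ->
  False.
Proof.
move=> cop p_pr p3.
rewrite (_ : E_ C12 a b d = Weierstrass
    (- a ^+ 4 + 2 * a ^+ 3 * b + 2 * a ^+ 2 * b ^+ 2 - 8 * a * b ^+ 3
     + 6 * b ^+ 4)
    (a ^+ 7 * b - 9 * a ^+ 6 * b ^+ 2 + 36 * a ^+ 5 * b ^+ 3
     - 83 * a ^+ 4 * b ^+ 4 + 119 * a ^+ 3 * b ^+ 5 - 106 * a ^+ 2 * b ^+ 6
     + 54 * a * b ^+ 7 - 12 * b ^+ 8)
    ((- a ^+ 4 + 3 * a ^+ 3 * b - 3 * a ^+ 2 * b ^+ 2
     + a * b ^+ 3) * (a ^+ 7 * b - 9 * a ^+ 6 * b ^+ 2 + 36 * a ^+ 5 * b ^+ 3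
     - 83 * a ^+ 4 * b ^+ 4 + 119 * a ^+ 3 * b ^+ 5 - 106 * a ^+ 2 * b ^+ 6
     + 54 * a * b ^+ 7 - 12 * b ^+ 8)) 0 0);
  last by congr Weierstrass; ring.
move=> pc4 pc6; case: (cuspidal_cases p_pr p3 pc4 pc6) => -[pf pg] {pc4 pc6}.
- by apply: (@bezout_no_common_prime p a b _ _
    (- (25 * a ^+ 3) + 23 * a ^+ 2 * b + 77 * a * b ^+ 2 - 122 * b ^+ 3)
    (- (25 * a ^+ 6 * b) + 198 * a ^+ 5 * b ^+ 2 - 684 * a ^+ 4 * b ^+ 3
     + 1316 * a ^+ 3 * b ^+ 4 - 1484 * a ^+ 2 * b ^+ 5 + 928 * a * b ^+ 6
     - 243 * b ^+ 7)
    (-1)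
    (2 * a ^+ 3 + 2 * a ^+ 2 * b - 8 * a * b ^+ 2 + 6 * b ^+ 3)
    1 1 11 4) pf pg _ _ => //; ring.
- by apply: (@bezout_no_common_prime p a b _ _
    (109 * a ^+ 7 + 144 * a ^+ 6 * b - 3732 * a ^+ 5 * b ^+ 2 + (13 * 1000
     + 380) * a ^+ 4 * b ^+ 3 - (22 * 1000 + 944) * a ^+ 3 * b ^+ 4
     + (21 * 1000 + 36) * a ^+ 2 * b ^+ 5 - 9480 * a * b ^+ 6 + 1164 * b ^+ 7)
    (109 * a ^+ 3 - 183 * a ^+ 2 * b + 87 * a * b ^+ 2 - b ^+ 3)
    1
    (36 * a ^+ 6 * b - 168 * a ^+ 5 * b ^+ 2 + 372 * a ^+ 4 * b ^+ 3
     - 468 * a ^+ 3 * b ^+ 4 + 336 * a ^+ 2 * b ^+ 5 - 120 * a * b ^+ 6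
     + 12 * b ^+ 7)
    2 1 11 8) pf pg _ _ => //; ring.
- by apply: (@bezout_no_common_prime p a b _ _
    (a ^+ 7 - 16 * a ^+ 6 * b + 108 * a ^+ 5 * b ^+ 2 - 396 * a ^+ 4 * b ^+ 3
     + 848 * a ^+ 3 * b ^+ 4 - 1076 * a ^+ 2 * b ^+ 5 + 760 * a * b ^+ 6
     - 228 * b ^+ 7)
    (- a ^+ 3 + 11 * a ^+ 2 * b - 43 * a * b ^+ 2 + 61 * b ^+ 3)
    1
    (16 * a ^+ 7 - 108 * a ^+ 6 * b + 408 * a ^+ 5 * b ^+ 2
     - 956 * a ^+ 4 * b ^+ 3 + 1436 * a ^+ 3 * b ^+ 4 - 1360 * a ^+ 2 * b ^+ 5
     + 744 * a * b ^+ 6 - 180 * b ^+ 7)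
    2 2 11 8) pf pg _ _ => //; ring.
Qed.

Lemma cuspidal_C2xC4 (a b d : int) (p : nat) : coprimez a b -> prime p ->
  (3 < p)%N -> (p%:Z %| c4 (E_ C2xC4 a b d))%Z ->
   (p%:Z %| c6 (E_ C2xC4 a b d))%Z ->
  False.
Proof.
move=> cop p_pr p3.
rewrite (_ : E_ C2xC4 a b d = Weierstrass
    a
    (- (a * b) - 4 * b ^+ 2)
    (a * (- (a * b) - 4 * b ^+ 2)) 0 0);
  last by congr Weierstrass; ring.
move=> pc4 pc6; case: (cuspidal_cases p_pr p3 pc4 pc6) => -[pf pg] {pc4 pc6}.
- by apply: (@bezout_no_common_prime p a b _ _
    (- 1)
    (- b)
    1
    0
    2 0 2 1) pf pg _ _ => //; ring.
- by apply: (@bezout_no_common_prime p a b _ _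
    (a - 4 * b)
    (- 1)
    1
    (4 * a + 16 * b)
    4 0 2 2) pf pg _ _ => //; ring.
- by apply: (@bezout_no_common_prime p a b _ _
    (a + 12 * b)
    1
    1
    (- (12 * a) - 48 * b)
    4 1 2 2) pf pg _ _ => //; ring.
Qed.

(** The roles of [a] and [b] are exchanged: the forms are monic in [b], while their leading
    coefficients in [a] (-19, 321, 481) contain primes above 3. *)
Lemma cuspidal_C2xC6 (a b d : int) (p : nat) : coprimez a b -> prime p ->
  (3 < p)%N -> (p%:Z %| c4 (E_ C2xC6 a b d))%Z ->
   (p%:Z %| c6 (E_ C2xC6 a b d))%Z ->
  False.
Proof.
move=> cop p_pr p3.
rewrite coprimez_sym in cop.
rewrite (_ : E_ C2xC6 a b d = Weierstrass
    (b ^+ 2 + 2 * b * a - 19 * a ^+ 2)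
    (2 * b ^+ 3 * a - 14 * b ^+ 2 * a ^+ 2 + 22 * b * a ^+ 3 - 10 * a ^+ 4)
    ((b ^+ 2 - 9 * a ^+ 2) * (2 * b ^+ 3 * a - 14 * b ^+ 2 * a ^+ 2
     + 22 * b * a ^+ 3 - 10 * a ^+ 4)) 0 0);
  last by congr Weierstrass; ring.
move=> pc4 pc6; case: (cuspidal_cases p_pr p3 pc4 pc6) => -[pf pg] {pc4 pc6}.
- by apply: (@bezout_no_common_prime p b a _ _
    (- (3 * b) - 17 * a)
    (6 * b ^+ 2 * a - 20 * b * a ^+ 2 - 18 * a ^+ 3)
    1
    (- (2 * b) + 19 * a)
    9 0 5 2) pf pg _ _ => //; ring.
- by apply: (@bezout_no_common_prime p b a _ _
    (5 * b ^+ 3 + 77 * b ^+ 2 * a - 201 * b * a ^+ 2 - 777 * a ^+ 3)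
    (- (5 * b) - 17 * a)
    1
    (- (12 * b ^+ 3) + 90 * b ^+ 2 * a - 12 * b * a ^+ 2 - 321 * a ^+ 3)
    9 1 5 4) pf pg _ _ => //; ring.
- by apply: (@bezout_no_common_prime p b a _ _
    (3 * b ^+ 3 - 37 * b ^+ 2 * a + 97 * b * a ^+ 2 - 191 * a ^+ 3)
    (3 * b - 25 * a)
    1
    (20 * b ^+ 3 - 134 * b ^+ 2 * a + 340 * b * a ^+ 2 - 481 * a ^+ 3)
    9 1 5 4) pf pg _ _ => //; ring.
Qed.

(** Writing the forms in [a] and [2 b] keeps the certificates small; the extra powers of 2 end up in
    [2^15], harmless for [p > 3]. *)
Lemma cuspidal_C2xC8 (a b d : int) (p : nat) : coprimez a b -> prime p ->
  (3 < p)%N -> (p%:Z %| c4 (E_ C2xC8 a b d))%Z ->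
   (p%:Z %| c6 (E_ C2xC8 a b d))%Z ->
  False.
Proof.
move=> cop p_pr p3.
rewrite (_ : E_ C2xC8 a b d = Weierstrass
    (- a ^+ 4 - 4 * a ^+ 3 * (2 * b) - 6 * a ^+ 2 * (2 * b) ^+ 2
     + 4 * (2 * b) ^+ 4)
    (- (a ^+ 6 * (2 * b) ^+ 2) - 7 * a ^+ 5 * (2 * b) ^+ 3
     - 20 * a ^+ 4 * (2 * b) ^+ 4 - 30 * a ^+ 3 * (2 * b) ^+ 5
     - 24 * a ^+ 2 * (2 * b) ^+ 6 - 8 * a * (2 * b) ^+ 7)
    ((- (a ^+ 3 * (2 * b)) - 2 * a ^+ 2 * (2 * b) ^+ 2 + 2 * a * (2 * b) ^+ 3
     + 4 * (2 * b) ^+ 4) * (- (a ^+ 6 * (2 * b) ^+ 2)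
     - 7 * a ^+ 5 * (2 * b) ^+ 3 - 20 * a ^+ 4 * (2 * b) ^+ 4
     - 30 * a ^+ 3 * (2 * b) ^+ 5 - 24 * a ^+ 2 * (2 * b) ^+ 6
     - 8 * a * (2 * b) ^+ 7)) 0 0);
  last by congr Weierstrass; ring.
move=> pc4 pc6; case: (cuspidal_cases p_pr p3 pc4 pc6) => -[pf pg] {pc4 pc6}.
- by apply: (@bezout_no_common_prime p a b _ _
    (21 * a ^+ 3 + 58 * a ^+ 2 * (2 * b) + 54 * a * (2 * b) ^+ 2
     - 68 * (2 * b) ^+ 3)
    (- (21 * a ^+ 5 * (2 * b) ^+ 2) - 121 * a ^+ 4 * (2 * b) ^+ 3
     - 270 * a ^+ 3 * (2 * b) ^+ 4 - 294 * a ^+ 2 * (2 * b) ^+ 5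
     - 136 * a * (2 * b) ^+ 6 + 4 * (2 * b) ^+ 7)
    (-1)
    (2 * (- (4 * a ^+ 3) - 6 * a ^+ 2 * (2 * b) + 4 * (2 * b) ^+ 3))
    15 0 11 4) pf pg _ _ => //; ring.
- by apply: (@bezout_no_common_prime p a b _ _
    (21 * a ^+ 7 + 138 * a ^+ 6 * (2 * b) + 307 * a ^+ 5 * (2 * b) ^+ 2
     - 18 * a ^+ 4 * (2 * b) ^+ 3 - 1066 * a ^+ 3 * (2 * b) ^+ 4
     - 1672 * a ^+ 2 * (2 * b) ^+ 5 - 640 * a * (2 * b) ^+ 6
     + 240 * (2 * b) ^+ 7)
    (21 * a ^+ 2 * (2 * b) + 12 * a * (2 * b) ^+ 2 - 59 * (2 * b) ^+ 3)
    1
    (2 * (- (8 * a ^+ 7) - 24 * a ^+ 6 * (2 * b) - 20 * a ^+ 5 * (2 * b) ^+ 2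
     + 52 * a ^+ 4 * (2 * b) ^+ 3 + 152 * a ^+ 3 * (2 * b) ^+ 4
     + 144 * a ^+ 2 * (2 * b) ^+ 5 + 32 * a * (2 * b) ^+ 6 - 16 * (2 * b) ^+ 7))
    15 0 11 8) pf pg _ _ => //; ring.
- by apply: (@bezout_no_common_prime p a b _ _
    (885 * a ^+ 7 + 6322 * a ^+ 6 * (2 * b) + (29 * 1000
     + 911) * a ^+ 5 * (2 * b) ^+ 2 + (90 * 1000 + 694) * a ^+ 4 * (2 * b) ^+ 3
     + (157 * 1000 + 150) * a ^+ 3 * (2 * b) ^+ 4 + (148 * 1000
     + 808) * a ^+ 2 * (2 * b) ^+ 5 + (73 * 1000 + 920) * a * (2 * b) ^+ 6
     + (12 * 1000 + 656) * (2 * b) ^+ 7)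
    (7080 * a ^+ 3 + (14 * 1000 + 291) * a ^+ 2 * (2 * b) + (13 * 1000
     + 716) * a * (2 * b) ^+ 2 + 3167 * (2 * b) ^+ 3)
    1
    (2 * (- (8 * a ^+ 7) - 40 * a ^+ 6 * (2 * b) - 132 * a ^+ 5 * (2 * b) ^+ 2
     - 268 * a ^+ 4 * (2 * b) ^+ 3 - 328 * a ^+ 3 * (2 * b) ^+ 4
     - 240 * a ^+ 2 * (2 * b) ^+ 5 - 96 * a * (2 * b) ^+ 6 - 16 * (2 * b) ^+ 7))
    15 1 11 8) pf pg _ _ => //; ring.
Qed.

(* The hypotheses say that f has p-adic valuation exactly j. *)
Lemma unit_residue (p : nat) (f x q r : int) (j J n : nat) : prime p ->
  ~~ (p%:Z %| x)%Z -> ~~ (p%:Z %| r)%Z -> (j < J)%N ->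
  f = p%:Z ^+ j * (p%:Z * q + r * x ^+ n) -> (p%:Z ^+ J %| f)%Z -> False.
Proof.
move=> p_pr px pr ltjJ -> /(dvdz_trans (dvdz_exp2l p%:Z ltjJ)).
have p0 : p%:Z ^+ j != 0 by rewrite expf_neq0 // -lt0n prime_gt0.
rewrite exprSr dvdz_mul2l // => pf; have : (p%:Z %| r * x ^+ n)%Z.
  by have := dvdz_lincomb 1 (- q) pf (dvdzz p%:Z); congr (_ %| _)%Z; ring.
case/(prime_dvdzM p_pr) => [|/(prime_dvdzX p_pr)]; exact/negP.
Qed.

(** A free starting point [lo] allows balanced residues, which keep the expansions small. The class
    at infinity, [p | b], is the one where [a] takes over as the unit. *)
Lemma residue_cases (p : nat) (lo a b : int) : prime p -> coprimez a b ->
  (exists k, b = p%:Z * k /\ ~~ (p%:Z %| a)%Z) \/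
  (~~ (p%:Z %| b)%Z /\
   exists i k, [/\ lo <= i, i < lo + p%:Z & a = i * b + p%:Z * k]).
Proof.
move=> p_pr cop; have [/dvdzP[k Ek]|pb] := boolP (p%:Z %| b)%Z.
  left; exists k; split; first by rewrite Ek mulrC.
  apply/negP => /(prime_coprimez p_pr cop); apply.
  by rewrite Ek dvdz_mull.
right; split=> //; have [i [k [i0 ip Ea]]] := residue (a - lo * b) p_pr pb.
exists (lo + i), k; split; [lia | lia |].
by rewrite -[LHS](subrK (lo * b)) Ea; ring.
Qed.

Lemma residue2 (a b : int) : coprimez a b ->
  (exists k, b = 2 * k /\ ~~ (2 %| a)%Z) \/
  (~~ (2 %| b)%Z /\ exists k,
    a = 0 * b + 2 * k \/ a = 1 * b + 2 * k).
Proof.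
case/(@residue_cases 2 0) => // [|[b_unit [i [k [lo_i i_hi ->]]]]];
    first by left.
right; split=> //; exists k.
have : i = 0 \/ i = 1 by lia.
by move=> [->|->]; tauto.
Qed.

Lemma residue3 (a b : int) : coprimez a b ->
  (exists k, b = 3 * k /\ ~~ (3 %| a)%Z) \/
  (~~ (3 %| b)%Z /\ exists k,
    a = -1 * b + 3 * k \/ a = 0 * b + 3 * k \/ a = 1 * b + 3 * k).
Proof.
case/(@residue_cases 3 (-1)) => // [|[b_unit [i [k [lo_i i_hi ->]]]]];
    first by left.
right; split=> //; exists k.
have : i = -1 \/ i = 0 \/ i = 1 by lia.
by move=> [->|[->|->]]; tauto.
Qed.

Lemma residue5 (a b : int) : coprimez a b ->
  (exists k, b = 5 * k /\ ~~ (5 %| a)%Z) \/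
  (~~ (5 %| b)%Z /\ exists k,
    a = -2 * b + 5 * k \/
    a = -1 * b + 5 * k \/
    a = 0 * b + 5 * k \/
    a = 1 * b + 5 * k \/
    a = 2 * b + 5 * k).
Proof.
case/(@residue_cases 5 (-2)) => // [|[b_unit [i [k [lo_i i_hi ->]]]]];
    first by left.
right; split=> //; exists k.
have : i = -2 \/ i = -1 \/ i = 0 \/ i = 1 \/ i = 2 by lia.
by move=> [->|[->|[->|[->|->]]]]; tauto.
Qed.

Lemma residue7 (a b : int) : coprimez a b ->
  (exists k, b = 7 * k /\ ~~ (7 %| a)%Z) \/
  (~~ (7 %| b)%Z /\ exists k,
    a = -3 * b + 7 * k \/
    a = -2 * b + 7 * k \/
    a = -1 * b + 7 * k \/
    a = 0 * b + 7 * k \/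
    a = 1 * b + 7 * k \/
    a = 2 * b + 7 * k \/
    a = 3 * b + 7 * k).
Proof.
case/(@residue_cases 7 (-3)) => // [|[b_unit [i [k [lo_i i_hi ->]]]]];
    first by left.
right; split=> //; exists k.
have : i = -3 \/ i = -2 \/ i = -1 \/ i = 0 \/ i = 1 \/ i = 2 \/ i = 3 by lia.
by move=> [->|[->|[->|[->|[->|[->|->]]]]]]; tauto.
Qed.

(** Modulo 3, [c4 = b2^2 - 24 b4] is [b2^2]. Since [b2] has half the degree of [c4], most classes
    modulo 3 are settled by a much shorter certificate. The exponent 1 is written out to match
    [unit_residue]. *)
Lemma dvd3_b2 (E : weierstrass int) : (3 ^+ 4 %| c4 E)%Z ->
  (3 ^+ 1 %| wa1 E ^+ 2 + 4 * wa2 E)%Z.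
Proof.
case: E => a1 a2 a3 a4 a6 /= dc4; apply: (@prime_dvdzX 3 _ 2 isT).
have d24 : (3 %| 3 * (8 * (2 * a4 + a1 * a3)))%Z by rewrite dvdz_mulr.
have := dvdz_lincomb 1 1 (dvdz_trans (isT : (3 %| 3 ^+ 4)%Z) dc4) d24.
by congr (_ %| _)%Z; ring.
Qed.

(** * The primes 3, 5 and 7 for the families with coprime parameters *)

Lemma irreducible_C5_at3 (a b d : int) : coprimez a b ->
  (3 ^+ 4 %| c4 (E_ C5 a b d))%Z -> False.
Proof.
move=> cop dc4.
have db2 := dvd3_b2 dc4.
move: (residue3 cop) dc4 db2 => [[k [-> x3]]|[x3 [k [->|[->|->]]]]] dc4 db2.
(* After the unit [a] come [q], then [r], [j], [J], [n] of [f = 3^j (3 q + r x^n)], read off from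
   the form expanded on the class; [j < J] is the contradiction. *)
- apply: (@unit_residue 3 _ a (3 * k ^+ 2 - 6 * k * a)
    1 0 1 2 isT x3 _ _ _ db2) => //; rewrite /=; ring.
- apply: (@unit_residue 3 _ b (3 * k ^+ 2 - 8 * k * b + 3 * b ^+ 2)
    (-1) 0 1 2 isT x3 _ _ _ db2) => //; rewrite /=; ring.
- apply: (@unit_residue 3 _ b (3 * k ^+ 2 - 6 * k * b)
    1 0 1 2 isT x3 _ _ _ db2) => //; rewrite /=; ring.
- apply: (@unit_residue 3 _ b (3 * k ^+ 2 - 4 * k * b - b ^+ 2)
    (-1) 0 1 2 isT x3 _ _ _ db2) => //; rewrite /=; ring.
Qed.

(** On the class where [b2] vanishes modulo 3, here [a = - b], the full [c4] is expanded instead: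
    its valuation is exactly 1. The families [C9], [C12] and [C2xC6] have one such class too, with
    valuation 2, still below 4. *)
Lemma irreducible_C7_at3 (a b d : int) : coprimez a b ->
  (3 ^+ 4 %| c4 (E_ C7 a b d))%Z -> False.
Proof.
move=> cop dc4.
have db2 := dvd3_b2 dc4.
move: (residue3 cop) dc4 db2 => [[k [-> x3]]|[x3 [k [->|[->|->]]]]] dc4 db2.
- apply: (@unit_residue 3 _ a (27 * k ^+ 4 - 54 * k ^+ 3 * a
    + 9 * k ^+ 2 * a ^+ 2 + 2 * k * a ^+ 3)
    1 0 1 4 isT x3 _ _ _ db2) => //; rewrite /=; ring.
- apply: (@unit_residue 3 _ b (729 * k ^+ 8 - 972 * k ^+ 7 * b
    - 1134 * k ^+ 6 * b ^+ 2 + 3024 * k ^+ 5 * b ^+ 3 - 2205 * k ^+ 4 * b ^+ 4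
    + 504 * k ^+ 3 * b ^+ 5 + 154 * k ^+ 2 * b ^+ 6 - 100 * k * b ^+ 7
    + 14 * b ^+ 8)
    1 1 4 8 isT x3 _ _ _ dc4) => //; rewrite /=; ring.
- apply: (@unit_residue 3 _ b (27 * k ^+ 4 + 18 * k ^+ 3 * b
    + 9 * k ^+ 2 * b ^+ 2 - 6 * k * b ^+ 3)
    1 0 1 4 isT x3 _ _ _ db2) => //; rewrite /=; ring.
- apply: (@unit_residue 3 _ b (27 * k ^+ 4 + 54 * k ^+ 3 * b
    + 45 * k ^+ 2 * b ^+ 2 + 10 * k * b ^+ 3)
    1 0 1 4 isT x3 _ _ _ db2) => //; rewrite /=; ring.
Qed.

Lemma irreducible_C8_at3 (a b d : int) : coprimez a b ->
  (3 ^+ 4 %| c4 (E_ C8 a b d))%Z -> False.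
Proof.
move=> cop dc4.
have db2 := dvd3_b2 dc4.
move: (residue3 cop) dc4 db2 => [[k [-> x3]]|[x3 [k [->|[->|->]]]]] dc4 db2.
- apply: (@unit_residue 3 _ a (- (108 * k ^+ 4) - 36 * k ^+ 3 * a
    + 48 * k ^+ 2 * a ^+ 2 - 8 * k * a ^+ 3)
    1 0 1 4 isT x3 _ _ _ db2) => //; rewrite /=; ring.
- apply: (@unit_residue 3 _ b (27 * k ^+ 4 - 108 * k ^+ 3 * b
    + 138 * k ^+ 2 * b ^+ 2 - 64 * k * b ^+ 3 + 8 * b ^+ 4)
    1 0 1 4 isT x3 _ _ _ db2) => //; rewrite /=; ring.
- apply: (@unit_residue 3 _ b (27 * k ^+ 4 - 72 * k ^+ 3 * b
    + 48 * k ^+ 2 * b ^+ 2 - 4 * k * b ^+ 3 - b ^+ 4)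
    (-1) 0 1 4 isT x3 _ _ _ db2) => //; rewrite /=; ring.
- apply: (@unit_residue 3 _ b (27 * k ^+ 4 - 36 * k ^+ 3 * b
    - 6 * k ^+ 2 * b ^+ 2 + 8 * k * b ^+ 3)
    1 0 1 4 isT x3 _ _ _ db2) => //; rewrite /=; ring.
Qed.

Lemma irreducible_C9_at3 (a b d : int) : coprimez a b ->
  (3 ^+ 4 %| c4 (E_ C9 a b d))%Z -> False.
Proof.
move=> cop dc4.
have db2 := dvd3_b2 dc4.
move: (residue3 cop) dc4 db2 => [[k [-> x3]]|[x3 [k [->|[->|->]]]]] dc4 db2.
- apply: (@unit_residue 3 _ a (243 * k ^+ 6 - 486 * k ^+ 5 * a
    + 243 * k ^+ 4 * a ^+ 2 - 90 * k ^+ 3 * a ^+ 3 + 18 * k ^+ 2 * a ^+ 4)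
    1 0 1 6 isT x3 _ _ _ db2) => //; rewrite /=; ring.
- apply: (@unit_residue 3 _ b ((19 * 1000 + 683) * k ^+ 12 - (78 * 1000
    + 732) * k ^+ 11 * b + (118 * 1000 + 98) * k ^+ 10 * b ^+ 2 - (52 * 1000
    + 488) * k ^+ 9 * b ^+ 3 - (76 * 1000 + 545) * k ^+ 8 * b ^+ 4
    + (142 * 1000 + 884) * k ^+ 7 * b ^+ 5 - (110 * 1000
    + 322) * k ^+ 6 * b ^+ 6 + (46 * 1000 + 332) * k ^+ 5 * b ^+ 7
    - 8262 * k ^+ 4 * b ^+ 8 - 1644 * k ^+ 3 * b ^+ 9 + 1284 * k ^+ 2 * b ^+ 10
    - 288 * k * b ^+ 11 + 24 * b ^+ 12)
    1 2 4 12 isT x3 _ _ _ dc4) => //; rewrite /=; ring.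
- apply: (@unit_residue 3 _ b (243 * k ^+ 6 + 162 * k ^+ 4 * b ^+ 2
    - 90 * k ^+ 3 * b ^+ 3 + 27 * k ^+ 2 * b ^+ 4 - 6 * k * b ^+ 5)
    1 0 1 6 isT x3 _ _ _ db2) => //; rewrite /=; ring.
- apply: (@unit_residue 3 _ b (243 * k ^+ 6 + 486 * k ^+ 5 * b
    + 567 * k ^+ 4 * b ^+ 2 + 306 * k ^+ 3 * b ^+ 3 + 90 * k ^+ 2 * b ^+ 4
    + 12 * k * b ^+ 5)
    1 0 1 6 isT x3 _ _ _ db2) => //; rewrite /=; ring.
Qed.

Lemma irreducible_C10_at3 (a b d : int) : coprimez a b ->
  (3 ^+ 4 %| c4 (E_ C10 a b d))%Z -> False.
Proof.
move=> cop dc4.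
have db2 := dvd3_b2 dc4.
move: (residue3 cop) dc4 db2 => [[k [-> x3]]|[x3 [k [->|[->|->]]]]] dc4 db2.
- apply: (@unit_residue 3 _ a (972 * k ^+ 6 - 1296 * k ^+ 5 * a
    + 216 * k ^+ 4 * a ^+ 2 + 72 * k ^+ 3 * a ^+ 3 - 4 * k * a ^+ 5)
    1 0 1 6 isT x3 _ _ _ db2) => //; rewrite /=; ring.
- apply: (@unit_residue 3 _ b (243 * k ^+ 6 - 810 * k ^+ 5 * b
    + 945 * k ^+ 4 * b ^+ 2 - 468 * k ^+ 3 * b ^+ 3 + 117 * k ^+ 2 * b ^+ 4
    - 34 * k * b ^+ 5 + 8 * b ^+ 6)
    1 0 1 6 isT x3 _ _ _ db2) => //; rewrite /=; ring.
- apply: (@unit_residue 3 _ b (243 * k ^+ 6 - 324 * k ^+ 5 * b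
    + 72 * k ^+ 3 * b ^+ 3 + 24 * k ^+ 2 * b ^+ 4 - 16 * k * b ^+ 5 + b ^+ 6)
    1 0 1 6 isT x3 _ _ _ db2) => //; rewrite /=; ring.
- apply: (@unit_residue 3 _ b (243 * k ^+ 6 + 162 * k ^+ 5 * b
    - 135 * k ^+ 4 * b ^+ 2 - 108 * k ^+ 3 * b ^+ 3 + 21 * k ^+ 2 * b ^+ 4
    + 10 * k * b ^+ 5)
    1 0 1 6 isT x3 _ _ _ db2) => //; rewrite /=; ring.
Qed.

Lemma irreducible_C12_at3 (a b d : int) : coprimez a b ->
  (3 ^+ 4 %| c4 (E_ C12 a b d))%Z -> False.
Proof.
move=> cop dc4.
have db2 := dvd3_b2 dc4.
move: (residue3 cop) dc4 db2 => [[k [-> x3]]|[x3 [k [->|[->|->]]]]] dc4 db2.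
- apply: (@unit_residue 3 _ a (- ((26 * 1000 + 244) * k ^+ 8) + (87 * 1000
    + 480) * k ^+ 7 * a - (81 * 1000 + 648) * k ^+ 6 * a ^+ 2 + (37 * 1000
    + 908) * k ^+ 5 * a ^+ 3 - (10 * 1000 + 44) * k ^+ 4 * a ^+ 4
    + 1512 * k ^+ 3 * a ^+ 5 - 108 * k ^+ 2 * a ^+ 6)
    1 0 1 8 isT x3 _ _ _ db2) => //; rewrite /=; ring.
- apply: (@unit_residue 3 _ b (2187 * k ^+ 8 - 5832 * k ^+ 7 * b
    - 1944 * k ^+ 6 * b ^+ 2 + (26 * 1000 + 568) * k ^+ 5 * b ^+ 3 - (45 * 1000
    + 414) * k ^+ 4 * b ^+ 4 + (38 * 1000 + 700) * k ^+ 3 * b ^+ 5 - (18 * 1000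
    + 492) * k ^+ 2 * b ^+ 6 + 4732 * k * b ^+ 7 - 504 * b ^+ 8)
    1 0 1 8 isT x3 _ _ _ db2) => //; rewrite /=; ring.
- apply: (@unit_residue 3 _ b ((1594 * 1000 + 323) * k ^+ 16 - ((12 * 1000
    + 754) * 1000 + 584) * k ^+ 15 * b + ((46 * 1000 + 766) * 1000
    + 808) * k ^+ 14 * b ^+ 2 - ((104 * 1000 + 871) * 1000
    + 24) * k ^+ 13 * b ^+ 3 + ((161 * 1000 + 558) * 1000
    + 64) * k ^+ 12 * b ^+ 4 - ((181 * 1000 + 713) * 1000
    + 456) * k ^+ 11 * b ^+ 5 + ((154 * 1000 + 524) * 1000
    + 672) * k ^+ 10 * b ^+ 6 - ((101 * 1000 + 336) * 1000
    + 832) * k ^+ 9 * b ^+ 7 + ((51 * 1000 + 729) * 1000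
    + 840) * k ^+ 8 * b ^+ 8 - ((20 * 1000 + 567) * 1000
    + 520) * k ^+ 7 * b ^+ 9 + (6318 * 1000) * k ^+ 6 * b ^+ 10 - (1472 * 1000
    + 256) * k ^+ 5 * b ^+ 11 + (252 * 1000 + 144) * k ^+ 4 * b ^+ 12
    - (30 * 1000 + 240) * k ^+ 3 * b ^+ 13 + 2400 * k ^+ 2 * b ^+ 14
    - 128 * k * b ^+ 15 + 5 * b ^+ 16)
    1 2 4 16 isT x3 _ _ _ dc4) => //; rewrite /=; ring.
- apply: (@unit_residue 3 _ b (2187 * k ^+ 8 + 5832 * k ^+ 7 * b
    - 1944 * k ^+ 6 * b ^+ 2 + 648 * k ^+ 5 * b ^+ 3 - 54 * k ^+ 4 * b ^+ 4
    - 36 * k ^+ 3 * b ^+ 5 + 12 * k ^+ 2 * b ^+ 6 - 4 * k * b ^+ 7)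
    1 0 1 8 isT x3 _ _ _ db2) => //; rewrite /=; ring.
Qed.

Lemma irreducible_C2xC4_at3 (a b d : int) : coprimez a b ->
  (3 ^+ 4 %| c4 (E_ C2xC4 a b d))%Z -> False.
Proof.
move=> cop dc4.
have db2 := dvd3_b2 dc4.
move: (residue3 cop) dc4 db2 => [[k [-> x3]]|[x3 [k [->|[->|->]]]]] dc4 db2.
- apply: (@unit_residue 3 _ a (- (48 * k ^+ 2) - 4 * k * a)
    1 0 1 2 isT x3 _ _ _ db2) => //; rewrite /=; ring.
- apply: (@unit_residue 3 _ b (3 * k ^+ 2 - 6 * k * b - 4 * b ^+ 2)
    1 0 1 2 isT x3 _ _ _ db2) => //; rewrite /=; ring.
- apply: (@unit_residue 3 _ b (3 * k ^+ 2 - 4 * k * b - 5 * b ^+ 2)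
    (-1) 0 1 2 isT x3 _ _ _ db2) => //; rewrite /=; ring.
- apply: (@unit_residue 3 _ b (3 * k ^+ 2 - 2 * k * b - 6 * b ^+ 2)
    (-1) 0 1 2 isT x3 _ _ _ db2) => //; rewrite /=; ring.
Qed.

Lemma irreducible_C2xC6_at3 (a b d : int) : coprimez a b ->
  (3 ^+ 4 %| c4 (E_ C2xC6 a b d))%Z -> False.
Proof.
move=> cop dc4.
have db2 := dvd3_b2 dc4.
move: (residue3 cop) dc4 db2 => [[k [-> x3]]|[x3 [k [->|[->|->]]]]] dc4 db2.
- apply: (@unit_residue 3 _ a (243 * k ^+ 8 - 1944 * k ^+ 7 * a
    + 5508 * k ^+ 6 * a ^+ 2 - 5832 * k ^+ 5 * a ^+ 3 - 990 * k ^+ 4 * a ^+ 4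
    + 6552 * k ^+ 3 * a ^+ 5 + 868 * k ^+ 2 * a ^+ 6 - 9656 * k * a ^+ 7
    + 5336 * a ^+ 8)
    1 2 4 8 isT x3 _ _ _ dc4) => //; rewrite /=; ring.
- apply: (@unit_residue 3 _ b (8667 * k ^+ 4 - (11 * 1000 + 448) * k ^+ 3 * b
    + 5400 * k ^+ 2 * b ^+ 2 - 1056 * k * b ^+ 3 + 69 * b ^+ 4)
    1 0 1 4 isT x3 _ _ _ db2) => //; rewrite /=; ring.
- apply: (@unit_residue 3 _ b (8667 * k ^+ 4 + 108 * k ^+ 3 * b
    - 270 * k ^+ 2 * b ^+ 2 + 12 * k * b ^+ 3)
    1 0 1 4 isT x3 _ _ _ db2) => //; rewrite /=; ring.
- apply: (@unit_residue 3 _ b (8667 * k ^+ 4 + (11 * 1000 + 664) * k ^+ 3 * b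
    + 5616 * k ^+ 2 * b ^+ 2 + 1152 * k * b ^+ 3 + 85 * b ^+ 4)
    1 0 1 4 isT x3 _ _ _ db2) => //; rewrite /=; ring.
Qed.

Lemma irreducible_C2xC8_at3 (a b d : int) : coprimez a b ->
  (3 ^+ 4 %| c4 (E_ C2xC8 a b d))%Z -> False.
Proof.
move=> cop dc4.
have db2 := dvd3_b2 dc4.
move: (residue3 cop) dc4 db2 => [[k [-> x3]]|[x3 [k [->|[->|->]]]]] dc4 db2.
- apply: (@unit_residue 3 _ a ((8957 * 1000 + 952) * k ^+ 8 - (2985 * 1000
    + 984) * k ^+ 7 * a - (2239 * 1000 + 488) * k ^+ 6 * a ^+ 2 - (393 * 1000
    + 984) * k ^+ 5 * a ^+ 3 - (22 * 1000 + 464) * k ^+ 4 * a ^+ 4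
    + 1440 * k ^+ 3 * a ^+ 5 + 288 * k ^+ 2 * a ^+ 6 + 16 * k * a ^+ 7)
    1 0 1 8 isT x3 _ _ _ db2) => //; rewrite /=; ring.
- apply: (@unit_residue 3 _ b (2187 * k ^+ 8 + 5832 * k ^+ 7 * b
    + 2916 * k ^+ 6 * b ^+ 2 - (11 * 1000 + 16) * k ^+ 5 * b ^+ 3 - (18 * 1000
    + 414) * k ^+ 4 * b ^+ 4 - (12 * 1000 + 168) * k ^+ 3 * b ^+ 5
    - 252 * k ^+ 2 * b ^+ 6 + 3400 * k * b ^+ 7 + 976 * b ^+ 8)
    1 0 1 8 isT x3 _ _ _ db2) => //; rewrite /=; ring.
- apply: (@unit_residue 3 _ b (2187 * k ^+ 8 + (11 * 1000 + 664) * k ^+ 7 * b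
    + (23 * 1000 + 328) * k ^+ 6 * b ^+ 2 + (12 * 1000 + 960) * k ^+ 5 * b ^+ 3
    - (22 * 1000 + 464) * k ^+ 4 * b ^+ 4 - (43 * 1000 + 776) * k ^+ 3 * b ^+ 5
    - (27 * 1000 + 648) * k ^+ 2 * b ^+ 6 - 4096 * k * b ^+ 7 + 1365 * b ^+ 8)
    1 0 1 8 isT x3 _ _ _ db2) => //; rewrite /=; ring.
- apply: (@unit_residue 3 _ b (2187 * k ^+ 8 + (17 * 1000 + 496) * k ^+ 7 * b
    + (57 * 1000 + 348) * k ^+ 6 * b ^+ 2 + (91 * 1000 + 368) * k ^+ 5 * b ^+ 3
    + (55 * 1000 + 26) * k ^+ 4 * b ^+ 4 - (36 * 1000 + 504) * k ^+ 3 * b ^+ 5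
    - (76 * 1000 + 188) * k ^+ 2 * b ^+ 6 - (38 * 1000 + 952) * k * b ^+ 7
    - 4880 * b ^+ 8)
    1 0 1 8 isT x3 _ _ _ db2) => //; rewrite /=; ring.
Qed.

(** [c4] is a unit modulo 5 except on the class [a = 2 b], the root of [8 a1 - 9 g] that produced
    the exceptional prime; there 5 divides [c4] exactly once. For [C10] the same happens on the
    class [a = - b]. *)
Lemma irreducible_C5_at5 (a b d : int) : coprimez a b ->
  (5 ^+ 4 %| c4 (E_ C5 a b d))%Z -> False.
Proof.
move=> cop dc4.
move: (residue5 cop) dc4 => [[k [-> x5]]|[x5 [k [->|[->|[->|[->|->]]]]]]] dc4.
- apply: (@unit_residue 5 _ a (125 * k ^+ 4 - 300 * k ^+ 3 * a
    + 70 * k ^+ 2 * a ^+ 2 + 12 * k * a ^+ 3)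
    1 0 4 4 isT x5 _ _ _ dc4) => //; rewrite /=; ring.
- apply: (@unit_residue 5 _ b (125 * k ^+ 4 + 100 * k ^+ 3 * b
    - 170 * k ^+ 2 * b ^+ 2 + 44 * k * b ^+ 3)
    1 0 4 4 isT x5 _ _ _ dc4) => //; rewrite /=; ring.
- apply: (@unit_residue 5 _ b (125 * k ^+ 4 + 200 * k ^+ 3 * b
    - 80 * k ^+ 2 * b ^+ 2 - 8 * k * b ^+ 3 + 3 * b ^+ 4)
    1 0 4 4 isT x5 _ _ _ dc4) => //; rewrite /=; ring.
- apply: (@unit_residue 5 _ b (125 * k ^+ 4 + 300 * k ^+ 3 * b
    + 70 * k ^+ 2 * b ^+ 2 - 12 * k * b ^+ 3)
    1 0 4 4 isT x5 _ _ _ dc4) => //; rewrite /=; ring.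
- apply: (@unit_residue 5 _ b (125 * k ^+ 4 + 400 * k ^+ 3 * b
    + 280 * k ^+ 2 * b ^+ 2 + 56 * k * b ^+ 3 + 3 * b ^+ 4)
    1 0 4 4 isT x5 _ _ _ dc4) => //; rewrite /=; ring.
- apply: (@unit_residue 5 _ b (25 * k ^+ 4 + 100 * k ^+ 3 * b
    + 110 * k ^+ 2 * b ^+ 2 + 44 * k * b ^+ 3 + 6 * b ^+ 4)
    (-1) 1 4 4 isT x5 _ _ _ dc4) => //; rewrite /=; ring.
Qed.

Lemma irreducible_C10_at5 (a b d : int) : coprimez a b ->
  (5 ^+ 4 %| c4 (E_ C10 a b d))%Z -> False.
Proof.
move=> cop dc4.
move: (residue5 cop) dc4 => [[k [-> x5]]|[x5 [k [->|[->|[->|[->|->]]]]]]] dc4.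
- apply: (@unit_residue 5 _ a (((781 * 1000 + 250) * 1000) * k ^+ 12
    - ((1250 * 1000) * 1000) * k ^+ 11 * a + ((812 * 1000
    + 500) * 1000) * k ^+ 10 * a ^+ 2 - ((281 * 1000
    + 250) * 1000) * k ^+ 9 * a ^+ 3 + ((56 * 1000
    + 250) * 1000) * k ^+ 8 * a ^+ 4 - (4500 * 1000) * k ^+ 7 * a ^+ 5
    - (800 * 1000) * k ^+ 6 * a ^+ 6 + (270 * 1000) * k ^+ 5 * a ^+ 7
    - (30 * 1000) * k ^+ 4 * a ^+ 8 + 1000 * k ^+ 3 * a ^+ 9
    + 80 * k ^+ 2 * a ^+ 10 - 8 * k * a ^+ 11)
    1 0 4 12 isT x5 _ _ _ dc4) => //; rewrite /=; ring.
- apply: (@unit_residue 5 _ b (((48 * 1000 + 828) * 1000 + 125) * k ^+ 12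
    - ((312 * 1000 + 500) * 1000) * k ^+ 11 * b + ((890 * 1000
    + 625) * 1000) * k ^+ 10 * b ^+ 2 - ((1484 * 1000
    + 375) * 1000) * k ^+ 9 * b ^+ 3 + ((1593 * 1000
    + 750) * 1000) * k ^+ 8 * b ^+ 4 - ((1139 * 1000
    + 250) * 1000) * k ^+ 7 * b ^+ 5 + ((534 * 1000
    + 700) * 1000) * k ^+ 6 * b ^+ 6 - ((149 * 1000
    + 820) * 1000) * k ^+ 5 * b ^+ 7 + ((14 * 1000
    + 610) * 1000) * k ^+ 4 * b ^+ 8 + (5342 * 1000) * k ^+ 3 * b ^+ 9
    - (2219 * 1000 + 520) * k ^+ 2 * b ^+ 10 + (327 * 1000 + 488) * k * b ^+ 11
    - (17 * 1000 + 661) * b ^+ 12)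
    1 0 4 12 isT x5 _ _ _ dc4) => //; rewrite /=; ring.
- apply: (@unit_residue 5 _ b ((9765 * 1000 + 625) * k ^+ 12 - ((39 * 1000
    + 62) * 1000 + 500) * k ^+ 11 * b + ((66 * 1000 + 406) * 1000
    + 250) * k ^+ 10 * b ^+ 2 - ((60 * 1000 + 937) * 1000
    + 500) * k ^+ 9 * b ^+ 3 + ((30 * 1000 + 234) * 1000
    + 375) * k ^+ 8 * b ^+ 4 - (4875 * 1000) * k ^+ 7 * b ^+ 5 - (3362 * 1000
    + 500) * k ^+ 6 * b ^+ 6 + (2535 * 1000) * k ^+ 5 * b ^+ 7 - (803 * 1000
    + 625) * k ^+ 4 * b ^+ 8 + (135 * 1000 + 500) * k ^+ 3 * b ^+ 9
    - (10 * 1000 + 70) * k ^+ 2 * b ^+ 10 - 172 * k * b ^+ 11 + 54 * b ^+ 12)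
    (-1) 1 4 12 isT x5 _ _ _ dc4) => //; rewrite /=; ring.
- apply: (@unit_residue 5 _ b (((48 * 1000 + 828) * 1000 + 125) * k ^+ 12
    - ((78 * 1000 + 125) * 1000) * k ^+ 11 * b + ((31 * 1000
    + 250) * 1000) * k ^+ 10 * b ^+ 2 + ((15 * 1000
    + 625) * 1000) * k ^+ 9 * b ^+ 3 - ((18 * 1000
    + 750) * 1000) * k ^+ 8 * b ^+ 4 + (6750 * 1000) * k ^+ 7 * b ^+ 5
    - (800 * 1000) * k ^+ 6 * b ^+ 6 - (180 * 1000) * k ^+ 5 * b ^+ 7
    + (90 * 1000) * k ^+ 4 * b ^+ 8 - (18 * 1000) * k ^+ 3 * b ^+ 9
    + 2080 * k ^+ 2 * b ^+ 10 - 128 * k * b ^+ 11 + 3 * b ^+ 12)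
    1 0 4 12 isT x5 _ _ _ dc4) => //; rewrite /=; ring.
- apply: (@unit_residue 5 _ b (((48 * 1000 + 828) * 1000 + 125) * k ^+ 12
    + ((39 * 1000 + 62) * 1000 + 500) * k ^+ 11 * b - ((11 * 1000 + 718) * 1000
    + 750) * k ^+ 10 * b ^+ 2 - (7812 * 1000 + 500) * k ^+ 9 * b ^+ 3
    + (1171 * 1000 + 875) * k ^+ 8 * b ^+ 4 + (375 * 1000) * k ^+ 7 * b ^+ 5
    - (12 * 1000 + 500) * k ^+ 6 * b ^+ 6 - (15 * 1000) * k ^+ 5 * b ^+ 7
    + 1875 * k ^+ 4 * b ^+ 8 + 500 * k ^+ 3 * b ^+ 9 - 30 * k ^+ 2 * b ^+ 10
    - 4 * k * b ^+ 11)
    1 0 4 12 isT x5 _ _ _ dc4) => //; rewrite /=; ring.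
- apply: (@unit_residue 5 _ b (((48 * 1000 + 828) * 1000 + 125) * k ^+ 12
    + ((156 * 1000 + 250) * 1000) * k ^+ 11 * b + ((203 * 1000
    + 125) * 1000) * k ^+ 10 * b ^+ 2 + ((140 * 1000
    + 625) * 1000) * k ^+ 9 * b ^+ 3 + ((56 * 1000
    + 250) * 1000) * k ^+ 8 * b ^+ 4 + ((12 * 1000
    + 750) * 1000) * k ^+ 7 * b ^+ 5 + (1300 * 1000) * k ^+ 6 * b ^+ 6
    - (60 * 1000) * k ^+ 5 * b ^+ 7 - (30 * 1000) * k ^+ 4 * b ^+ 8
    - 2000 * k ^+ 3 * b ^+ 9 + 320 * k ^+ 2 * b ^+ 10 + 64 * k * b ^+ 11
    + 3 * b ^+ 12)
    1 0 4 12 isT x5 _ _ _ dc4) => //; rewrite /=; ring.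
Qed.

(** [c4] does not help here: it is a multiple of [a^2 - a b + b^2], whose roots 3 and -2 modulo 7
    are simple and lift modulo every power of 7. [c6] is a unit on every class but the cuspidal one
    [a = 3 b], where 7 divides it exactly once. *)
Lemma irreducible_C7_at7 (a b d : int) : coprimez a b ->
  (7 ^+ 4 %| c4 (E_ C7 a b d))%Z ->
  (7 ^+ 6 %| c6 (E_ C7 a b d))%Z -> False.
Proof.
move=> cop dc4 dc6.
move: (residue7 cop) dc4 dc6 => [[k [->
    x7]]|[x7 [k [->|[->|[->|[->|[->|[->|->]]]]]]]]] dc4 dc6.
- apply: (@unit_residue 7 _ a (- (((1977 * 1000 + 326) * 1000 + 743) * k ^+ 12)
    + ((5084 * 1000 + 554) * 1000 + 482) * k ^+ 11 * a - ((4721 * 1000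
    + 372) * 1000 + 19) * k ^+ 10 * a ^+ 2 + ((2040 * 1000 + 739) * 1000
    + 554) * k ^+ 9 * a ^+ 3 - ((469 * 1000 + 419) * 1000
    + 510) * k ^+ 8 * a ^+ 4 + ((57 * 1000 + 177) * 1000
    + 414) * k ^+ 7 * a ^+ 5 - (4588 * 1000 + 311) * k ^+ 6 * a ^+ 6
    + (533 * 1000 + 22) * k ^+ 5 * a ^+ 7 - (59 * 1000 + 682) * k ^+ 4 * a ^+ 8
    + 2254 * k ^+ 3 * a ^+ 9 + 105 * k ^+ 2 * a ^+ 10 - 6 * k * a ^+ 11)
    (-1) 0 6 12 isT x7 _ _ _ dc6) => //; rewrite /=; ring.
- apply: (@unit_residue 7 _ b (- (((1977 * 1000 + 326) * 1000 + 743) * k ^+ 12)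
    + ((8474 * 1000 + 257) * 1000 + 470) * k ^+ 11 * b - (((15 * 1000
    + 374) * 1000 + 724) * 1000 + 267) * k ^+ 10 * b ^+ 2 + (((14 * 1000
    + 792) * 1000 + 479) * 1000 + 366) * k ^+ 9 * b ^+ 3 - ((7169 * 1000
    + 765) * 1000 + 358) * k ^+ 8 * b ^+ 4 + ((326 * 1000 + 828) * 1000
    + 922) * k ^+ 7 * b ^+ 5 + ((1714 * 1000 + 969) * 1000
    + 473) * k ^+ 6 * b ^+ 6 - ((1025 * 1000 + 952) * 1000
    + 102) * k ^+ 5 * b ^+ 7 + ((250 * 1000 + 184) * 1000
    + 886) * k ^+ 4 * b ^+ 8 - (4378 * 1000 + 542) * k ^+ 3 * b ^+ 9
    - ((12 * 1000 + 434) * 1000 + 751) * k ^+ 2 * b ^+ 10 + (2836 * 1000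
    + 206) * k * b ^+ 11 - (212 * 1000 + 760) * b ^+ 12)
    (-1) 0 6 12 isT x7 _ _ _ dc6) => //; rewrite /=; ring.
- apply: (@unit_residue 7 _ b (- (((1977 * 1000 + 326) * 1000 + 743) * k ^+ 12)
    + ((5084 * 1000 + 554) * 1000 + 482) * k ^+ 11 * b - ((4721 * 1000
    + 372) * 1000 + 19) * k ^+ 10 * b ^+ 2 + ((1072 * 1000 + 252) * 1000
    + 986) * k ^+ 9 * b ^+ 3 + ((1398 * 1000 + 376) * 1000
    + 14) * k ^+ 8 * b ^+ 4 - ((1306 * 1000 + 609) * 1000
    + 794) * k ^+ 7 * b ^+ 5 + ((440 * 1000 + 124) * 1000
    + 909) * k ^+ 6 * b ^+ 6 - (9349 * 1000 + 494) * k ^+ 5 * b ^+ 7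
    - ((46 * 1000 + 648) * 1000 + 686) * k ^+ 4 * b ^+ 8 + ((18 * 1000
    + 632) * 1000 + 642) * k ^+ 3 * b ^+ 9 - (3633 * 1000
    + 735) * k ^+ 2 * b ^+ 10 + (378 * 1000 + 78) * k * b ^+ 11 - (16 * 1000
    + 920) * b ^+ 12)
    (-1) 0 6 12 isT x7 _ _ _ dc6) => //; rewrite /=; ring.
- apply: (@unit_residue 7 _ b (- (((1977 * 1000 + 326) * 1000 + 743) * k ^+ 12)
    + ((1694 * 1000 + 851) * 1000 + 494) * k ^+ 11 * b + ((605 * 1000
    + 304) * 1000 + 105) * k ^+ 10 * b ^+ 2 - ((1233 * 1000 + 667) * 1000
    + 414) * k ^+ 9 * b ^+ 3 + ((479 * 1000 + 302) * 1000
    + 26) * k ^+ 8 * b ^+ 4 + ((33 * 1000 + 177) * 1000 + 18) * k ^+ 7 * b ^+ 5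
    - ((93 * 1000 + 530) * 1000 + 955) * k ^+ 6 * b ^+ 6 + ((39 * 1000
    + 774) * 1000 + 966) * k ^+ 5 * b ^+ 7 - (9674 * 1000
    + 658) * k ^+ 4 * b ^+ 8 + (1556 * 1000 + 338) * k ^+ 3 * b ^+ 9
    - (166 * 1000 + 635) * k ^+ 2 * b ^+ 10 + (10 * 1000 + 818) * k * b ^+ 11
    - 320 * b ^+ 12)
    (-1) 0 6 12 isT x7 _ _ _ dc6) => //; rewrite /=; ring.
- apply: (@unit_residue 7 _ b (- (((1977 * 1000 + 326) * 1000 + 743) * k ^+ 12)
    - ((1694 * 1000 + 851) * 1000 + 494) * k ^+ 11 * b + ((605 * 1000
    + 304) * 1000 + 105) * k ^+ 10 * b ^+ 2 + ((265 * 1000 + 180) * 1000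
    + 846) * k ^+ 9 * b ^+ 3 - ((143 * 1000 + 296) * 1000
    + 482) * k ^+ 8 * b ^+ 4 + ((26 * 1000 + 118) * 1000
    + 78) * k ^+ 7 * b ^+ 5 - (4588 * 1000 + 311) * k ^+ 6 * b ^+ 6
    + (1166 * 1000 + 886) * k ^+ 5 * b ^+ 7 - (195 * 1000
    + 510) * k ^+ 4 * b ^+ 8 + (17 * 1000 + 346) * k ^+ 3 * b ^+ 9
    - 819 * k ^+ 2 * b ^+ 10 + 18 * k * b ^+ 11)
    (-1) 0 6 12 isT x7 _ _ _ dc6) => //; rewrite /=; ring.
- apply: (@unit_residue 7 _ b (- (((1977 * 1000 + 326) * 1000 + 743) * k ^+ 12)
    - ((5084 * 1000 + 554) * 1000 + 482) * k ^+ 11 * b - ((4721 * 1000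
    + 372) * 1000 + 19) * k ^+ 10 * b ^+ 2 - ((2040 * 1000 + 739) * 1000
    + 554) * k ^+ 9 * b ^+ 3 - ((469 * 1000 + 419) * 1000
    + 510) * k ^+ 8 * b ^+ 4 - ((57 * 1000 + 177) * 1000
    + 414) * k ^+ 7 * b ^+ 5 - (4588 * 1000 + 311) * k ^+ 6 * b ^+ 6
    - (533 * 1000 + 22) * k ^+ 5 * b ^+ 7 - (59 * 1000 + 682) * k ^+ 4 * b ^+ 8
    - 2254 * k ^+ 3 * b ^+ 9 + 105 * k ^+ 2 * b ^+ 10 + 6 * k * b ^+ 11)
    (-1) 0 6 12 isT x7 _ _ _ dc6) => //; rewrite /=; ring.
- apply: (@unit_residue 7 _ b (- (((1977 * 1000 + 326) * 1000 + 743) * k ^+ 12)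
    - ((8474 * 1000 + 257) * 1000 + 470) * k ^+ 11 * b - (((15 * 1000
    + 374) * 1000 + 724) * 1000 + 267) * k ^+ 10 * b ^+ 2 - (((15 * 1000
    + 760) * 1000 + 965) * 1000 + 934) * k ^+ 9 * b ^+ 3 - (((10 * 1000
    + 282) * 1000 + 757) * 1000 + 898) * k ^+ 8 * b ^+ 4 - ((4536 * 1000
    + 780) * 1000 + 738) * k ^+ 7 * b ^+ 5 - ((1398 * 1000 + 23) * 1000
    + 67) * k ^+ 6 * b ^+ 6 - ((305 * 1000 + 363) * 1000
    + 982) * k ^+ 5 * b ^+ 7 - ((47 * 1000 + 299) * 1000
    + 14) * k ^+ 4 * b ^+ 8 - (5111 * 1000 + 582) * k ^+ 3 * b ^+ 9
    - (368 * 1000 + 991) * k ^+ 2 * b ^+ 10 - (16 * 1000 + 74) * k * b ^+ 11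
    - 320 * b ^+ 12)
    (-1) 0 6 12 isT x7 _ _ _ dc6) => //; rewrite /=; ring.
- apply: (@unit_residue 7 _ b (- (((282 * 1000 + 475) * 1000 + 249) * k ^+ 12)
    - ((1694 * 1000 + 851) * 1000 + 494) * k ^+ 11 * b - ((4479 * 1000
    + 250) * 1000 + 377) * k ^+ 10 * b ^+ 2 - ((6929 * 1000 + 290) * 1000
    + 802) * k ^+ 9 * b ^+ 3 - ((7021 * 1000 + 527) * 1000
    + 618) * k ^+ 8 * b ^+ 4 - ((4929 * 1000 + 257) * 1000
    + 802) * k ^+ 7 * b ^+ 5 - ((2466 * 1000 + 242) * 1000
    + 373) * k ^+ 6 * b ^+ 6 - ((888 * 1000 + 518) * 1000
    + 862) * k ^+ 5 * b ^+ 7 - ((229 * 1000 + 324) * 1000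
    + 998) * k ^+ 4 * b ^+ 8 - ((41 * 1000 + 445) * 1000
    + 474) * k ^+ 3 * b ^+ 9 - (4989 * 1000 + 285) * k ^+ 2 * b ^+ 10
    - (359 * 1000 + 946) * k * b ^+ 11 - (11 * 1000 + 792) * b ^+ 12)
    1 1 6 12 isT x7 _ _ _ dc6) => //; rewrite /=; ring.
Qed.

(** * Valuations as divisibilities, and the separation of 2 from the odd primes *)

Lemma dvdz_v2_ge (n : int) (k : nat) : v2_ge n k = (2 ^+ k %| n)%Z.
Proof.
rewrite /v2_ge /v2; have [->|n0] := eqVneq n 0; first by rewrite dvdz0.
by rewrite dvdzE abszX /= pfactor_dvdn // absz_gt0.
Qed.

Lemma dvdz_v2_le (n : int) (k : nat) : v2_le n k = ~~ (2 ^+ k.+1 %| n)%Z.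
Proof.
rewrite /v2_le /v2; have [->|n0] := eqVneq n 0; first by rewrite dvdz0.
by rewrite dvdzE abszX /= pfactor_dvdn ?absz_gt0 // -leqNgt.
Qed.

Lemma dvdz_v2_eq (n : int) (k : nat) :
  v2_eq n k = (2 ^+ k %| n)%Z && ~~ (2 ^+ k.+1 %| n)%Z.
Proof.
rewrite -dvdz_v2_ge -dvdz_v2_le /v2_eq /v2_ge /v2_le; case: (v2 n) => //= m.
by rewrite (inj_eq (@Some_inj _)) eqn_leq andbC.
Qed.

Definition integral_scaling (E : weierstrass int) (u : int) : Prop :=
  [/\ (u %| wa1 E)%Z, (u ^+ 2 %| wa2 E)%Z, (u ^+ 3 %| wa3 E)%Z,
      (u ^+ 4 %| wa4 E)%Z & (u ^+ 6 %| wa6 E)%Z].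

Lemma global_minimal_scaling (E : weierstrass int) (u : int) :
  u != 0 -> discriminant E != 0 -> integral_scaling E u ->
  (forall p, prime p -> ~ reducible_at p E u) ->
  global_minimal_model (to_rat E) (change_variables (to_rat E) u%:~R 0 0 0).
Proof.
move=> u0 D0 [i1 i2 i3 i4 i6].
apply: (global_minimal_model_criterion (r := 0) (s := 0)) => //.
by rewrite expr0n /= !(mulr0, mul0r, addr0, subr0).
Qed.

(** The scaling [u] does not appear: in the families that go through this notion it is a power of 2,
    so the divisibilities of the original invariants are enough. [C3] and [C4], whose [u] can
    contain odd primes, are treated apart. *)
Definition odd_irreducible (E : weierstrass int) : Prop :=
  forall p, prime p -> (2 < p)%N -> (p%:Z ^+ 4 %| c4 E)%Z ->
    (p%:Z ^+ 6 %| c6 E)%Z -> (p%:Z ^+ 12 %| discriminant E)%Z -> False.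

Lemma odd_irreducibleP (E : weierstrass int) (u : int) :
  odd_irreducible E -> ~ reducible_at 2 E u ->
  forall p, prime p -> ~ reducible_at p E u.
Proof.
move=> irr irr2 p p_pr; have [->//|p_odd] := eqVneq p 2%N.
move=> [x [y [z [Ex Ey Ez _]]]]; apply: (irr p p_pr).
- by have := prime_gt1 p_pr; lia.
- by rewrite Ex; apply: dvdz_mull; exact: dvdz_mulr.
- by rewrite Ey; apply: dvdz_mull; exact: dvdz_mulr.
- by rewrite Ez; apply: dvdz_mull; exact: dvdz_mulr.
Qed.

Lemma integral_scaling1 (E : weierstrass int) : integral_scaling E 1.
Proof. by split; rewrite ?expr1n dvd1z. Qed.

Lemma prime_ndvdzX (p : nat) (m : int) (k : nat) : prime p ->
  ~~ (p%:Z %| m)%Z -> ~~ (p%:Z %| m ^+ k)%Z.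
Proof. by move=> p_pr; apply: contra; exact: prime_dvdzX. Qed.

Lemma prime_ndvdM (p : nat) (m n : int) : prime p ->
  ~~ (p%:Z %| m)%Z -> ~~ (p%:Z %| n)%Z -> ~~ (p%:Z %| m * n)%Z.
Proof. by move=> p_pr pm pn; apply/negP => /(prime_dvdzM p_pr)[];
    exact/negP. Qed.

Lemma odd_rep (n : int) : ~~ (2 %| n)%Z -> exists k, n = 2 * k + 1.
Proof. by move=> n2; exists (n %/ 2)%Z; lia. Qed.

Lemma odd_mul (m n : int) :
  ~~ (2 %| m)%Z -> ~~ (2 %| n)%Z -> ~~ (2 %| m * n)%Z.
Proof. exact: (@prime_ndvdM 2). Qed.

Lemma odd_pow (n : int) (k : nat) : ~~ (2 %| n)%Z -> ~~ (2 %| n ^+ k)%Z.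
Proof. exact: (@prime_ndvdzX 2). Qed.

Lemma irreducible2_unit_c4 (E : weierstrass int) (u q x : int) (n : nat) :
  u != 0 -> ~~ (2 %| x)%Z -> c4 E = u ^+ 4 * (2 * q + x ^+ n) ->
  ~ reducible_at 2 E u.
Proof.
move=> u0 x2 Ec4 [y [_ [_ [Ey _ _ _]]]].
apply: (@unit_residue 2 (2 * q + x ^+ n) x q 1 0 4 n isT x2) => //;
    first by ring.
apply/dvdzP; exists y; rewrite [RHS]mulrC.
by apply: (mulfI (expf_neq0 4 u0)); rewrite -Ey -Ec4.
Qed.

(** For the classes where 16 and 64 do divide the scaled [c4] and [c6]. The quotients are odd and 1
    modulo 4 (an odd square plus a multiple of 4), whereas Kraus asks for 3 modulo 4 next to an odd
    [c4]. *)
Lemma irreducible2_kraus (E : weierstrass int) (u q q' x : int) (m n : nat) :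
  u != 0 -> ~~ (2 %| x)%Z ->
  c4 E = u ^+ 4 * (16 * (2 * q + x ^+ m)) ->
  c6 E = u ^+ 6 * (64 * (4 * q' + (x ^+ n) ^+ 2)) ->
  ~ reducible_at 2 E u.
Proof.
move=> u0 x2 Ec4 Ec6 [y [z [_ [Ey Ez _ /(_ erefl) K]]]].
have {}Ey : y = 2 * q + x ^+ m.
  have : 16 * (2 * q + x ^+ m) = 2%:Z ^+ 4 * y.
    by apply: (mulfI (expf_neq0 4 u0)); rewrite -Ey -Ec4.
  lia.
have {}Ez : z = 4 * q' + (x ^+ n) ^+ 2.
  have : 64 * (4 * q' + (x ^+ n) ^+ 2) = 2%:Z ^+ 6 * z.
    by apply: (mulfI (expf_neq0 6 u0)); rewrite -Ez -Ec6.
  lia.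
have [l El] := odd_rep (odd_pow m x2).
have [l' El'] := odd_rep (odd_pow n x2).
have [r Ez'] : exists r, z = 4 * r + 1.
  by exists (q' + l' ^+ 2 + l'); rewrite Ez El'; ring.
by case: K => [[i [j [Ki Kj]]]|[i [Ki _]]]; lia.
Qed.

(* With a1 odd c4 is odd; with a1 even the discriminant has the parity of a3. *)
Lemma reducible2_even (E : weierstrass int) : reducible_at 2 E 1 ->
  (2 %| wa1 E)%Z /\ (2 %| wa3 E)%Z.
Proof.
case: E => a1 a2 a3 a4 a6 [x [_ [z [/= Ex _ Ez _]]]].
have a1_even : (2 %| a1)%Z.
  apply: (@prime_dvdzX 2 _ 4 isT); apply/dvdzP.
  pose t := 4 * a1 ^+ 2 * a2 + 8 * a2 ^+ 2 - 12 * (2 * a4 + a1 * a3).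
  exists (8 * x - t); transitivity (1 ^+ 4 * (2 ^+ 4 * x) - 2 * t);
      last by ring.
  by rewrite -Ex /t; ring.
split=> //; case/dvdzP: a1_even Ez => k -> Ez.
apply: (@prime_dvdzX 2 _ 4 isT); apply/dvdzP.
pose B := k ^+ 2 + a2; pose C := a4 + k * a3; pose b6 := a3 ^+ 2 + 4 * a6.
pose b8 := (k * 2) ^+ 2 * a6 + 4 * a2 * a6 - k * 2 * a3 * a4 + a2 * a3 ^+ 2
           - a4 ^+ 2.
exists (2 ^+ 11 * z + 14 * a3 ^+ 4 + 27 * (4 * a3 ^+ 2 * a6 + 8 * a6 ^+ 2)
        + 8 * B ^+ 2 * b8 + 32 * C ^+ 3 - 36 * B * C * b6).
transitivity (1 ^+ 12 * (2 ^+ 12 * z) + 28 * a3 ^+ 4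
  + 27 * (8 * a3 ^+ 2 * a6 + 16 * a6 ^+ 2) + 16 * B ^+ 2 * b8 + 64 * C ^+ 3
  - 72 * B * C * b6); last by ring.
by rewrite -Ez /B /C /b6 /b8; ring.
Qed.

(** [b2] is a unit modulo 3 outside the class [a = 0]. On that class [81 | c4] only confines [a] to
    [- 3 b] modulo 9, and the discriminant has to conclude: its valuation there is exactly 3. *)
Lemma irreducible_C6_at3 (a b d : int) : coprimez a b ->
  (3 ^+ 4 %| c4 (E_ C6 a b d))%Z ->
  (3 ^+ 12 %| discriminant (E_ C6 a b d))%Z -> False.
Proof.
move=> cop dc4 dD; have db2 := dvd3_b2 dc4.
move: (residue3 cop) dc4 dD db2 => [[k [->
    x3]]|[x3 [k [->|[->|->]]]]] dc4 dD db2.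
- apply: (@unit_residue 3 _ a (- (9 * k ^+ 2) - 6 * k * a)
    1 0 1 2 isT x3 _ _ _ db2) => //; rewrite /=; ring.
- apply: (@unit_residue 3 _ b (3 * k ^+ 2 - 8 * k * b + b ^+ 2)
    1 0 1 2 isT x3 _ _ _ db2) => //; rewrite /=; ring.
(* Here [a = 3 k], and [c4 / 9] is [b^3 (b + k)] modulo 3 with [b] a unit. *)
- have [l El] : exists l, k = - b + 3 * l.
    have /dvdzP[l El] : (3 %| b + k)%Z; last by exists l; lia.
    case/dvdzP: dc4 => t Et.
    have d3 : (3 %| b ^+ 3 * (b + k))%Z.
      apply/dvdzP.
      exists (3 * t - k * b ^+ 3 - 10 * k ^+ 2 * b ^+ 2 - 12 * k ^+ 3 * b
              - 3 * k ^+ 4).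
      by apply: (@mulfI _ 9) => //; transitivity (t * 3 ^+ 4
          + 9 * (- 3 * k * b ^+ 3
        - 30 * k ^+ 2 * b ^+ 2 - 36 * k ^+ 3 * b - 9 * k ^+ 4));
        [rewrite -Et /=|]; ring.
    case/(@prime_dvdzM 3 _ _ isT): d3 => // /(@prime_dvdzX 3 _ _ isT).
    by rewrite (negPf x3).
  rewrite El in dD; apply: (@unit_residue 3 _ b (6561 * l ^+ 6 * b ^+ 6
      - 4374 * l ^+ 5 * b ^+ 7 - 1215 * l ^+ 4 * b ^+ 8
      + 1872 * l ^+ 3 * b ^+ 9 - 648 * l ^+ 2 * b ^+ 10 + 96 * l * b ^+ 11
      - 5 * b ^+ 12)
    (-1) 3 12 12 isT x3 _ _ _ dD) => //; rewrite /=; ring.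
- apply: (@unit_residue 3 _ b (3 * k ^+ 2 - 4 * k * b - 3 * b ^+ 2)
    1 0 1 2 isT x3 _ _ _ db2) => //; rewrite /=; ring.
Qed.

(* a = m b + n k with b odd runs through a residue class on which u_ is
   constant. *)
Lemma scaling_C6_u2 (b d k : int) : ~~ (2 %| b)%Z ->
  let E := E_ C6 (- b + 8 * k) b d in
  integral_scaling E 2 /\ ~ reducible_at 2 E 2.
Proof.
move=> b2 E; split.
  split; apply/dvdzP;
    [exists (4 * k - b)
    |exists (- (2 * k * b))
    |exists (- (8 * k ^+ 2 * b) + k * b ^+ 2)
    |by exists 0|by exists 0]; rewrite /=; ring.
apply: (@irreducible2_unit_c4 _ _ (128 * k ^+ 4 + 128 * k ^+ 3 * b
    - 4 * k * b ^+ 3) b 4) => //.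
rewrite /=; ring.
Qed.

Lemma scaling_C8_u2 (b d k : int) : ~~ (2 %| b)%Z ->
  let E := E_ C8 (2 * b + 4 * k) b d in
  integral_scaling E 2 /\ ~ reducible_at 2 E 2.
Proof.
move=> b2 E; split.
  split; apply/dvdzP;
    [exists (- (8 * k ^+ 2) + b ^+ 2)
    |exists (- (4 * k ^+ 2 * b ^+ 2) - k * b ^+ 3)
    |exists (- (8 * k ^+ 3 * b ^+ 3) - 6 * k ^+ 2 * b ^+ 4 - k * b ^+ 5)
    |by exists 0|by exists 0]; rewrite /=; ring.
apply: (@irreducible2_unit_c4 _ _ (2048 * k ^+ 8 - 2048 * k ^+ 6 * b ^+ 2
    - 1024 * k ^+ 5 * b ^+ 3 + 128 * k ^+ 3 * b ^+ 5 + 48 * k ^+ 2 * b ^+ 6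
    + 8 * k * b ^+ 7) b 8) => //.
rewrite /=; ring.
Qed.

(** Here 16 divides [c4] and 64 divides [c6], so these divisibilities do not exclude [u = 2]; the
    congruences of Kraus do. *)
Lemma scaling_C8_u1 (b d k : int) : ~~ (2 %| b)%Z ->
  let E := E_ C8 (4 * k) b d in
  integral_scaling E 1 /\ ~ reducible_at 2 E 1.
Proof.
move=> b2 E; split.
  exact: integral_scaling1.
apply: (@irreducible2_kraus _ _ (2048 * k ^+ 8 - 8192 * k ^+ 7 * b + (12 * 1000
    + 288) * k ^+ 6 * b ^+ 2 - 9216 * k ^+ 5 * b ^+ 3 + 3840 * k ^+ 4 * b ^+ 4
    - 896 * k ^+ 3 * b ^+ 5 + 112 * k ^+ 2 * b ^+ 6 - 8 * k * b ^+ 7)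
  (- ((65 * 1000 + 536) * k ^+ 12) + (393 * 1000 + 216) * k ^+ 11 * b
   - (983 * 1000 + 40) * k ^+ 10 * b ^+ 2 + (1359 * 1000
   + 872) * k ^+ 9 * b ^+ 3 - (1167 * 1000 + 360) * k ^+ 8 * b ^+ 4
   + (657 * 1000 + 408) * k ^+ 7 * b ^+ 5 - (249 * 1000 + 88) * k ^+ 6 * b ^+ 6
   + (63 * 1000 + 360) * k ^+ 5 * b ^+ 7 - (10 * 1000 + 296) * k ^+ 4 * b ^+ 8
   + 880 * k ^+ 3 * b ^+ 9 - 6 * k * b ^+ 11) b 8 6) => //; rewrite /=; ring.
Qed.

Lemma scaling_C10_u2 (b d k : int) : ~~ (2 %| b)%Z ->
  let E := E_ C10 (2 * k) b d in
  integral_scaling E 2 /\ ~ reducible_at 2 E 2.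
Proof.
move=> b2 E; split.
  split; apply/dvdzP;
    [exists (4 * k ^+ 3 - 4 * k ^+ 2 * b - 2 * k * b ^+ 2 + b ^+ 3)
    |exists (- (2 * k ^+ 3 * b ^+ 3) + 3 * k ^+ 2 * b ^+ 4 - k * b ^+ 5)
    |exists (- (8 * k ^+ 6 * b ^+ 3) + 24 * k ^+ 5 * b ^+ 4
     - 24 * k ^+ 4 * b ^+ 5 + 9 * k ^+ 3 * b ^+ 6 - k ^+ 2 * b ^+ 7)
    |by exists 0|by exists 0]; rewrite /=; ring.
apply: (@irreducible2_unit_c4 _ _ (128 * k ^+ 12 - 512 * k ^+ 11 * b
    + 512 * k ^+ 10 * b ^+ 2 + 640 * k ^+ 9 * b ^+ 3 - 1920 * k ^+ 8 * b ^+ 4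
    + 1728 * k ^+ 7 * b ^+ 5 - 512 * k ^+ 6 * b ^+ 6 - 288 * k ^+ 5 * b ^+ 7
    + 360 * k ^+ 4 * b ^+ 8 - 180 * k ^+ 3 * b ^+ 9 + 52 * k ^+ 2 * b ^+ 10
    - 8 * k * b ^+ 11) b 12) => //.
rewrite /=; ring.
Qed.

Lemma scaling_C12_u2 (b d k : int) : ~~ (2 %| b)%Z ->
  let E := E_ C12 (2 * k) b d in
  integral_scaling E 2 /\ ~ reducible_at 2 E 2.
Proof.
move=> b2 E; split.
  split; apply/dvdzP;
    [exists (- (8 * k ^+ 4) + 8 * k ^+ 3 * b + 4 * k ^+ 2 * b ^+ 2
     - 8 * k * b ^+ 3 + 3 * b ^+ 4)
    |exists (32 * k ^+ 7 * b - 144 * k ^+ 6 * b ^+ 2 + 288 * k ^+ 5 * b ^+ 3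
     - 332 * k ^+ 4 * b ^+ 4 + 238 * k ^+ 3 * b ^+ 5 - 106 * k ^+ 2 * b ^+ 6
     + 27 * k * b ^+ 7 - 3 * b ^+ 8)
    |exists (- (256 * k ^+ 11 * b) + 1536 * k ^+ 10 * b ^+ 2
     - 4224 * k ^+ 9 * b ^+ 3 + 7008 * k ^+ 8 * b ^+ 4 - 7760 * k ^+ 7 * b ^+ 5
     + 5984 * k ^+ 6 * b ^+ 6 - 3248 * k ^+ 5 * b ^+ 7 + 1222 * k ^+ 4 * b ^+ 8
     - 304 * k ^+ 3 * b ^+ 9 + 45 * k ^+ 2 * b ^+ 10 - 3 * k * b ^+ 11)
    |by exists 0|by exists 0]; rewrite /=; ring.
apply: (@irreducible2_unit_c4 _ _ (2048 * k ^+ 16 - (24 * 1000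
    + 576) * k ^+ 15 * b + (135 * 1000 + 168) * k ^+ 14 * b ^+ 2 - (454 * 1000
    + 656) * k ^+ 13 * b ^+ 3 + (1050 * 1000 + 624) * k ^+ 12 * b ^+ 4
    - (1772 * 1000 + 544) * k ^+ 11 * b ^+ 5 + (2260 * 1000
    + 992) * k ^+ 10 * b ^+ 6 - (2224 * 1000 + 128) * k ^+ 9 * b ^+ 7
    + (1703 * 1000 + 40) * k ^+ 8 * b ^+ 8 - (1015 * 1000
    + 680) * k ^+ 7 * b ^+ 9 + (468 * 1000) * k ^+ 6 * b ^+ 10 - (163 * 1000
    + 584) * k ^+ 5 * b ^+ 11 + (42 * 1000 + 24) * k ^+ 4 * b ^+ 12
    - 7560 * k ^+ 3 * b ^+ 13 + 900 * k ^+ 2 * b ^+ 14 - 72 * k * b ^+ 15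
    + 4 * b ^+ 16) b 16) => //.
rewrite /=; ring.
Qed.

Lemma scaling_C2xC4_u1 (b d k : int) : ~~ (2 %| b)%Z ->
  let E := E_ C2xC4 (2 * b + 4 * k) b d in
  integral_scaling E 1 /\ ~ reducible_at 2 E 1.
Proof.
move=> b2 E; split.
  exact: integral_scaling1.
apply: (@irreducible2_kraus _ _ (8 * k ^+ 4 + 48 * k ^+ 3 * b
    + 100 * k ^+ 2 * b ^+ 2 + 84 * k * b ^+ 3 + 30 * b ^+ 4)
  (- (16 * k ^+ 6) - 144 * k ^+ 5 * b - 516 * k ^+ 4 * b ^+ 2
   - 936 * k ^+ 3 * b ^+ 3 - 867 * k ^+ 2 * b ^+ 4 - 333 * k * b ^+ 5
   - 23 * b ^+ 6) b 4 3) => //; rewrite /=; ring.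
Qed.

Lemma scaling_C2xC4_u2 (b d k : int) : ~~ (2 %| b)%Z ->
  let E := E_ C2xC4 (16 * k) b d in
  integral_scaling E 2 /\ ~ reducible_at 2 E 2.
Proof.
move=> b2 E; split.
  split; apply/dvdzP;
    [exists (8 * k)
    |exists (- (4 * k * b) - b ^+ 2)
    |exists (- (32 * k ^+ 2 * b) - 8 * k * b ^+ 2)
    |by exists 0|by exists 0]; rewrite /=; ring.
apply: (@irreducible2_kraus _ _ (128 * k ^+ 4 + 128 * k ^+ 3 * b
    + 40 * k ^+ 2 * b ^+ 2 + 4 * k * b ^+ 3)
  (- (1024 * k ^+ 6) - 1536 * k ^+ 5 * b - 864 * k ^+ 4 * b ^+ 2
   - 224 * k ^+ 3 * b ^+ 3 - 18 * k ^+ 2 * b ^+ 4 + 3 * k * b ^+ 5) b 4 3) =>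
   //; rewrite /=; ring.
Qed.

Lemma scaling_C2xC4_u2' (b d k : int) : ~~ (2 %| b)%Z ->
  let E := E_ C2xC4 (8 * b + 16 * k) b d in
  integral_scaling E 2 /\ ~ reducible_at 2 E 2.
Proof.
move=> b2 E; split.
  split; apply/dvdzP;
    [exists (8 * k + 4 * b)
    |exists (- (4 * k * b) - 3 * b ^+ 2)
    |exists (- (32 * k ^+ 2 * b) - 40 * k * b ^+ 2 - 12 * b ^+ 3)
    |by exists 0|by exists 0]; rewrite /=; ring.
apply: (@irreducible2_kraus _ _ (128 * k ^+ 4 + 384 * k ^+ 3 * b
    + 424 * k ^+ 2 * b ^+ 2 + 204 * k * b ^+ 3 + 36 * b ^+ 4)
  (- (1024 * k ^+ 6) - 4608 * k ^+ 5 * b - 8544 * k ^+ 4 * b ^+ 2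
   - 8352 * k ^+ 3 * b ^+ 3 - 4530 * k ^+ 2 * b ^+ 4 - 1287 * k * b ^+ 5
   - 149 * b ^+ 6) b 4 3) => //; rewrite /=; ring.
Qed.

Lemma scaling_C2xC4_u2'' (b d k : int) : ~~ (2 %| b)%Z ->
  let E := E_ C2xC4 (4 * b + 16 * k) b d in
  integral_scaling E 2 /\ ~ reducible_at 2 E 2.
Proof.
move=> b2 E; split.
  split; apply/dvdzP;
    [exists (8 * k + 2 * b)
    |exists (- (4 * k * b) - 2 * b ^+ 2)
    |exists (- (32 * k ^+ 2 * b) - 24 * k * b ^+ 2 - 4 * b ^+ 3)
    |by exists 0|by exists 0]; rewrite /=; ring.
apply: (@irreducible2_kraus _ _ (128 * k ^+ 4 + 256 * k ^+ 3 * b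
    + 184 * k ^+ 2 * b ^+ 2 + 56 * k * b ^+ 3 + 6 * b ^+ 4)
  (- (1024 * k ^+ 6) - 3072 * k ^+ 5 * b - 3744 * k ^+ 4 * b ^+ 2
   - 2368 * k ^+ 3 * b ^+ 3 - 810 * k ^+ 2 * b ^+ 4 - 138 * k * b ^+ 5
   - 9 * b ^+ 6) b 4 3) => //; rewrite /=; ring.
Qed.

Lemma scaling_C2xC4_u4 (b d k : int) : ~~ (2 %| b)%Z ->
  let E := E_ C2xC4 (-4 * b + 16 * k) b d in
  integral_scaling E 4 /\ ~ reducible_at 2 E 4.
Proof.
move=> b2 E; split.
  split; apply/dvdzP;
    [exists (4 * k - b)
    |exists (- (k * b))
    |exists (- (4 * k ^+ 2 * b) + k * b ^+ 2)
    |by exists 0|by exists 0]; rewrite /=; ring.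
apply: (@irreducible2_unit_c4 _ _ (128 * k ^+ 4 - 8 * k ^+ 2 * b ^+ 2) b 4) =>
    //.
rewrite /=; ring.
Qed.

(** A valuation 1 for [a + b] means [a = b] modulo 4, but with [a = b + 4 h] the quotient
    [a2 / 16^2] is [- h^2 (20 h^2 + 9 h b + b^2) / 2]: integral for odd [b], yet with half-integral
    coefficients. Splitting modulo 8 gives integral witnesses. *)
Lemma scaling_C2xC6_u16 (b d k : int) : ~~ (2 %| b)%Z ->
  let E := E_ C2xC6 (b + 8 * k) b d in
  integral_scaling E 16 /\ ~ reducible_at 2 E 16.
Proof.
move=> b2 E; split.
  split; apply/dvdzP;
    [exists (- (76 * k ^+ 2) - 18 * k * b - b ^+ 2)
    |exists (- (160 * k ^+ 4) - 36 * k ^+ 3 * b - 2 * k ^+ 2 * b ^+ 2)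
    |exists (5760 * k ^+ 6 + 2736 * k ^+ 5 * b + 476 * k ^+ 4 * b ^+ 2
     + 36 * k ^+ 3 * b ^+ 3 + k ^+ 2 * b ^+ 4)
    |by exists 0|by exists 0]; rewrite /=; ring.
apply: (@irreducible2_unit_c4 _ _ (((18 * 1000 + 442) * 1000 + 368) * k ^+ 8
    + ((17 * 1000 + 51) * 1000 + 904) * k ^+ 7 * b + (6857 * 1000
    + 88) * k ^+ 6 * b ^+ 2 + (1566 * 1000 + 432) * k ^+ 5 * b ^+ 3
    + (222 * 1000 + 360) * k ^+ 4 * b ^+ 4 + (20 * 1000 + 88) * k ^+ 3 * b ^+ 5
    + 1128 * k ^+ 2 * b ^+ 6 + 36 * k * b ^+ 7) b 8) => //.
rewrite /=; ring.
Qed.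

Lemma scaling_C2xC6_u16' (b d k : int) : ~~ (2 %| b)%Z ->
  let E := E_ C2xC6 (5 * b + 8 * k) b d in
  integral_scaling E 16 /\ ~ reducible_at 2 E 16.
Proof.
move=> b2 E; split.
  split; apply/dvdzP;
    [exists (- (76 * k ^+ 2) - 94 * k * b - 29 * b ^+ 2)
    |exists (- (160 * k ^+ 4) - 356 * k ^+ 3 * b - 296 * k ^+ 2 * b ^+ 2
     - 109 * k * b ^+ 3 - 15 * b ^+ 4)
    |exists (5760 * k ^+ 6 + (20 * 1000 + 16) * k ^+ 5 * b + (28 * 1000
     + 916) * k ^+ 4 * b ^+ 2 + (22 * 1000 + 228) * k ^+ 3 * b ^+ 3
     + 9589 * k ^+ 2 * b ^+ 4 + 2201 * k * b ^+ 5 + 210 * b ^+ 6)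
    |by exists 0|by exists 0]; rewrite /=; ring.
apply: (@irreducible2_unit_c4 _ _ (((18 * 1000 + 442) * 1000 + 368) * k ^+ 8
    + ((90 * 1000 + 821) * 1000 + 376) * k ^+ 7 * b + ((195 * 1000
    + 635) * 1000 + 328) * k ^+ 6 * b ^+ 2 + ((240 * 1000 + 756) * 1000
    + 768) * k ^+ 5 * b ^+ 3 + ((185 * 1000 + 139) * 1000
    + 960) * k ^+ 4 * b ^+ 4 + ((91 * 1000 + 98) * 1000
    + 792) * k ^+ 3 * b ^+ 5 + ((28 * 1000 + 10) * 1000
    + 208) * k ^+ 2 * b ^+ 6 + (4920 * 1000 + 324) * k * b ^+ 7 + (378 * 1000
    + 60) * b ^+ 8) b 8) => //.
rewrite /=; ring.
Qed.

Lemma scaling_C2xC6_u4 (b d k : int) : ~~ (2 %| b)%Z ->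
  let E := E_ C2xC6 (- b + 4 * k) b d in
  integral_scaling E 4 /\ ~ reducible_at 2 E 4.
Proof.
move=> b2 E; split.
  split; apply/dvdzP;
    [exists (- (76 * k ^+ 2) + 40 * k * b - 5 * b ^+ 2)
    |exists (- (160 * k ^+ 4) + 248 * k ^+ 3 * b - 140 * k ^+ 2 * b ^+ 2
     + 34 * k * b ^+ 3 - 3 * b ^+ 4)
    |exists (5760 * k ^+ 6 - (11 * 1000 + 808) * k ^+ 5 * b
     + 9824 * k ^+ 4 * b ^+ 2 - 4240 * k ^+ 3 * b ^+ 3 + 1000 * k ^+ 2 * b ^+ 4
     - 122 * k * b ^+ 5 + 6 * b ^+ 6)
    |by exists 0|by exists 0]; rewrite /=; ring.
apply: (@irreducible2_unit_c4 _ _ (((18 * 1000 + 442) * 1000 + 368) * k ^+ 8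
    - ((39 * 1000 + 665) * 1000 + 664) * k ^+ 7 * b + ((37 * 1000 + 161) * 1000
    + 600) * k ^+ 6 * b ^+ 2 - ((19 * 1000 + 805) * 1000
    + 184) * k ^+ 5 * b ^+ 3 + (6566 * 1000 + 640) * k ^+ 4 * b ^+ 4
    - (1387 * 1000 + 8) * k ^+ 3 * b ^+ 5 + (182 * 1000
    + 280) * k ^+ 2 * b ^+ 6 - (13 * 1000 + 632) * k * b ^+ 7
    + 444 * b ^+ 8) b 8) => //.
rewrite /=; ring.
Qed.

Lemma scaling_C2xC8_u64 (b d k : int) : ~~ (2 %| b)%Z ->
  let E := E_ C2xC8 (4 * k) b d in
  integral_scaling E 64 /\ ~ reducible_at 2 E 64.
Proof.
move=> b2 E; split.
  split; apply/dvdzP;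
    [exists (- (4 * k ^+ 4) - 8 * k ^+ 3 * b - 6 * k ^+ 2 * b ^+ 2 + b ^+ 4)
    |exists (- (4 * k ^+ 6 * b ^+ 2) - 14 * k ^+ 5 * b ^+ 3
     - 20 * k ^+ 4 * b ^+ 4 - 15 * k ^+ 3 * b ^+ 5 - 6 * k ^+ 2 * b ^+ 6
     - k * b ^+ 7)
    |exists (8 * k ^+ 9 * b ^+ 3 + 36 * k ^+ 8 * b ^+ 4 + 64 * k ^+ 7 * b ^+ 5
     + 52 * k ^+ 6 * b ^+ 6 + 8 * k ^+ 5 * b ^+ 7 - 21 * k ^+ 4 * b ^+ 8
     - 19 * k ^+ 3 * b ^+ 9 - 7 * k ^+ 2 * b ^+ 10 - k * b ^+ 11)
    |by exists 0|by exists 0]; rewrite /=; ring.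
apply: (@irreducible2_unit_c4 _ _ (128 * k ^+ 16 + 1024 * k ^+ 15 * b
    + 3584 * k ^+ 14 * b ^+ 2 + 7168 * k ^+ 13 * b ^+ 3
    + 8832 * k ^+ 12 * b ^+ 4 + 6400 * k ^+ 11 * b ^+ 5
    + 1600 * k ^+ 10 * b ^+ 6 - 1856 * k ^+ 9 * b ^+ 7 - 2312 * k ^+ 8 * b ^+ 8
    - 928 * k ^+ 7 * b ^+ 9 + 400 * k ^+ 6 * b ^+ 10 + 800 * k ^+ 5 * b ^+ 11
    + 552 * k ^+ 4 * b ^+ 12 + 224 * k ^+ 3 * b ^+ 13 + 56 * k ^+ 2 * b ^+ 14
    + 8 * k * b ^+ 15) b 16) => //.
rewrite /=; ring.
Qed.

Lemma scaling_C2xC8_u16 (b d k : int) : ~~ (2 %| b)%Z ->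
  let E := E_ C2xC8 (2 * b + 4 * k) b d in
  integral_scaling E 16 /\ ~ reducible_at 2 E 16.
Proof.
move=> b2 E; split.
  split; apply/dvdzP;
    [exists (- (16 * k ^+ 4) - 64 * k ^+ 3 * b - 96 * k ^+ 2 * b ^+ 2
     - 56 * k * b ^+ 3 - 7 * b ^+ 4)
    |exists (- (64 * k ^+ 6 * b ^+ 2) - 416 * k ^+ 5 * b ^+ 3
     - 1120 * k ^+ 4 * b ^+ 4 - 1600 * k ^+ 3 * b ^+ 5 - 1276 * k ^+ 2 * b ^+ 6
     - 534 * k * b ^+ 7 - 90 * b ^+ 8)
    |exists (512 * k ^+ 9 * b ^+ 3 + 4608 * k ^+ 8 * b ^+ 4 + (17 * 1000
     + 920) * k ^+ 7 * b ^+ 5 + (39 * 1000 + 168) * k ^+ 6 * b ^+ 6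
     + (52 * 1000 + 160) * k ^+ 5 * b ^+ 7 + (42 * 1000
     + 432) * k ^+ 4 * b ^+ 8 + (19 * 1000 + 360) * k ^+ 3 * b ^+ 9
     + 3312 * k ^+ 2 * b ^+ 10 - 702 * k * b ^+ 11 - 270 * b ^+ 12)
    |by exists 0|by exists 0]; rewrite /=; ring.
apply: (@irreducible2_unit_c4 _ _ ((32 * 1000 + 768) * k ^+ 16 + (524 * 1000
    + 288) * k ^+ 15 * b + (3866 * 1000 + 624) * k ^+ 14 * b ^+ 2 + ((17 * 1000
    + 432) * 1000 + 576) * k ^+ 13 * b ^+ 3 + ((53 * 1000 + 698) * 1000
    + 560) * k ^+ 12 * b ^+ 4 + ((119 * 1000 + 570) * 1000
    + 432) * k ^+ 11 * b ^+ 5 + ((198 * 1000 + 430) * 1000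
    + 720) * k ^+ 10 * b ^+ 6 + ((249 * 1000 + 110) * 1000
    + 528) * k ^+ 9 * b ^+ 7 + ((237 * 1000 + 298) * 1000
    + 432) * k ^+ 8 * b ^+ 8 + ((170 * 1000 + 137) * 1000
    + 600) * k ^+ 7 * b ^+ 9 + ((89 * 1000 + 994) * 1000
    + 496) * k ^+ 6 * b ^+ 10 + ((34 * 1000 + 74) * 1000
    + 112) * k ^+ 5 * b ^+ 11 + (9126 * 1000 + 240) * k ^+ 4 * b ^+ 12
    + (2047 * 1000 + 360) * k ^+ 3 * b ^+ 13 + (603 * 1000
    + 440) * k ^+ 2 * b ^+ 14 + (180 * 1000 + 64) * k * b ^+ 15 + (25 * 1000
    + 680) * b ^+ 16) b 16) => //.
rewrite /=; ring.
Qed.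

(** * Classes with [u = 1] at the prime 2 *)

Lemma irreducible2_odd_a1 (E : weierstrass int) (x q : int) (n : nat) :
  ~~ (2 %| x)%Z -> wa1 E = 2 * q + x ^+ n -> ~ reducible_at 2 E 1.
Proof.
move=> x2 Ea1 /reducible2_even[dvd_a1 _].
by apply: (@unit_residue 2 _ x q 1 0 1 n isT x2 _ _ _ dvd_a1) => //;
    rewrite Ea1; ring.
Qed.

Lemma irreducible2_odd_a3 (E : weierstrass int) (x q : int) (n : nat) :
  ~~ (2 %| x)%Z -> wa3 E = 2 * q + x ^+ n -> ~ reducible_at 2 E 1.
Proof.
move=> x2 Ea3 /reducible2_even[_ dvd_a3].
by apply: (@unit_residue 2 _ x q 1 0 1 n isT x2 _ _ _ dvd_a3) => //;
    rewrite Ea3; ring.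
Qed.

(** [a1 = a - b] is even only when both parameters are odd, and then [a3 = - a^2 b] is odd. *)
Lemma irreducible_C5_at2 (a b d : int) : coprimez a b ->
  ~ reducible_at 2 (E_ C5 a b d) 1.
Proof.
move=> cop.
case: (residue2 cop) => [[k [-> x2]]|[x2 [k [->|->]]]].
- apply: (@irreducible2_odd_a1 _ a (- k) 1 x2);
    rewrite /=; ring.
- apply: (@irreducible2_odd_a1 _ b (k - b) 1 x2);
    rewrite /=; ring.
- apply: (@irreducible2_odd_a3 _ b (- (2 * k ^+ 2 * b) - 2 * k * b ^+ 2
    - b ^+ 3) 3 x2);
    rewrite /=; ring.
Qed.

Lemma irreducible_C6_at2 (a b d : int) : coprimez a b -> ~~ (2 %| a + b)%Z ->
  ~ reducible_at 2 (E_ C6 a b d) 1.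
Proof.
move=> cop odd_ab.
move: (residue2 cop) odd_ab => [[k [-> x2]]|[x2 [k [->|->]]]] odd_ab.
- apply: (@irreducible2_odd_a1 _ a (- k) 1 x2);
    rewrite /=; ring.
- apply: (@irreducible2_odd_a1 _ b (k - b) 1 x2);
    rewrite /=; ring.
- lia.
Qed.

Lemma irreducible_C7_at2 (a b d : int) : coprimez a b ->
  ~ reducible_at 2 (E_ C7 a b d) 1.
Proof.
move=> cop.
case: (residue2 cop) => [[k [-> x2]]|[x2 [k [->|->]]]].
- apply: (@irreducible2_odd_a1 _ a (- (2 * k ^+ 2) + k * a) 2 x2);
    rewrite /=; ring.
- apply: (@irreducible2_odd_a1 _ b (2 * k ^+ 2 + k * b - b ^+ 2) 2 x2);
    rewrite /=; ring.
- apply: (@irreducible2_odd_a1 _ b (2 * k ^+ 2 + 3 * k * b) 2 x2);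
    rewrite /=; ring.
Qed.

Lemma irreducible_C8_at2 (a b d : int) : coprimez a b -> ~~ (2 %| a)%Z ->
  ~ reducible_at 2 (E_ C8 a b d) 1.
Proof.
move=> cop odd_ab.
move: (residue2 cop) odd_ab => [[k [-> x2]]|[x2 [k [->|->]]]] odd_ab.
- apply: (@irreducible2_odd_a1 _ a (- (4 * k ^+ 2) + 4 * k * a - a ^+ 2) 2 x2);
    rewrite /=; ring.
- lia.
- apply: (@irreducible2_odd_a1 _ b (- (2 * k ^+ 2) + 2 * k * b) 2 x2);
    rewrite /=; ring.
Qed.

Lemma irreducible_C9_at2 (a b d : int) : coprimez a b ->
  ~ reducible_at 2 (E_ C9 a b d) 1.
Proof.
move=> cop.
case: (residue2 cop) => [[k [-> x2]]|[x2 [k [->|->]]]].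
- apply: (@irreducible2_odd_a1 _ a (- (4 * k ^+ 3) + 2 * k ^+ 2 * a) 3 x2);
    rewrite /=; ring.
- apply: (@irreducible2_odd_a1 _ b (4 * k ^+ 3 + k * b ^+ 2 - b ^+ 3) 3 x2);
    rewrite /=; ring.
- apply: (@irreducible2_odd_a1 _ b (4 * k ^+ 3 + 6 * k ^+ 2 * b
    + 4 * k * b ^+ 2) 3 x2);
    rewrite /=; ring.
Qed.

Lemma irreducible_C10_at2 (a b d : int) : coprimez a b -> ~~ (2 %| a)%Z ->
  ~ reducible_at 2 (E_ C10 a b d) 1.
Proof.
move=> cop odd_ab.
move: (residue2 cop) odd_ab => [[k [-> x2]]|[x2 [k [->|->]]]] odd_ab.
- apply: (@irreducible2_odd_a1 _ a (8 * k ^+ 3 - 4 * k ^+ 2 * a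
    - 2 * k * a ^+ 2) 3 x2);
    rewrite /=; ring.
- lia.
- apply: (@irreducible2_odd_a1 _ b (4 * k ^+ 3 + 2 * k ^+ 2 * b
    - 3 * k * b ^+ 2 - b ^+ 3) 3 x2);
    rewrite /=; ring.
Qed.

Lemma irreducible_C12_at2 (a b d : int) : coprimez a b -> ~~ (2 %| a)%Z ->
  ~ reducible_at 2 (E_ C12 a b d) 1.
Proof.
move=> cop odd_ab.
move: (residue2 cop) odd_ab => [[k [-> x2]]|[x2 [k [->|->]]]] odd_ab.
- apply: (@irreducible2_odd_a1 _ a (48 * k ^+ 4 - 32 * k ^+ 3 * a
    + 4 * k ^+ 2 * a ^+ 2 + 2 * k * a ^+ 3 - a ^+ 4) 4 x2);
    rewrite /=; ring.
- lia.
- apply: (@irreducible2_odd_a1 _ b (- (8 * k ^+ 4) - 8 * k ^+ 3 * b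
    + 4 * k ^+ 2 * b ^+ 2 - 2 * k * b ^+ 3) 4 x2);
    rewrite /=; ring.
Qed.

Lemma irreducible_C2xC4_at2 (a b d : int) : coprimez a b -> ~~ (2 %| a)%Z ->
  ~ reducible_at 2 (E_ C2xC4 a b d) 1.
Proof.
move=> cop odd_ab.
move: (residue2 cop) odd_ab => [[k [-> x2]]|[x2 [k [->|->]]]] odd_ab.
- apply: (@irreducible2_odd_a1 _ a 0 1 x2);
    rewrite /=; ring.
- lia.
- apply: (@irreducible2_odd_a1 _ b k 1 x2);
    rewrite /=; ring.
Qed.

Lemma irreducible_C2xC6_at2 (a b d : int) : coprimez a b -> ~~ (2 %| a + b)%Z ->
  ~ reducible_at 2 (E_ C2xC6 a b d) 1.
Proof.
move=> cop odd_ab.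
move: (residue2 cop) odd_ab => [[k [-> x2]]|[x2 [k [->|->]]]] odd_ab.
- apply: (@irreducible2_odd_a1 _ a (2 * k ^+ 2 + 2 * k * a - 10 * a ^+ 2) 2 x2);
    rewrite /=; ring.
- apply: (@irreducible2_odd_a1 _ b (- (38 * k ^+ 2) + 2 * k * b) 2 x2);
    rewrite /=; ring.
- lia.
Qed.

Lemma irreducible_C2xC8_at2 (a b d : int) : coprimez a b -> ~~ (2 %| a)%Z ->
  ~ reducible_at 2 (E_ C2xC8 a b d) 1.
Proof.
move=> cop odd_ab.
move: (residue2 cop) odd_ab => [[k [-> x2]]|[x2 [k [->|->]]]] odd_ab.
- apply: (@irreducible2_odd_a1 _ a (512 * k ^+ 4 - 48 * k ^+ 2 * a ^+ 2
    - 8 * k * a ^+ 3 - a ^+ 4) 4 x2);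
    rewrite /=; ring.
- lia.
- apply: (@irreducible2_odd_a1 _ b (- (8 * k ^+ 4) - 48 * k ^+ 3 * b
    - 108 * k ^+ 2 * b ^+ 2 - 76 * k * b ^+ 3 + 15 * b ^+ 4) 4 x2);
    rewrite /=; ring.
Qed.

(** The discriminant [a^2 b^6 (a + b)^3 (a + 9 b)] decides: its last two factors contribute [3 + 1]
    to the 2-adic valuation here and [6 + 2] for [a = 3 b] modulo 8, both below 12. *)
Lemma irreducible_C6_mod4 (b d k : int) : ~~ (2 %| b)%Z ->
  ~ reducible_at 2 (E_ C6 (b + 4 * k) b d) 1.
Proof.
move=> x2 [x [y [z [_ _ Ez _]]]].
apply: (@unit_residue 2 (1 ^+ 12 * (2 ^+ 12 * z)) b (128 * k ^+ 6 * b ^+ 6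
    + 576 * k ^+ 5 * b ^+ 7 + 840 * k ^+ 4 * b ^+ 8 + 576 * k ^+ 3 * b ^+ 9
    + 204 * k ^+ 2 * b ^+ 10 + 36 * k * b ^+ 11 + 2 * b ^+ 12)
  1 4 12 12 isT x2) => //; last by rewrite expr1n mul1r dvdz_mulr.
rewrite -Ez /=; ring.
Qed.

Lemma irreducible_C6_mod8 (b d k : int) : ~~ (2 %| b)%Z ->
  ~ reducible_at 2 (E_ C6 (3 * b + 8 * k) b d) 1.
Proof.
move=> x2 [x [y [z [_ _ Ez _]]]].
apply: (@unit_residue 2 (1 ^+ 12 * (2 ^+ 12 * z)) b (512 * k ^+ 6 * b ^+ 6
    + 1920 * k ^+ 5 * b ^+ 7 + 2760 * k ^+ 4 * b ^+ 8 + 2008 * k ^+ 3 * b ^+ 9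
    + 792 * k ^+ 2 * b ^+ 10 + 162 * k * b ^+ 11 + 13 * b ^+ 12)
  1 8 12 12 isT x2) => //; last by rewrite expr1n mul1r dvdz_mulr.
rewrite -Ez /=; ring.
Qed.

Lemma dvdz_base (p : nat) (k : nat) (x : int) : (p%:Z ^+ k.+1 %| x)%Z ->
    (p%:Z %| x)%Z.
Proof. by apply: dvdz_trans; rewrite exprS dvdz_mulr. Qed.

(** * Minimality for the families with coprime parameters and [r = s = 0] *)

Lemma odd_irreducible_C5 (a b d : int) : coprimez a b ->
  odd_irreducible (E_ C5 a b d).
Proof.
move=> cop p p_pr; rewrite leq_eqVlt => /predU1P[<-|p3] dc4 dc6 dD.
  exact: irreducible_C5_at3 cop dc4.
have p5 := cuspidal_C5 cop p_pr p3 (dvdz_base dc4) (dvdz_base dc6).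
rewrite p5 in dc4 dc6; exact: irreducible_C5_at5 cop dc4.
Qed.

Lemma odd_irreducible_C6 (a b d : int) : coprimez a b ->
  odd_irreducible (E_ C6 a b d).
Proof.
move=> cop p p_pr; rewrite leq_eqVlt => /predU1P[<-|p3] dc4 dc6 dD.
  exact: irreducible_C6_at3 cop dc4 dD.
exact: cuspidal_C6 cop p_pr p3 (dvdz_base dc4) (dvdz_base dc6).
Qed.

Lemma odd_irreducible_C7 (a b d : int) : coprimez a b ->
  odd_irreducible (E_ C7 a b d).
Proof.
move=> cop p p_pr; rewrite leq_eqVlt => /predU1P[<-|p3] dc4 dc6 dD.
  exact: irreducible_C7_at3 cop dc4.
have p7 := cuspidal_C7 cop p_pr p3 (dvdz_base dc4) (dvdz_base dc6).
rewrite p7 in dc4 dc6; exact: irreducible_C7_at7 cop dc4 dc6.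
Qed.

Lemma odd_irreducible_C8 (a b d : int) : coprimez a b ->
  odd_irreducible (E_ C8 a b d).
Proof.
move=> cop p p_pr; rewrite leq_eqVlt => /predU1P[<-|p3] dc4 dc6 dD.
  exact: irreducible_C8_at3 cop dc4.
exact: cuspidal_C8 cop p_pr p3 (dvdz_base dc4) (dvdz_base dc6).
Qed.

Lemma odd_irreducible_C9 (a b d : int) : coprimez a b ->
  odd_irreducible (E_ C9 a b d).
Proof.
move=> cop p p_pr; rewrite leq_eqVlt => /predU1P[<-|p3] dc4 dc6 dD.
  exact: irreducible_C9_at3 cop dc4.
exact: cuspidal_C9 cop p_pr p3 (dvdz_base dc4) (dvdz_base dc6).
Qed.

Lemma odd_irreducible_C10 (a b d : int) : coprimez a b ->
  odd_irreducible (E_ C10 a b d).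
Proof.
move=> cop p p_pr; rewrite leq_eqVlt => /predU1P[<-|p3] dc4 dc6 dD.
  exact: irreducible_C10_at3 cop dc4.
have p5 := cuspidal_C10 cop p_pr p3 (dvdz_base dc4) (dvdz_base dc6).
rewrite p5 in dc4 dc6; exact: irreducible_C10_at5 cop dc4.
Qed.

Lemma odd_irreducible_C12 (a b d : int) : coprimez a b ->
  odd_irreducible (E_ C12 a b d).
Proof.
move=> cop p p_pr; rewrite leq_eqVlt => /predU1P[<-|p3] dc4 dc6 dD.
  exact: irreducible_C12_at3 cop dc4.
exact: cuspidal_C12 cop p_pr p3 (dvdz_base dc4) (dvdz_base dc6).
Qed.

Lemma odd_irreducible_C2xC4 (a b d : int) : coprimez a b ->
  odd_irreducible (E_ C2xC4 a b d).
Proof.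
move=> cop p p_pr; rewrite leq_eqVlt => /predU1P[<-|p3] dc4 dc6 dD.
  exact: irreducible_C2xC4_at3 cop dc4.
exact: cuspidal_C2xC4 cop p_pr p3 (dvdz_base dc4) (dvdz_base dc6).
Qed.

Lemma odd_irreducible_C2xC6 (a b d : int) : coprimez a b ->
  odd_irreducible (E_ C2xC6 a b d).
Proof.
move=> cop p p_pr; rewrite leq_eqVlt => /predU1P[<-|p3] dc4 dc6 dD.
  exact: irreducible_C2xC6_at3 cop dc4.
exact: cuspidal_C2xC6 cop p_pr p3 (dvdz_base dc4) (dvdz_base dc6).
Qed.

Lemma odd_irreducible_C2xC8 (a b d : int) : coprimez a b ->
  odd_irreducible (E_ C2xC8 a b d).
Proof.
move=> cop p p_pr; rewrite leq_eqVlt => /predU1P[<-|p3] dc4 dc6 dD.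
  exact: irreducible_C2xC8_at3 cop dc4.
exact: cuspidal_C2xC8 cop p_pr p3 (dvdz_base dc4) (dvdz_base dc6).
Qed.

Lemma global_minimal_model_family (T : torsion_type) (a b d c f : int) :
  s_ T a b d c f = 0 -> r_ T a b = 0 -> u_ T a b d c f != 0 ->
  discriminant (E_ T a b d) != 0 ->
  integral_scaling (E_ T a b d) (u_ T a b d c f) /\
    ~ reducible_at 2 (E_ T a b d) (u_ T a b d c f) ->
  odd_irreducible (E_ T a b d) ->
  global_minimal_model (to_rat (E_ T a b d)) (E' T a b d c f).
Proof.
move=> s0 r0 u0 D0 [iu irr2] irr; rewrite /E' s0 r0.
apply: global_minimal_scaling => //; exact: odd_irreducibleP.
Qed.

(** Rewrites the tests in [u_], [r_] and [s_] as divisibilities by literal powers of 2, within reach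
    of [lia]; the infinite valuation of 0 then needs no case of its own. *)
Definition dvdz_v2 := (dvdz_v2_ge, dvdz_v2_le, dvdz_v2_eq).

Lemma odd_of_even (a b : int) : coprimez a b -> (2 %| a)%Z -> ~~ (2 %| b)%Z.
Proof. by move=> cop a2; apply/negP => /(@prime_coprimez 2 _ _ isT cop a2). Qed.

Lemma minimal_C5 (a b d c f : int) : coprimez a b ->
  discriminant (E_ C5 a b d) != 0 ->
  global_minimal_model (to_rat (E_ C5 a b d)) (E' C5 a b d c f).
Proof.
move=> cop D0; apply: global_minimal_model_family => //.
  by split; [exact: integral_scaling1 | exact: irreducible_C5_at2].
exact: odd_irreducible_C5.
Qed.

Lemma minimal_C7 (a b d c f : int) : coprimez a b ->
  discriminant (E_ C7 a b d) != 0 ->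
  global_minimal_model (to_rat (E_ C7 a b d)) (E' C7 a b d c f).
Proof.
move=> cop D0; apply: global_minimal_model_family => //.
  by split; [exact: integral_scaling1 | exact: irreducible_C7_at2].
exact: odd_irreducible_C7.
Qed.

Lemma minimal_C9 (a b d c f : int) : coprimez a b ->
  discriminant (E_ C9 a b d) != 0 ->
  global_minimal_model (to_rat (E_ C9 a b d)) (E' C9 a b d c f).
Proof.
move=> cop D0; apply: global_minimal_model_family => //.
  by split; [exact: integral_scaling1 | exact: irreducible_C9_at2].
exact: odd_irreducible_C9.
Qed.

Lemma minimal_C6 (a b d c f : int) : coprimez a b ->
  discriminant (E_ C6 a b d) != 0 ->
  global_minimal_model (to_rat (E_ C6 a b d)) (E' C6 a b d c f).
Proof.
move=> cop D0; apply: global_minimal_model_family => //.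
  by rewrite /=; case: ifP.
have [ab2|ab2] := boolP (2 %| a + b)%Z; last first.
  have -> : u_ C6 a b d c f = 1.
    by rewrite /= ?dvdz_v2; do ?case: ifPn => //; lia.
  by split; [exact: integral_scaling1 | exact: irreducible_C6_at2].
have b2 : ~~ (2 %| b)%Z by have := odd_of_even cop; lia.
have [ab8|ab8] := boolP (8 %| a + b)%Z.
  have -> : u_ C6 a b d c f = 2.
    by rewrite /= ?dvdz_v2; do ?case: ifPn => //; lia.
  have [k ->] : exists k, a = - b + 8 * k by exists ((a + b) %/ 8)%Z; lia.
  exact: scaling_C6_u2.
have -> : u_ C6 a b d c f = 1.
  by rewrite /= ?dvdz_v2; do ?case: ifPn => //; lia.
split; first exact: integral_scaling1.
(* As [b] is odd, [a + b] is either 2 modulo 4, where [a] is [b] modulo 4, or 4 modulo 8, where [a]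
   is [3 b] modulo 8. *)
have [[k ->]|[k ->]] : (exists k, a = b + 4 * k) \/ (exists k, a = 3 * b
    + 8 * k).
  have [ab4|ab4] := boolP (4 %| a + b)%Z.
    by right; exists ((a - 3 * b) %/ 8)%Z; lia.
  by left; exists ((a - b) %/ 4)%Z; lia.
- exact: irreducible_C6_mod4.
- exact: irreducible_C6_mod8.
exact: odd_irreducible_C6.
Qed.

Lemma minimal_C10 (a b d c f : int) : coprimez a b ->
  discriminant (E_ C10 a b d) != 0 ->
  global_minimal_model (to_rat (E_ C10 a b d)) (E' C10 a b d c f).
Proof.
move=> cop D0; apply: global_minimal_model_family => //.
  by rewrite /=; case: ifP.
have [a2|a2] := boolP (2 %| a)%Z; last first.
  have -> : u_ C10 a b d c f = 1.
    by rewrite /= ?dvdz_v2; do ?case: ifPn => //; lia.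
  by split; [exact: integral_scaling1 | exact: irreducible_C10_at2].
have b2 := odd_of_even cop a2.
have -> : u_ C10 a b d c f = 2.
  by rewrite /= ?dvdz_v2; do ?case: ifPn => //; lia.
case/dvdzP: a2 => k ->; rewrite mulrC.
exact: scaling_C10_u2.
exact: odd_irreducible_C10.
Qed.

Lemma minimal_C12 (a b d c f : int) : coprimez a b ->
  discriminant (E_ C12 a b d) != 0 ->
  global_minimal_model (to_rat (E_ C12 a b d)) (E' C12 a b d c f).
Proof.
move=> cop D0; apply: global_minimal_model_family => //.
  by rewrite /=; case: ifP.
have [a2|a2] := boolP (2 %| a)%Z; last first.
  have -> : u_ C12 a b d c f = 1.
    by rewrite /= ?dvdz_v2; do ?case: ifPn => //; lia.
  by split; [exact: integral_scaling1 | exact: irreducible_C12_at2].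
have b2 := odd_of_even cop a2.
have -> : u_ C12 a b d c f = 2.
  by rewrite /= ?dvdz_v2; do ?case: ifPn => //; lia.
case/dvdzP: a2 => k ->; rewrite mulrC.
exact: scaling_C12_u2.
exact: odd_irreducible_C12.
Qed.

Lemma minimal_C8 (a b d c f : int) : coprimez a b ->
  discriminant (E_ C8 a b d) != 0 ->
  global_minimal_model (to_rat (E_ C8 a b d)) (E' C8 a b d c f).
Proof.
move=> cop D0; apply: global_minimal_model_family => //.
  by rewrite /=; case: ifP.
have [a2|a2] := boolP (2 %| a)%Z; last first.
  have -> : u_ C8 a b d c f = 1.
    by rewrite /= ?dvdz_v2; do ?case: ifPn => //; lia.
  by split; [exact: integral_scaling1 | exact: irreducible_C8_at2].
have b2 := odd_of_even cop a2; have [a4|a4] := boolP (4 %| a)%Z.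
  have -> : u_ C8 a b d c f = 1.
    by rewrite /= ?dvdz_v2; do ?case: ifPn => //; lia.
  have [k ->] : exists k, a = 4 * k by exists (a %/ 4)%Z; lia.
  exact: scaling_C8_u1.
have -> : u_ C8 a b d c f = 2.
  by rewrite /= ?dvdz_v2; do ?case: ifPn => //; lia.
have [k ->] : exists k, a = 2 * b + 4 * k by exists ((a - 2 * b) %/ 4)%Z; lia.
exact: scaling_C8_u2.
exact: odd_irreducible_C8.
Qed.

Lemma minimal_C2xC4 (a b d c f : int) : coprimez a b ->
  discriminant (E_ C2xC4 a b d) != 0 ->
  global_minimal_model (to_rat (E_ C2xC4 a b d)) (E' C2xC4 a b d c f).
Proof.
move=> cop D0; apply: global_minimal_model_family => //.
  by rewrite /=; do ?case: ifP.
have [a2|a2] := boolP (2 %| a)%Z; last first.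
  have -> : u_ C2xC4 a b d c f = 1.
    by rewrite /= ?dvdz_v2; do ?case: ifPn => //; lia.
  by split; [exact: integral_scaling1 | exact: irreducible_C2xC4_at2].
have b2 := odd_of_even cop a2; have [a4|a4] := boolP (4 %| a)%Z; last first.
  have -> : u_ C2xC4 a b d c f = 1.
    by rewrite /= ?dvdz_v2; do ?case: ifPn => //; lia.
  have [k ->] : exists k, a = 2 * b + 4 * k by exists ((a - 2 * b) %/ 4)%Z; lia.
  exact: scaling_C2xC4_u1.
have [a16|a16] := boolP (16 %| a + 4 * b)%Z.
  have -> : u_ C2xC4 a b d c f = 4.
    by rewrite /= ?dvdz_v2; do ?case: ifPn => //; lia.
  have [k ->] : exists k, a = - 4 * b + 16 * k by exists ((a + 4 * b) %/ 16)%Z;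
      lia.
  exact: scaling_C2xC4_u4.
have -> : u_ C2xC4 a b d c f = 2.
  by rewrite /= ?dvdz_v2; do ?case: ifPn => //; lia.
have [[k ->]|[[k ->]|[k ->]]] : (exists k, a = 16 * k) \/
    (exists k, a = 8 * b + 16 * k) \/ (exists k, a = 4 * b + 16 * k).
- have [a8|a8] := boolP (8 %| a)%Z; last first.
    by right; right; exists ((a - 4 * b) %/ 16)%Z; lia.
  have [a0|a0] := boolP (16 %| a)%Z; first by left; exists (a %/ 16)%Z; lia.
  by right; left; exists ((a - 8 * b) %/ 16)%Z; lia.
- exact: scaling_C2xC4_u2.
- exact: scaling_C2xC4_u2'.
- exact: scaling_C2xC4_u2''.
exact: odd_irreducible_C2xC4.
Qed.

Lemma minimal_C2xC6 (a b d c f : int) : coprimez a b ->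
  discriminant (E_ C2xC6 a b d) != 0 ->
  global_minimal_model (to_rat (E_ C2xC6 a b d)) (E' C2xC6 a b d c f).
Proof.
move=> cop D0; apply: global_minimal_model_family => //.
  by rewrite /=; do ?case: ifP.
have [ab2|ab2] := boolP (2 %| a + b)%Z; last first.
  have -> : u_ C2xC6 a b d c f = 1.
    by rewrite /= ?dvdz_v2; do ?case: ifPn => //; lia.
  by split; [exact: integral_scaling1 | exact: irreducible_C2xC6_at2].
have b2 : ~~ (2 %| b)%Z by have := odd_of_even cop; lia.
have [ab4|ab4] := boolP (4 %| a + b)%Z.
  have -> : u_ C2xC6 a b d c f = 4.
    by rewrite /= ?dvdz_v2; do ?case: ifPn => //; lia.
  have [k ->] : exists k, a = - b + 4 * k by exists ((a + b) %/ 4)%Z; lia.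
  exact: scaling_C2xC6_u4.
have -> : u_ C2xC6 a b d c f = 16.
  by rewrite /= ?dvdz_v2; do ?case: ifPn => //; lia.
have [[k ->]|[k ->]] : (exists k, a = b + 8 * k) \/ (exists k, a = 5 * b
    + 8 * k).
- have [ab8|ab8] := boolP (8 %| a - b)%Z; [left|right].
    by exists ((a - b) %/ 8)%Z; lia.
  by exists ((a - 5 * b) %/ 8)%Z; lia.
- exact: scaling_C2xC6_u16.
- exact: scaling_C2xC6_u16'.
exact: odd_irreducible_C2xC6.
Qed.

Lemma minimal_C2xC8 (a b d c f : int) : coprimez a b ->
  discriminant (E_ C2xC8 a b d) != 0 ->
  global_minimal_model (to_rat (E_ C2xC8 a b d)) (E' C2xC8 a b d c f).
Proof.
move=> cop D0; apply: global_minimal_model_family => //.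
  by rewrite /=; do ?case: ifP.
have [a2|a2] := boolP (2 %| a)%Z; last first.
  have -> : u_ C2xC8 a b d c f = 1.
    by rewrite /= ?dvdz_v2; do ?case: ifPn => //; lia.
  by split; [exact: integral_scaling1 | exact: irreducible_C2xC8_at2].
have b2 := odd_of_even cop a2; have [a4|a4] := boolP (4 %| a)%Z.
  have -> : u_ C2xC8 a b d c f = 64.
    by rewrite /= ?dvdz_v2; do ?case: ifPn => //; lia.
  have [k ->] : exists k, a = 4 * k by exists (a %/ 4)%Z; lia.
  exact: scaling_C2xC8_u64.
have -> : u_ C2xC8 a b d c f = 16.
  by rewrite /= ?dvdz_v2; do ?case: ifPn => //; lia.
have [k ->] : exists k, a = 2 * b + 4 * k by exists ((a - 2 * b) %/ 4)%Z; lia.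
exact: scaling_C2xC8_u16.
exact: odd_irreducible_C2xC8.
Qed.

(** * The families governed by squarefree or cubefree parameters *)

Lemma prime_power_gauss (p : nat) (m x : int) (k : nat) : prime p ->
  ~~ (p%:Z %| m)%Z -> (p%:Z ^+ k %| m * x)%Z -> (p%:Z ^+ k %| x)%Z.
Proof.
move=> p_pr pm; rewrite Gauss_dvdzr // coprimezXl //.
by move: pm; rewrite dvdzE -prime_coprime.
Qed.

Lemma prime_ndvdX_small (p q k : nat) : prime p -> prime q -> p <> q ->
  ~~ (p%:Z %| q%:Z ^+ k)%Z.
Proof.
move=> p_pr q_pr pq; apply/negP => /(prime_dvdzX p_pr).
by rewrite dvdzE /= dvdn_prime2 // => /eqP.
Qed.

Lemma PoszX (p k : nat) : (p ^ k)%N%:Z = p%:Z ^+ k.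
Proof. by rewrite -natz natrX natz. Qed.

Lemma squarefree_ndvd (n : int) (p : nat) : squarefree n -> prime p ->
  ~~ (p%:Z ^+ 2 %| n)%Z.
Proof. by move=> sqf p_pr; rewrite -PoszX; exact: sqf. Qed.

(** The discriminant is [- 27 a^4]. Away from 3, [p^12] dividing it gives [p^3 | a]; at 3, [a^4] has
    valuation at least 9 and again [27 | a]. *)
Lemma minimal_C3_0 (a b d c f : int) : cubefree a ->
  discriminant (E_ C3_0 a b d) != 0 ->
  global_minimal_model (to_rat (E_ C3_0 a b d)) (E' C3_0 a b d c f).
Proof.
move=> cbf D0.
apply: (@global_minimal_scaling (E_ C3_0 a b d) 1 isT D0 (integral_scaling1 _)).
move=> p p_pr [x [y [z [_ _ Ez _]]]].
have {Ez} : (p%:Z ^+ 12 %| (- 3%:Z ^+ 3) * a ^+ 4)%Z.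
  apply/dvdzP; exists z; transitivity (1 ^+ 12 * (p%:Z ^+ 12 * z));
      last by ring.
  by rewrite -Ez /=; ring.
have p0 : p%:Z != 0 by rewrite -lt0n prime_gt0.
have cube_free : ~~ (p%:Z ^+ 3 %| a)%Z by rewrite -PoszX; exact: cbf.
have [E3|p3] := eqVneq p 3%N; last first.
  move/(prime_power_gauss p_pr); rewrite rpredN.
  move/(_ (prime_ndvdX_small _ p_pr (isT : prime 3) (elimN eqP p3))).
  by rewrite (exprM _ 3 4) dvdz_pexp2r //; exact/negP.
rewrite E3 in cube_free *; rewrite mulNr -mulrN (exprD _ 3 9) dvdz_mul2l // =>
    d9.
(* As 9 is not a multiple of 4, eight of the factors 3 of [a^4] first give [9 | a], and the ninth
   then divides the fourth power of [a / 9]. *)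
have /dvdzP[k Ek] : (3 ^+ 2 %| a)%Z.
  rewrite -(@dvdz_pexp2r _ _ 4) // -rpredN; apply: dvdz_trans d9.
  exact: (@dvdz_exp2l 3 8 9).
move: d9 cube_free; rewrite Ek rpredN.
have -> : (k * 3 ^+ 2) ^+ 4 = 3 ^+ 8 * k ^+ 4 by ring.
rewrite (exprD _ 8 1) dvdz_mul2l // => /(@prime_dvdzX 3 _ 4 isT)/dvdzP[l ->].
by case/negP; apply/dvdzP; exists l; ring.
Qed.

(** With [Q = a^2 - a b + b^2], [c4 = 16 d^2 Q] and the discriminant is [16 (a b (a - b))^2 d^6]. A
    prime dividing [Q] divides none of [a], [b], [a - b]. So for odd [p] one of the two invariants
    leaves its whole power of [p] to [d], against squarefreeness. *)
Lemma minimal_C2xC2 (a b d c f : int) : coprimez a b -> (2 %| a)%Z ->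
  squarefree d -> discriminant (E_ C2xC2 a b d) != 0 ->
  global_minimal_model (to_rat (E_ C2xC2 a b d)) (E' C2xC2 a b d c f).
Proof.
move=> cop a2 sqf D0; have b2 := odd_of_even cop a2.
have irr : odd_irreducible (E_ C2xC2 a b d).
  move=> p p_pr p2 dc4 _ dD.
  have p_odd k : ~~ (p%:Z %| 2%:Z ^+ k)%Z.
    by apply: prime_ndvdX_small => //; lia.
  have {}dc4 : (p%:Z ^+ 4 %| d ^+ 2 * (a ^+ 2 - a * b + b ^+ 2))%Z.
    apply: (prime_power_gauss p_pr (p_odd 4)).
    by move: dc4; congr (_ %| _)%Z; rewrite /=; ring.
  have {}dD : (p%:Z ^+ 12 %| (a * b * (a - b)) ^+ 2 * d ^+ 6)%Z.
    apply: (prime_power_gauss p_pr (p_odd 4)).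
    by move: dD; congr (_ %| _)%Z; rewrite /=; ring.
  have p_sqf := squarefree_ndvd sqf p_pr.
  have [pQ|pQ] := boolP (p%:Z %| a ^+ 2 - a * b + b ^+ 2)%Z; last first.
    case/negP: p_sqf; rewrite -(@dvdz_pexp2r _ _ 2) // -exprM.
    by apply: (prime_power_gauss p_pr pQ); rewrite mulrC.
  case/negP: p_sqf; rewrite -(@dvdz_pexp2r _ _ 6) // -exprM.
  apply: (prime_power_gauss p_pr _ dD); apply/negP.
  move/(prime_dvdzX p_pr)/(prime_dvdzM p_pr) => [/(prime_dvdzM p_pr)[]|] pP.
  - apply: (prime_coprimez p_pr cop pP); apply: (prime_dvdzX p_pr (k := 2)).
    by have := dvdz_lincomb 1 (b - a) pQ pP; congr (_ %| _)%Z; ring.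
  - apply: (prime_coprimez p_pr cop _ pP); apply: (prime_dvdzX p_pr (k := 2)).
    by have := dvdz_lincomb 1 (a - b) pQ pP; congr (_ %| _)%Z; ring.
  - have pa : (p%:Z %| a)%Z.
      apply: (prime_dvdzX p_pr (k := 2)).
      by have := dvdz_lincomb 1 b pQ pP; congr (_ %| _)%Z; ring.
    apply: (prime_coprimez p_pr cop pa).
    by have := dvdz_lincomb 1 (- 1) pa pP; congr (_ %| _)%Z; ring.
have [u2|u2] := boolP ((16 %| a)%Z && (4 %| b * d - 1)%Z).
  have Eu : u_ C2xC2 a b d c f = 2.
    by rewrite /= dvdz_v2; case: ifPn => //; lia.
  rewrite /E' /s_ Eu /=.
  have [k Ea] : exists k, a = 16 * k.
    by exists (a %/ 16)%Z; lia.
  apply: (global_minimal_model_criterion (u := 2) (r := 0) (s := 1)) => //.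
    by rewrite Ea /=; split; lia.
  apply: odd_irreducibleP irr _.
  apply: (@irreducible2_unit_c4 _ 2 (d ^+ 2 * (128 * k ^+ 2
      - 8 * k * b)) (b * d) 2) => //.
    by lia.
  by rewrite Ea /=; ring.
have Eu : u_ C2xC2 a b d c f = 1 by rewrite /= dvdz_v2; case: ifPn => //; lia.
rewrite /E' /s_ Eu /=.
apply: (@global_minimal_scaling (E_ C2xC2 a b d) 1 isT D0 (integral_scaling1
    _)).
apply: odd_irreducibleP irr _ => -[x [y [z [Ex Ey Ez /(_ erefl) K]]]].
case/dvdzP: a2 => a' Ea; rewrite {}Ea in u2 Ex Ey Ez.
have {}Ex : x = d ^+ 2 * (4 * a' ^+ 2 - 2 * a' * b + b ^+ 2).
  apply: (@mulfI _ 16) => //; transitivity (1 ^+ 4 * (2%:Z ^+ 4 * x));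
      first by ring.
  by rewrite -Ex /=; ring.
have {}Ey : y = - (d ^+ 3 * (2 * a' + b) * (4 * a' - b) * (a' - b)).
  apply: (@mulfI _ 64) => //; transitivity (1 ^+ 6 * (2%:Z ^+ 6 * y));
      first by ring.
  by rewrite -Ey /=; ring.
have {}Ez : 64 * z = (b * (2 * a' - b) * d ^+ 3) ^+ 2 * a' ^+ 2.
  apply: (@mulfI _ 64) => //; transitivity (1 ^+ 12 * (2%:Z ^+ 12 * z));
      first by ring.
  by rewrite -Ez /=; ring.
(* For [d = 2 e] the quotient [x] is [4 (b e)^2], that is 4, modulo 8: neither odd nor a multiple of
   16. *)
have [d2|d2] := boolP (2 %| d)%Z.
  have := squarefree_ndvd sqf (isT : prime 2).
  case/dvdzP: d2 => e Ed; rewrite {}Ed in Ex * => e2.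
  have [t Et] : exists t, b * e = 2 * t + 1.
    by apply/odd_rep/odd_mul => //; move: e2; clear; lia.
  have {}Ex : x = 8 * (e ^+ 2 * (2 * a' ^+ 2 - a' * b)) + 4 * (b * e) ^+ 2.
    by rewrite Ex; ring.
  move: K Ex; rewrite Et; clear => K Ex.
  by case: K => [[i [j [Ei _]]]|[i [Ei _]]]; lia.
(* For odd [d] the discriminant gives [64 | a'^2], hence [16 | a]. Then [y] is [- (b d)^3] modulo 4,
   and Kraus's residue 3 means [b d = 1] modulo 4, the case where [u = 2]. *)
have a'8 : (2 ^+ 3 %| a')%Z.
  rewrite -(@dvdz_pexp2r _ _ 2) // -exprM.
  apply: (@prime_power_gauss 2 ((b * (2 * a' - b) * d ^+ 3) ^+ 2)) => //;
      last first.
    by rewrite -Ez dvdz_mulr.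
  apply/odd_pow/odd_mul/odd_pow => //; apply: odd_mul => //.
  by move: b2; clear; lia.
case/dvdzP: a'8 => m Em.
have [t Et] := odd_rep (odd_mul b2 d2).
have [q Eq] : exists q, y = 4 * q - (b * d) ^+ 3.
  exists (- (d ^+ 3 * (1024 * m ^+ 3 - 96 * m ^+ 2 * b - 6 * m * b ^+ 2))).
  by rewrite Ey Em; ring.
have {}Ex : x = 2 * (d ^+ 2 * (2 * a' ^+ 2 - a' * b)) + (b * d) ^+ 2.
  by rewrite Ex; ring.
move: u2 K Ex Eq; rewrite Em Et; clear => u2 K Ex Eq.
by case: K => [[i [j [_ Ej]]]|[i [Ei _]]]; lia.
Qed.

Lemma prime_dvdz_exact (p : nat) (n : int) : squarefree n -> prime p ->
  (p%:Z %| n)%Z -> exists2 m, n = p%:Z * m & ~~ (p%:Z %| m)%Z.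
Proof.
move=> sqf p_pr /dvdzP[m Em]; exists m; first by rewrite Em mulrC.
apply: contra (squarefree_ndvd sqf p_pr) => /dvdzP[k Ek].
by apply/dvdzP; exists k; rewrite Em Ek; ring.
Qed.

(** Removing [u = c^2 f] leaves [c f^2 g^3 (a - 24 b)] from [c4] and [f^4 g^8 b^3 (a - 27 b)] from
    the discriminant. A prime dividing the first is prime to [b]. Away from 3, a prime factor of [f]
    or [g] contributes only 4 or 8 to the second, and a prime dividing [a - 27 b] but not [f g]
    misses the first. *)
Lemma minimal_C3 (a b d c f g : int) : coprimez a b ->
  a = c ^+ 3 * f ^+ 2 * g -> c != 0 -> f != 0 -> coprimez f g ->
  squarefree f -> squarefree g -> discriminant (E_ C3 a b d) != 0 ->
  global_minimal_model (to_rat (E_ C3 a b d)) (E' C3 a b d c f).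
Proof.
move=> cop Ea c0 f0 copfg sqff sqfg D0.
have u0 : c ^+ 2 * f != 0 by rewrite mulf_neq0 ?expf_neq0.
apply: (@global_minimal_scaling (E_ C3 a b d) _ u0 D0).
  split=> /=; rewrite ?dvdz0 //; apply/dvdzP.
    by exists (c * f * g); rewrite Ea; ring.
  by exists (f * g ^+ 2 * b); rewrite Ea; ring.
move=> p p_pr [x [y [z [Ex _ Ez _]]]].
have {}Ex : c * f ^+ 2 * g ^+ 3 * (a - 24 * b) = p%:Z ^+ 4 * x.
  apply: (@mulfI _ ((c ^+ 2 * f) ^+ 4)); first by rewrite expf_neq0.
  by rewrite -Ex /= Ea; ring.
have {}Ez : f ^+ 4 * g ^+ 8 * b ^+ 3 * (a - 27 * b) = p%:Z ^+ 12 * z.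
  apply: (@mulfI _ ((c ^+ 2 * f) ^+ 12)); first by rewrite expf_neq0.
  by rewrite -Ez /= Ea; ring.
have pE k t : (p%:Z %| p%:Z ^+ k.+1 * t)%Z by rewrite exprS -mulrA dvdz_mulr.
have pD : (p%:Z ^+ 12 %| f ^+ 4 * g ^+ 8 * b ^+ 3 * (a - 27 * b))%Z.
  by rewrite Ez dvdz_mulr.
have pc4 : (p%:Z ^+ 4 %| c * f ^+ 2 * g ^+ 3 * (a - 24 * b))%Z.
  by rewrite Ex dvdz_mulr.
have pcfg_a t : (p%:Z %| t)%Z -> [\/ t = c, t = f | t = g] -> (p%:Z %| a)%Z.
  move=> /dvdzP[m ->] [] E; rewrite Ea -E; apply/dvdzP.
  - by exists (m ^+ 3 * p%:Z ^+ 2 * f ^+ 2 * g); ring.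
  - by exists (c ^+ 3 * m ^+ 2 * p%:Z * g); ring.
  - by exists (c ^+ 3 * f ^+ 2 * m); ring.
have pb : ~~ (p%:Z %| b)%Z.
  apply/negP => pb; have pa := prime_coprimez p_pr cop ^~ pb.
  have := dvdz_base pc4; apply/negP;
      apply: (prime_ndvdM p_pr (prime_ndvdM p_pr (prime_ndvdM p_pr _ _) _)).
  - by apply/negP => /pcfg_a H; apply/pa/H; constructor 1.
  - by apply: prime_ndvdzX => //; apply/negP => /pcfg_a H; apply/pa/H;
      constructor 2.
  - by apply: prime_ndvdzX => //; apply/negP => /pcfg_a H; apply/pa/H;
      constructor 3.
  - apply/negP => pab; apply: pa.
    by have := dvdz_lincomb 1 24 pab pb; congr (_ %| _)%Z; ring.
have p_fg : (p%:Z %| f)%Z -> (p%:Z %| g)%Z -> False by exact: prime_coprimez.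
have [p3|p3] := eqVneq p 3%N; last first.
  have pk k : ~~ (p%:Z %| 3%:Z ^+ k)%Z.
    by apply: prime_ndvdX_small => //; exact/eqP.
  have [pf|pf] := boolP (p%:Z %| f)%Z.
    have pa : (p%:Z %| a)%Z by apply: (pcfg_a f) => //; constructor 2.
    have := squarefree_ndvd sqff p_pr; case/negP.
    have : (p%:Z ^+ 12 %| g ^+ 8 * b ^+ 3 * (a - 27 * b) * f ^+ 4)%Z.
      by move: pD; congr (_ %| _)%Z; ring.
    move/(prime_power_gauss p_pr) => H; have {H} : (p%:Z ^+ 12 %| f ^+ 4)%Z.
      apply: H; apply: (prime_ndvdM p_pr (prime_ndvdM p_pr _ _)).
      - by apply: prime_ndvdzX => //; apply/negP; exact: p_fg.
      - exact: prime_ndvdzX.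
      - apply/negP => pab; have : (p%:Z %| 3 ^+ 3 * b)%Z.
          by have := dvdz_lincomb 1 (- 1) pa pab; congr (_ %| _)%Z; ring.
        by apply/negP/prime_ndvdM.
    rewrite (exprM _ 3 4) dvdz_pexp2r // => /(dvdz_trans _); apply.
    exact: dvdz_exp2l.
  have [pg|pg] := boolP (p%:Z %| g)%Z.
    have pa : (p%:Z %| a)%Z by apply: (pcfg_a g) => //; constructor 3.
    have [m Em pm] := prime_dvdz_exact sqfg p_pr pg.
    have : (p%:Z ^+ 12 %| f ^+ 4 * b ^+ 3 * (a - 27 * b) * g ^+ 8)%Z.
      by move: pD; congr (_ %| _)%Z; ring.
    move/(prime_power_gauss p_pr) => H; have {H} : (p%:Z ^+ 12 %| g ^+ 8)%Z.
      apply: H; apply: (prime_ndvdM p_pr (prime_ndvdM p_pr _ _)).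
      - exact: prime_ndvdzX.
      - exact: prime_ndvdzX.
      - apply/negP => pab; have : (p%:Z %| 3 ^+ 3 * b)%Z.
          by have := dvdz_lincomb 1 (- 1) pa pab; congr (_ %| _)%Z; ring.
        by apply/negP/prime_ndvdM.
    rewrite Em exprMn (exprD _ 8 4) dvdz_mul2l; last first.
      by rewrite expf_neq0 // -lt0n prime_gt0.
    by move/dvdz_base; apply/negP/prime_ndvdzX.
  have pab : (p%:Z %| a - 27 * b)%Z.
    have := dvdz_base pD; case/(prime_dvdzM p_pr) => //.
    case/(prime_dvdzM p_pr) => [|/(prime_dvdzX p_pr)];
        last by rewrite (negPf pb).
    by case/(prime_dvdzM p_pr) => /(prime_dvdzX p_pr);
        rewrite ?(negPf pf) ?(negPf pg).
  have := dvdz_base pc4; apply/negP;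
      apply: (prime_ndvdM p_pr (prime_ndvdM p_pr (prime_ndvdM p_pr _ _) _)).
  - apply/negP => pc; have pa : (p%:Z %| a)%Z by apply: (pcfg_a c) => //;
      constructor 1.
    have : (p%:Z %| 3 ^+ 3 * b)%Z.
      by have := dvdz_lincomb 1 (- 1) pa pab; congr (_ %| _)%Z; ring.
    by apply/negP/prime_ndvdM.
  - exact: prime_ndvdzX.
  - exact: prime_ndvdzX.
  - apply/negP => pab'; have : (p%:Z %| 3 ^+ 1 * b)%Z.
      by have := dvdz_lincomb 1 (- 1) pab' pab; congr (_ %| _)%Z; ring.
    by apply/negP/prime_ndvdM.
rewrite {}p3 in pb p_fg pD pc4 pcfg_a.
have [P3 nd nX] : [/\ prime 3,
    forall m n : int, ~~ (3 %| m)%Z -> ~~ (3 %| n)%Z -> ~~ (3 %| m * n)%Z &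
    forall (m : int) k, ~~ (3 %| m)%Z -> ~~ (3 %| m ^+ k)%Z].
  by split=> // *; [exact: (@prime_ndvdM 3) | exact: (@prime_ndvdzX 3)].
have {}pD : (3 ^+ 12 %| f ^+ 4 * g ^+ 8 * (a - 27 * b))%Z.
  apply: (@prime_power_gauss 3 (b ^+ 3)) => //; first exact: nX.
  by move: pD; congr (_ %| _)%Z; ring.
(* At 3 the factor [f^4 g^8] absorbs at most 8 of the 12 factors, because 3 divides at most one of
   [f] and [g], and only once. *)
have ab81 : (3 ^+ 4 %| a - 27 * b)%Z.
  have cancel3 k n m : (3 ^+ (k + n) %| 3 ^+ k * m)%Z -> (3 ^+ n %| m)%Z.
    by rewrite exprD dvdz_mul2l // expf_neq0.
  have [pf|pf] := boolP (3 %| f)%Z.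
    have [m Em pm] := prime_dvdz_exact sqff P3 pf.
    apply: (dvdz_trans (dvdz_exp2l 3 (isT : (4 <= 8)%N))).
    apply: (@prime_power_gauss 3 (m ^+ 4 * g ^+ 8)) => //.
      by apply: nd; apply: nX => //; apply/negP; exact: p_fg.
    by apply: (cancel3 4%N); move: pD; rewrite Em; congr (_ %| _)%Z; ring.
  have [pg|pg] := boolP (3 %| g)%Z.
    have [m Em pm] := prime_dvdz_exact sqfg P3 pg.
    apply: (@prime_power_gauss 3 (f ^+ 4 * m ^+ 8)) => //.
      by apply: nd; exact: nX.
    by apply: (cancel3 8%N); move: pD; rewrite Em; congr (_ %| _)%Z; ring.
  apply: (dvdz_trans (dvdz_exp2l 3 (isT : (4 <= 12)%N))).
  apply: (@prime_power_gauss 3 (f ^+ 4 * g ^+ 8)) => //.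
  by apply: nd; exact: nX.
have {ab81}[t Et] : exists t, a = 27 * (b + 3 * t).
  by case/dvdzP: ab81 => t Et; exists t; rewrite -[a](subrK (27 * b)) Et; ring.
have bt k : ~~ (3 %| b + 3 * k)%Z by move: pb; clear; lia.
(* Now [a = 27 (b + 3 t)] has valuation exactly 3. As [a = c^3 f^2 g], either 3 divides [c] once and
   not [f g], or [f^2 g] has valuation 3, impossible for coprime squarefree [f], [g]. In the first
   case [c] and [a - 24 b = 3 (b + 27 t)] give the quotient of [c4] valuation 2 instead of 4. *)
rewrite Ea in Et; have [/dvdzP[c' Ec]|pc] := boolP (3 %| c)%Z.
  have Et' : c' ^+ 3 * f ^+ 2 * g = b + 3 * t.
    by apply: (@mulfI _ 27) => //; rewrite -Et Ec; ring.
  have ndcfg : ~~ (3 %| c' * f ^+ 2 * g ^+ 3)%Z.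
    apply/negP => /dvdzP[k Ek]; have := nX _ 3 (bt t); rewrite -Et'.
    case/negP; apply/dvdzP.
    by exists (k * (c' ^+ 8 * f ^+ 4)); transitivity (c' ^+ 8 * f ^+ 4 * (c'
        * f ^+ 2 * g ^+ 3)); [|rewrite Ek]; ring.
  have := nd _ _ ndcfg (bt (9 * t)); case/negP.
  apply: (@dvdz_base 3 1); rewrite -(@dvdz_mul2l (3 ^+ 2)) // -exprD.
  by move: pc4; rewrite Ea Et Ec; congr (_ %| _)%Z; ring.
have /nd ndcf : ~~ (3 %| c ^+ 3)%Z by exact: nX.
have [pf|pf] := boolP (3 %| f)%Z.
  have [m Em pm] := prime_dvdz_exact sqff P3 pf.
  have : (3 %| c ^+ 3 * (m ^+ 2 * g))%Z.
    apply/dvdzP; exists (b + 3 * t); apply: (@mulfI _ 9) => //.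
    by transitivity (27 * (b + 3 * t)); [rewrite -Et Em|]; ring.
  apply/negP/ndcf/nd; first exact: nX.
  by apply/negP; exact: p_fg.
have [pg|pg] := boolP (3 %| g)%Z.
  have [m Em pm] := prime_dvdz_exact sqfg P3 pg.
  have : (3 %| c ^+ 3 * (f ^+ 2 * m))%Z.
    apply/dvdzP; exists (3 * (b + 3 * t)); apply: (@mulfI _ 3) => //.
    by transitivity (27 * (b + 3 * t)); [rewrite -Et Em|]; ring.
  by apply/negP/ndcf/nd => //; exact: nX.
have : (3 %| c ^+ 3 * (f ^+ 2 * g))%Z.
  by apply/dvdzP; exists (9 * (b + 3 * t)); rewrite mulrA Et; ring.
by apply/negP/ndcf/nd => //; exact: nX.
Qed.

(** A common odd factor of [a] and [Q = a^2 + 16 a b + 16 b^2] would divide [b], so a prime factor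
    of [f] would need [p^4 | f^2]. Otherwise [p] divides [Q], then [a + 16 b] through the
    discriminant, and [Q - a (a + 16 b) = 16 b^2] is a contradiction. The factors 16 and [2^12] let
    one statement serve [u = c] and [u = 2 c]. *)
Lemma odd_irreducible_C4 (a b c f : int) : coprimez a b ->
  a = c ^+ 2 * f -> squarefree f ->
  forall (p : nat) (x z : int), prime p -> ~~ (p%:Z %| 2)%Z ->
  16 * (f ^+ 2 * (a ^+ 2 + 16 * a * b + 16 * b ^+ 2)) = p%:Z ^+ 4 * x ->
  2 ^+ 12 * (c ^+ 2 * f ^+ 7 * b ^+ 4 * (a + 16 * b)) = p%:Z ^+ 12 * z -> False.
Proof.
move=> cop Ea sqf p x z p_pr p2 Ex Ez.
have p2k k : ~~ (p%:Z %| 2 ^+ k)%Z by exact: prime_ndvdzX.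
have pc4 : (p%:Z ^+ 4 %| f ^+ 2 * (a ^+ 2 + 16 * a * b + 16 * b ^+ 2))%Z.
  by apply: (prime_power_gauss p_pr (p2k 4%N)); rewrite [_ * _]Ex dvdz_mulr.
have pD : (p%:Z ^+ 12 %| c ^+ 2 * f ^+ 7 * b ^+ 4 * (a + 16 * b))%Z.
  by apply: (prime_power_gauss p_pr (p2k 12%N)); rewrite Ez dvdz_mulr.
have pa_c : (p%:Z %| c)%Z -> (p%:Z %| a)%Z.
  by move=> pc; rewrite Ea exprS -!mulrA dvdz_mulr.
have pa_f : (p%:Z %| f)%Z -> (p%:Z %| a)%Z by move=> pf; rewrite Ea dvdz_mull.
have c4_unit : (p%:Z %| a)%Z -> ~~ (p%:Z %| a ^+ 2 + 16 * a * b
    + 16 * b ^+ 2)%Z.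
  move=> pa; apply/negP => pQ.
  have : (p%:Z %| 2 ^+ 4 * b ^+ 2)%Z.
    by have := dvdz_lincomb 1 (- a - 16 * b) pQ pa; congr (_ %| _)%Z; ring.
  apply/negP/(prime_ndvdM p_pr) => //; apply: prime_ndvdzX => //.
  by apply/negP; exact: prime_coprimez pa.
have [pf|pf] := boolP (p%:Z %| f)%Z.
  have /c4_unit pQ := pa_f pf.
  have : (p%:Z ^+ 4 %| f ^+ 2)%Z by apply: (prime_power_gauss p_pr pQ);
      rewrite mulrC.
  by rewrite (exprM _ 2 2) dvdz_pexp2r //; exact/negP/squarefree_ndvd.
have pQ : (p%:Z %| a ^+ 2 + 16 * a * b + 16 * b ^+ 2)%Z.
  case/(prime_dvdzM p_pr): (dvdz_base pc4) => // /(prime_dvdzX p_pr).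
  by rewrite (negPf pf).
have pa : ~~ (p%:Z %| a)%Z by apply: contraL pQ.
have pb : ~~ (p%:Z %| b)%Z.
  apply: contra pa => pb; apply: (prime_dvdzX p_pr (k := 2)).
  have := dvdz_lincomb 1 (- 16 * a - 16 * b) pQ pb; congr (_ %| _)%Z; ring.
have pab : (p%:Z %| a + 16 * b)%Z.
  case/(prime_dvdzM p_pr): (dvdz_base pD) => //.
  case/(prime_dvdzM p_pr) => [|/(prime_dvdzX p_pr)]; last by rewrite (negPf pb).
  case/(prime_dvdzM p_pr) => /(prime_dvdzX p_pr); last by rewrite (negPf pf).
  by move/pa_c; rewrite (negPf pa).
have : (p%:Z %| 2 ^+ 4 * b ^+ 2)%Z.
  by have := dvdz_lincomb 1 (- a) pQ pab; congr (_ %| _)%Z; ring.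
by apply/negP/(prime_ndvdM p_pr) => //; exact: prime_ndvdzX.
Qed.

(** Supplies the parity clause in the test for [u = 2 c]: an odd [f] leaves all factors 2 of [a] in
    the square. *)
Lemma v2_even_sqrM (c f : int) : c != 0 -> ~~ (2 %| f)%Z ->
  v2_even (c ^+ 2 * f).
Proof.
move=> c0 f2; have f0 : f != 0 by apply: contraNneq f2 => ->; rewrite dvdz0.
rewrite /v2_even /v2 mulf_eq0 expf_eq0 /= (negPf c0) (negPf f0) /=.
rewrite abszM abszX lognM ?expn_gt0 ?absz_gt0 ?c0 // lognX oddD oddM /=.
by rewrite logn_coprime ?prime_coprime //; move: f2; rewrite dvdzE.
Qed.

(** The conclusions imply the test for [u = 2 c], so [u = c] is minimal at 2 when that test fails.
    First [a] must be even, hence [b] odd; the cases then follow the parities of [f], of [c] and of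
    its successive halves. *)
Lemma irreducible2_C4 (a b d c f : int) : coprimez a b ->
  a = c ^+ 2 * f -> c != 0 -> squarefree f -> reducible_at 2 (E_ C4 a b d) c ->
  [/\ ~~ (2 %| f)%Z, (16 %| c)%Z & (4 %| b * f - 3)%Z].
Proof.
move=> cop Ea c0 sqf [x [y [z [Ex Ey Ez /(_ erefl) K]]]].
have {}Ex : f ^+ 2 * (a ^+ 2 + 16 * a * b + 16 * b ^+ 2) = 16 * x.
  apply: (@mulfI _ (c ^+ 4)); first by rewrite expf_neq0.
  by transitivity (c ^+ 4 * (2%:Z ^+ 4 * x)); [rewrite -Ex /= Ea|]; ring.
have {}Ey : - f ^+ 3 * (a + 8 * b) * (a ^+ 2 + 16 * a * b - 8 * b ^+ 2)
    = 64 * y.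
  apply: (@mulfI _ (c ^+ 6)); first by rewrite expf_neq0.
  by transitivity (c ^+ 6 * (2%:Z ^+ 6 * y)); [rewrite -Ey /= Ea|]; ring.
have {}Ez : c ^+ 2 * f ^+ 7 * b ^+ 4 * (a + 16 * b) = 4096 * z.
  apply: (@mulfI _ (c ^+ 12)); first by rewrite expf_neq0.
  by transitivity (c ^+ 12 * (2%:Z ^+ 12 * z)); [rewrite -Ez /= Ea|]; ring.
have f4 : ~~ (4 %| f)%Z := squarefree_ndvd sqf (isT : prime 2).
have a_even : (2 %| c)%Z || (2 %| f)%Z.
  apply/norP => -[c2 f2]; have a2 : ~~ (2 %| a)%Z.
    by rewrite Ea; apply: odd_mul => //; exact: (@prime_ndvdzX 2).
  apply: (@unit_residue 2 (16 * x) (f * a) (8 * f ^+ 2 * (a * b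
      + b ^+ 2)) 1 0 1 2) => //.
  - exact: odd_mul.
  - by rewrite -Ex; ring.
  - by rewrite dvdz_mulr.
have b2 : ~~ (2 %| b)%Z.
  apply: odd_of_even cop _; rewrite Ea.
  by case/orP: a_even => h;
      [rewrite exprS -!mulrA dvdz_mulr | rewrite dvdz_mull].
(* For [f = 2 f'], an even [c] makes [x] equal to 4 modulo 8, and an odd [c] makes [x] odd but [y]
   equal to [- 1 + 2 = 1] modulo 4; Kraus excludes both. *)
have [f2|f2] := boolP (2 %| f)%Z.
  exfalso; case/dvdzP: f2 => f' Ef; rewrite {}Ef in Ea Ex Ey Ez f4.
  have f'2 : ~~ (2 %| f')%Z by move: f4; clear; lia.
  have {}Ex : x = (c ^+ 2 * f' ^+ 2) ^+ 2 + 8 * c ^+ 2 * f' ^+ 3 * b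
      + 4 * (f' * b) ^+ 2.
    by apply: (@mulfI _ 16) => //; rewrite -Ex Ea; ring.
  have {}Ey : y = - f' ^+ 3 * (c ^+ 2 * f' + 4 * b)
      * (c ^+ 4 * f' ^+ 2 + 8 * c ^+ 2 * f' * b - 2 * b ^+ 2).
    by apply: (@mulfI _ 64) => //; rewrite -Ey Ea; ring.
  have [l El] := odd_rep (odd_mul f'2 b2).
  have [/dvdzP[k Ek]|c2] := boolP (2 %| c)%Z.
    have {}Ex : x = 16 * (k ^+ 2 * f' ^+ 2) ^+ 2 + 32 * k ^+ 2 * f' ^+ 3 * b
        + 4 * (2 * l + 1) ^+ 2.
      by rewrite Ex El Ek; ring.
    by case: K Ex => [[i [j [-> _]]]|[i [-> _]]]; clear; lia.
  have {}Ey : y = 4 * - (f' ^+ 3 * (3 * c ^+ 4 * f' ^+ 2 * b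
      + 8 * c ^+ 2 * f' * b ^+ 2
      - 2 * b ^+ 3)) - (c ^+ 3 * f' ^+ 3) ^+ 2 + 2 * (c * f' ^+ 2 * b) ^+ 2.
    by rewrite Ey; ring.
  have [r Er] := odd_rep (odd_mul (odd_pow 3 c2) (odd_pow 3 f'2)).
  have [s Es] := odd_rep (odd_mul (odd_mul c2 (odd_pow 2 f'2)) b2).
  have [t Et] := odd_rep (odd_mul (odd_pow 2 c2) (odd_pow 2 f'2)).
  move: K Ex Ey; rewrite El Er Es Et; move: (f' ^+ 3 * _) (c ^+ 2 * f' ^+ 3) =>
      A B.
  by clear=> -[[i [j [_ ->]]]|[i [-> _]]]; lia.
have {a_even} : (2 %| c)%Z by move: a_even; rewrite (negPf f2) orbF.
case/dvdzP=> c' Ec; rewrite {}Ec in Ea Ez c0 *.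
have {}Ex : x = (c' ^+ 2 * f ^+ 2) ^+ 2 + 4 * (c' ^+ 2 * f ^+ 3 * b)
    + (b * f) ^+ 2.
  by apply: (@mulfI _ 16) => //; rewrite -Ex Ea; ring.
have [l El] := odd_rep (odd_mul b2 f2).
(* For odd [c'], [x] is the sum of two odd squares and 4 times an odd number, so it is 2 modulo
   4. *)
have [/dvdzP[m Em]|c'2] := boolP (2 %| c')%Z; last first.
  exfalso; have [s Es] := odd_rep (odd_mul (odd_pow 2 c'2) (odd_pow 2 f2)).
  have [t Et] := odd_rep (odd_mul (odd_mul (odd_pow 2 c'2) (odd_pow 3 f2)) b2).
  move: K Ex; rewrite El Es Et.
  by clear=> -[[i [j [-> _]]]|[i [-> _]]]; lia.
have [A {}Ex] : exists A, x = 2 * A + (b * f) ^+ 2.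
  by exists (8 * m ^+ 4 * f ^+ 4 + 8 * m ^+ 2 * f ^+ 3 * b); rewrite Ex Em;
      ring.
have [B {}Ey] : exists B, y = 4 * B + 2 * (m * (f ^+ 2 * b)) ^+ 2
    + (b * f) ^+ 3.
  exists (- (f ^+ 3 * (2 * m ^+ 2 * f + b) * (8 * m ^+ 4 * f ^+ 2
    + 8 * m ^+ 2 * f * b))).
  by apply: (@mulfI _ 64) => //; rewrite -Ey Ea Em; ring.
have {}Ez : (f ^+ 7 * b ^+ 4) * (m ^+ 2 * (m ^+ 2 * f + b)) = 2 ^+ 4 * z.
  by apply: (mulfI (expf_neq0 8 (isT : (2 : int) != 0)));
      transitivity (4096 * z); [rewrite -Ez Ea Em|]; ring.
have dz : (2 ^+ 4 %| m ^+ 2 * (m ^+ 2 * f + b))%Z.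
  apply: (@prime_power_gauss 2 (f ^+ 7 * b ^+ 4) _ 4 isT).
    exact: odd_mul (odd_pow 7 f2) (odd_pow 4 b2).
  by apply/dvdzP; exists z; rewrite Ez mulrC.
case: K => [[i [j [_ Ej]]]|[i [Ei _]]]; last first.
  by move: Ei; rewrite Ex El; clear; lia.
(* Here [c = 4 m]. For even [m] the factor [m^2 f + b] is odd, so [16 | m^2] and [16 | c]; and [y]
   is [(b f)^3] modulo 4, which forces [b f = 3] modulo 4. *)
have [m2|m2] := boolP (2 %| m)%Z.
  split=> //; last first.
    case/dvdzP: m2 => k Ek; move: Ej; rewrite Ey Ek El.
    have -> : (k * 2 * (f ^+ 2 * b)) ^+ 2 = 4 * (k * (f ^+ 2 * b)) ^+ 2 by ring.
    by move: (_ ^+ 2); clear; lia.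
  have mfb : ~~ (2 %| m ^+ 2 * f + b)%Z.
    apply: contra b2 => d1; have := dvdz_lincomb 1 (- m * f) d1 m2.
    by congr (_ %| _)%Z; ring.
  have : (2 ^+ 4 %| m ^+ 2)%Z by apply: (@prime_power_gauss 2 _ _ 4 isT mfb);
      rewrite mulrC.
  rewrite (exprM _ 2 2) dvdz_pexp2r // Em => /dvdzP[k ->].
  by apply/dvdzP; exists k; ring.
(* For odd [m], [b] is [- m^2 f] modulo 16, so [b f] is [- (m f)^2], that is 3, modulo 4; then [y]
   is [2 + 27 = 1] modulo 4 instead of 3. *)
exfalso; have [w Ew] : exists w, m ^+ 2 * f + b = 16 * w.
  have /dvdzP[w Ew] := @prime_power_gauss 2 _ _ 4 isT (odd_pow 2 m2) dz.
  by exists w; rewrite Ew; ring.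
have [n En] := odd_rep (odd_mul m2 f2).
have [s Es] := odd_rep (odd_mul m2 (odd_mul (odd_pow 2 f2) b2)).
have Ebf : l = 2 * (4 * (w * f) - (n ^+ 2 + n) - 1) + 1.
  apply: (@mulfI _ 2) => //; apply: (addIr 1).
  transitivity (16 * w * f - (m * f) ^+ 2); last by rewrite En; ring.
  by rewrite -El -Ew; ring.
move: Ej; rewrite Ey El Es Ebf; move: (_ - 1) => q; clear.
have -> : 4 * B + 2 * (2 * s + 1) ^+ 2 + (2 * (2 * q + 1) + 1) ^+ 3
    = 4 * (B + 2 * s ^+ 2 + 2 * s + 16 * q ^+ 3 + 36 * q ^+ 2 + 27 * q + 7) + 1.
  by ring.
lia.
Qed.

Lemma minimal_C4 (a b d c f : int) : coprimez a b ->
  a = c ^+ 2 * f -> c != 0 -> squarefree f ->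
  discriminant (E_ C4 a b d) != 0 ->
  global_minimal_model (to_rat (E_ C4 a b d)) (E' C4 a b d c f).
Proof.
move=> cop Ea c0 sqf D0.
have irr_odd u : u = c \/ u = 2 * c -> forall p, prime p -> p <> 2 ->
    ~ reducible_at p (E_ C4 a b d) u.
  move=> Eu p p_pr p2 [x [_ [z [Ex _ Ez _]]]].
  have p_odd : ~~ (p%:Z %| 2)%Z by exact: (@prime_ndvdX_small p 2 1).
  have c4' : c4 (E_ C4 a b d)
      = c ^+ 4 * (f ^+ 2 * (a ^+ 2 + 16 * a * b
          + 16 * b ^+ 2)) by rewrite /= Ea; ring.
  have D' : discriminant (E_ C4 a b d)
      = c ^+ 12 * (c ^+ 2 * f ^+ 7 * b ^+ 4 * (a + 16 * b)) by rewrite /= Ea;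
          ring.
  case: Eu => Eu; rewrite {}Eu c4' D' in Ex Ez.
  - apply: (odd_irreducible_C4 (x := 16 * x) (z :=
      2 ^+ 12 * z) cop Ea sqf p_pr p_odd).
      by apply: (mulfI (expf_neq0 4 c0)); rewrite mulrCA Ex; ring.
    by apply: (mulfI (expf_neq0 12 c0)); rewrite mulrCA Ez; ring.
  - apply: (odd_irreducible_C4 (x := 256 * x) (z :=
      2 ^+ 24 * z) cop Ea sqf p_pr p_odd).
      by apply: (mulfI (expf_neq0 4 c0)); rewrite mulrCA Ex; ring.
    by apply: (mulfI (expf_neq0 12 c0)); rewrite mulrCA Ez; ring.
have [cond|cond] := boolP [&& v2_ge a 8, v2_even a & (b * f == 3 %[mod 4])%Z].
  have Eu : u_ C4 a b d c f = 2 * c by rewrite /= cond.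
  rewrite /E' /s_ Eu eqxx /=.
  case/and3P: cond; rewrite dvdz_v2_ge Ea => d256 _ bf.
  have bf2 : ~~ (2 %| b * f)%Z by lia.
  have f2 : ~~ (2 %| f)%Z by apply: contra bf2 => f2; rewrite dvdz_mull.
  have /dvdzP[n En] : (2 ^+ 4 %| c)%Z.
    rewrite -(@dvdz_pexp2r _ _ 2) // -exprM.
    by apply: (@prime_power_gauss 2 f) => //; rewrite mulrC.
  have [t Et] : exists t, b * f = 4 * t + 3 by exists (b * f %/ 4)%Z; lia.
  have u0 : 2 * c != 0 by rewrite mulf_neq0.
  rewrite -Ea; apply: (global_minimal_model_criterion (u := 2 * c) (r :=
      0) (s := c)) => //.
    rewrite /= Ea; split; apply/dvdzP.
    - by exists (8 * n * f + 1); rewrite En; ring.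
    (* This coefficient is [- (b f + c f + 1) / 4]; with [16 | c] it is integral exactly when
       [b f = 3] modulo 4. *)
    - exists (- (t + 1 + 4 * n * f)); transitivity (- (c ^+ 2 * (b * f))
        - c ^+ 3 * f - c ^+ 2).
        by ring.
      by rewrite Et En; ring.
    - by exists (- (2 * n * f ^+ 2 * b)); rewrite En; ring.
    - by exists (n * f ^+ 2 * b); rewrite En; ring.
    - by exists 0; ring.
  move=> p p_pr; have [->|/eqP p2] := eqVneq p 2%N; last by apply: irr_odd =>
      //; right.
  apply: (@irreducible2_unit_c4 _ _ (f ^+ 2 * (2048 * n ^+ 4 * f ^+ 2
    + 128 * n ^+ 2 * f * b)) (b * f) 2) => //.
  by rewrite /= Ea En; ring.
have Eu : u_ C4 a b d c f = c by rewrite /= (negPf cond).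
have s0 : s_ C4 a b d c f = 0.
  by rewrite /s_ Eu; case: ifP => // /eqP Ec; move: c0; rewrite -subr_eq0; lia.
rewrite /E' Eu s0; apply: (@global_minimal_scaling (E_ C4 a b d) c c0 D0).
  split=> /=; rewrite ?dvdz0 //; apply/dvdzP.
  - by exists (c * f); rewrite Ea; ring.
  - by exists (- (f * b)); rewrite Ea; ring.
  - by exists (- (c * f ^+ 2 * b)); rewrite Ea; ring.
move=> p p_pr; have [->|/eqP p2] := eqVneq p 2%N; last by apply: irr_odd => //;
    left.
case/(irreducible2_C4 cop Ea c0 sqf) => f2 c16 bf.
case/and3P: cond; split; last by lia.
  by rewrite dvdz_v2_ge Ea dvdz_mulr // (exprM _ 4 2) dvdz_exp2r.
by rewrite Ea v2_even_sqrM.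
Qed.

(** With [Y = b^2 d], [c4 = 16 (a^2 + 3 Y)] and [c6 = 64 a (a^2 - 9 Y)]. Eliminating [Y] gives
    [p^2 | a], then [p^4 | 3 Y]; but [p^2] divides neither [d] nor, because of the gcd, [b], so [Y]
    has valuation at most 3. *)
Lemma odd_irreducible_C2 (a b d : int) : squarefree d ->
  squarefree (gcdz a b) -> odd_irreducible (E_ C2 a b d).
Proof.
move=> sqf sqfab p p_pr p2 dc4 dc6 dD.
have gcd_p : (p%:Z ^+ 2 %| a)%Z -> (p%:Z ^+ 2 %| b)%Z -> False.
  move=> pa pb; have := squarefree_ndvd sqfab p_pr.
  by rewrite dvdz_gcd pa pb.
have p2k k : ~~ (p%:Z %| 2%:Z ^+ k)%Z.
  by apply: prime_ndvdX_small => //; lia.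
have p0 : p%:Z != 0 by rewrite -lt0n prime_gt0.
have {}dc4 : (p%:Z ^+ 4 %| a ^+ 2 + 3 * (b ^+ 2 * d))%Z.
  apply: (prime_power_gauss p_pr (p2k 4%N)).
  by move: dc4; congr (_ %| _)%Z; rewrite /=; ring.
have {}dc6 : (p%:Z ^+ 4 %| a * (a ^+ 2 - 9 * (b ^+ 2 * d)))%Z.
  apply: (dvdz_trans (dvdz_exp2l p%:Z (isT : (4 <= 6)%N))).
  apply: (prime_power_gauss p_pr (p2k 6%N)).
  by move: dc6; congr (_ %| _)%Z; rewrite /=; ring.
have {}dD : (p%:Z ^+ 12 %| b ^+ 2 * d * (a ^+ 2 - b ^+ 2 * d) ^+ 2)%Z.
  apply: (prime_power_gauss p_pr (p2k 6%N)).
  by move: dD; congr (_ %| _)%Z; rewrite /=; ring.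
(* From [3 a (a^2 + 3 Y) + a (a^2 - 9 Y) = 4 a^3]. *)
have da3 : (p%:Z ^+ 4 %| a ^+ 3)%Z.
  apply: (prime_power_gauss p_pr (p2k 2%N)).
  by have := dvdz_lincomb (3 * a) 1 dc4 dc6; congr (_ %| _)%Z; ring.
have {da3}da : (p%:Z ^+ 2 %| a)%Z.
  case/dvdzP: (prime_dvdzX p_pr (dvdz_base da3)) => k Ek.
  move: da3; rewrite Ek exprMn mulrC (exprD _ 3 1) dvdz_mul2l ?expf_neq0 //.
  by move/(prime_dvdzX p_pr)/dvdzP=> [m ->]; apply/dvdzP; exists m; ring.
have {}dc4 : (p%:Z ^+ 4 %| 3 * (b ^+ 2 * d))%Z.
  have /dvdzP[k Ek] := da.
  have da2 : (p%:Z ^+ 4 %| a ^+ 2)%Z by rewrite Ek exprMn dvdz_mull // -exprM.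
  by have := dvdz_lincomb 1 (- 1) dc4 da2; congr (_ %| _)%Z; ring.
have pd := squarefree_ndvd sqf p_pr.
have b_exact : (p%:Z %| b)%Z -> exists2 m, b = p%:Z * m & ~~ (p%:Z %| m)%Z.
  case/dvdzP=> m Em; exists m; first by rewrite Em mulrC.
  apply/negP => /dvdzP[k Ek]; apply: gcd_p da _; apply/dvdzP.
  by exists k; rewrite Em Ek; ring.
have [p3|p3] := eqVneq p 3%N; last first.
  have {}dc4 : (p%:Z ^+ 4 %| b ^+ 2 * d)%Z.
    apply: (prime_power_gauss p_pr _ dc4).
    by apply: (@prime_ndvdX_small p 3 1) => //; exact/eqP.
  have [/b_exact[m Em pm]|pb] := boolP (p%:Z %| b)%Z.
    case/negP: pd; apply: (prime_power_gauss p_pr (prime_ndvdzX 2 p_pr pm)).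
    rewrite -(@dvdz_mul2l (p%:Z ^+ 2)) ?expf_neq0 // -exprD.
    by move: dc4; rewrite Em; congr (_ %| _)%Z; ring.
  case/negP: pd; apply: (dvdz_trans (dvdz_exp2l p%:Z (isT : (2 <= 4)%N))).
  exact: prime_power_gauss p_pr (prime_ndvdzX 2 p_pr pb) dc4.
(* At 3 only [27 | Y] remains, which happens when 3 divides both [b] and [d] exactly once. As
   [81 | a^2], the discriminant [64 Y (a^2 - Y)^2] then has valuation [3 + 6 = 9], below 12. *)
rewrite {}p3 in p_pr gcd_p dc4 dD da pd b_exact *.
have {}dc4 : (3 ^+ 3 %| b ^+ 2 * d)%Z.
  by rewrite -(@dvdz_mul2l 3) // -exprS.
have [/b_exact[m Em pm]|pb] := boolP (3 %| b)%Z; last first.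
  case/negP: pd; apply: (dvdz_trans (dvdz_exp2l 3 (isT : (2 <= 3)%N))).
  exact: (prime_power_gauss p_pr (prime_ndvdzX 2 p_pr pb) dc4).
have [e Ed pe] : exists2 e, d = 3 * e & ~~ (3 %| e)%Z.
  apply: (prime_dvdz_exact sqf p_pr).
  have d3 : (3 ^+ 1 %| m ^+ 2 * d)%Z.
    rewrite -(@dvdz_mul2l (3 ^+ 2)) // -exprD.
    by move: dc4; rewrite Em; congr (_ %| _)%Z; ring.
  exact: (prime_power_gauss (k := 1) p_pr (prime_ndvdzX 2 p_pr pm) d3).
case/dvdzP: da => a' Ea.
have pX m0 := @prime_ndvdzX 3 m0 2 p_pr; have pM := prime_ndvdM p_pr.
apply: (@unit_residue 3 _ (m ^+ 2 * e) (m ^+ 2 * e * (3 * a' ^+ 4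
    - 2 * a' ^+ 2 * m ^+ 2 * e)) 1 9 12 3 isT _ _ _ _ dD) => //.
  by apply: pM => //; exact: pX.
by rewrite Ea Em Ed; ring.
Qed.

(** [d] can supply only one factor 2, so [b] must be even. Iterated, this extracts [8 | b] from
    [64 | b^2 d]. *)
Lemma even_sqrM (b d : int) (k : nat) : ~~ (2 ^+ 2 %| d)%Z ->
  (2 ^+ k.+2 %| b ^+ 2 * d)%Z -> exists2 m, b = 2 * m & (2 ^+ k %| m ^+ 2
   * d)%Z.
Proof.
move=> d4 dbd; have [/dvdzP[m Em]|b2] := boolP (2 %| b)%Z.
  exists m; first by rewrite Em mulrC.
  rewrite -(@dvdz_mul2l (2 ^+ 2)) // -exprD.
  by move: dbd; rewrite Em; congr (_ %| _)%Z; ring.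
case/negP: d4; apply: (@dvdz_trans (2 ^+ k.+2)); first exact: dvdz_exp2l.
by apply: (@prime_power_gauss 2 (b ^+ 2)) => //; exact: odd_pow.
Qed.

(** The two alternatives are the parities of [a]. For odd [a] the discriminant forces [64 | b^2 d].
    For even [a], [16 | x] makes [b] even, and the squarefree gcd and [d] make [a / 2] and [b / 2]
    both odd. *)
Lemma reducible2_C2_u1 (a b d : int) : squarefree d ->
  squarefree (gcdz a b) -> reducible_at 2 (E_ C2 a b d) 1 ->
  (8 %| b)%Z && (4 %| a - 3)%Z \/
  [/\ (2 %| a)%Z, ~~ (4 %| a)%Z, (2 %| b)%Z, ~~ (4 %| b)%Z &
      (16 %| b ^+ 2 * d - a ^+ 2)%Z].
Proof.
move=> sqf sqfab [x [y [z [Ex Ey Ez /(_ erefl) K]]]].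
have d4 := squarefree_ndvd sqf (isT : prime 2).
have {}Ex : x = a ^+ 2 + 3 * (b ^+ 2 * d).
  apply: (@mulfI _ 16) => //; transitivity (1 ^+ 4 * (2%:Z ^+ 4 * x));
      first by ring.
  by rewrite -Ex /=; ring.
have {}Ey : y = a * (a ^+ 2 - 9 * (b ^+ 2 * d)).
  apply: (@mulfI _ 64) => //; transitivity (1 ^+ 6 * (2%:Z ^+ 6 * y));
      first by ring.
  by rewrite -Ey /=; ring.
have {}Ez : 2 ^+ 6 * z = b ^+ 2 * d * (b ^+ 2 * d - a ^+ 2) ^+ 2.
  apply: (@mulfI _ 64) => //; transitivity (1 ^+ 12 * (2%:Z ^+ 12 * z));
      first by ring.
  by rewrite -Ez /=; ring.
set Y := b ^+ 2 * d in Ex Ey Ez *.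
have [a2|a2] := boolP (2 %| a)%Z; last first.
  left; have [r Er] := odd_rep (odd_pow 3 a2).
  have {}Ey : y = 2 * r + 1 - 9 * (a * Y) by rewrite -Er Ey; ring.
  (* If [x = 16 i], then [y = 4 a^3 - 48 a i] is 4 modulo 8, not 0 or 8 modulo 32. *)
  case: K => [[i [j [_ Ej]]]|[i [Ei Ej]]]; last first.
    have {}Ex : 9 * (a * Y) = 48 * (a * i) - 3 * (2 * r + 1).
      apply: (@mulfI _ 1) => //; rewrite -Er.
      transitivity (3 * a * (a ^+ 2 + 3 * Y - a ^+ 2)); first by ring.
      by rewrite -Ex Ei; ring.
    by move: Ej Ey; rewrite Ex; clear; case=> -[j ->]; lia.
  have Y2 : (2 %| Y)%Z.
    apply/negPn/negP => Y2; have [t Et] := odd_rep (odd_mul a2 Y2).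
    by move: Ey; rewrite Ej Et; clear; lia.
  have {Ez} : (2 ^+ 6 %| Y)%Z.
    apply: (@prime_power_gauss 2 ((Y - a ^+ 2) ^+ 2)) => //; last first.
      by apply/dvdzP; exists z; rewrite mulrC -Ez mulrC.
    apply: odd_pow; apply: contra a2 => Ya; apply: (@prime_dvdzX 2 _ 2 isT).
    by have := dvdz_lincomb 1 (- 1) Y2 Ya; congr (_ %| _)%Z; ring.
  case/(even_sqrM (k := 4) d4) => b1 Eb.
  case/(even_sqrM (k := 2) d4) => b2 Eb1.
  case/(even_sqrM (k := 0) d4) => b3 Eb2 _.
  have {}Eb : b = 8 * b3 by rewrite Eb Eb1 Eb2; ring.
  (* With [8 | b], [y] is [a^3], hence [a], modulo 4, and Kraus's residue 3 passes to [a]. *)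
  have [k Ek] := odd_rep a2; apply/andP; split; first by rewrite Eb dvdz_mulr.
  move: Ey; rewrite Ej -Er /Y Eb Ek => Ey.
  have [q Eq] : exists q, 4 * j + 3 = 4 * q + 2 * k + 1.
    exists (2 * k ^+ 3 + 3 * k ^+ 2 + k - 144 * (2 * k + 1) * b3 ^+ 2 * d).
    by rewrite Ey; ring.
  by move: Eq; clear; lia.
right; case/dvdzP: a2 => a' Ea; case: K => [[i [j [_ Ej]]]|[i [Ei _]]].
  exfalso; have {}Ey : y = 2 * (a' * (a ^+ 2 - 9 * Y)) by rewrite Ey Ea; ring.
  by move: Ey; rewrite Ej; clear; lia.
have [m Em dm] : exists2 m, b = 2 * m & (2 ^+ 0 %| m ^+ 2 * d)%Z.
  apply: even_sqrM d4 _; apply: (@prime_power_gauss 2 3) => //.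
  apply/dvdzP; exists (4 * i - a' ^+ 2).
  transitivity (x - a ^+ 2); first by rewrite Ex /Y; ring.
  by rewrite Ei Ea; ring.
have {dm}Ei' : a' ^+ 2 + 3 * (m ^+ 2 * d) = 4 * i.
  apply: (@mulfI _ 4) => //; transitivity x; last by rewrite Ei; ring.
  by rewrite Ex /Y Ea Em; ring.
have gcd2 : (2 %| a')%Z -> (2 %| m)%Z -> False.
  case/dvdzP=> k1 E1 /dvdzP[k2 E2]; have :=
      squarefree_ndvd sqfab (isT : prime 2).
  by rewrite dvdz_gcd Ea Em E1 E2; case/negP; lia.
have m2 : ~~ (2 %| m)%Z.
  apply/negP => m2; apply: gcd2 (m2); apply: (@prime_dvdzX 2 _ 2 isT).
  have /dvdzP[k2 E2] := m2; apply/dvdzP; exists (2 * i - 6 * k2 ^+ 2 * d).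
  transitivity (4 * i - 3 * (m ^+ 2 * d)); first by rewrite -Ei'; ring.
  by rewrite E2; ring.
have a'2 : ~~ (2 %| a')%Z.
  apply/negP => /dvdzP[k1 E1]; case/negP: d4.
  apply: (@prime_power_gauss 2 (3 * m ^+ 2)) => //.
    by apply: odd_mul => //; exact: odd_pow.
  apply/dvdzP; exists (i - k1 ^+ 2).
  transitivity (4 * i - a' ^+ 2); first by rewrite -Ei'; ring.
  by rewrite E1; ring.
split=> //.
- by move: a'2; rewrite Ea; clear; lia.
- by rewrite Em dvdz_mulr.
- by move: m2; rewrite Em; clear; lia.
apply/dvdzP; exists (m ^+ 2 * d - i).
transitivity (16 * (m ^+ 2 * d) - 4 * (4 * i)); last by ring.
by rewrite -Ei' /Y Ea Em; ring.
Qed.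

Lemma odd_halves (n : int) : (2 %| n)%Z -> ~~ (4 %| n)%Z ->
  exists2 m, n = 2 * m & ~~ (2 %| m)%Z.
Proof. by move=> n2 n4; exists (n %/ 2)%Z; lia. Qed.

(** After removal of [u = 2] the discriminant is an odd number times [(w / 4)^2] with
    [w = b^2 d - a^2], so its divisibility by [2^12] amounts to [2^8 | w]. Then [y] is [- (a / 2)^3]
    modulo 4, and Kraus's residue 3 means that [a / 2] is 1 modulo 4. *)
Lemma reducible2_C2_u2 (a b d : int) :
  (2 %| a)%Z -> ~~ (4 %| a)%Z -> (2 %| b)%Z -> ~~ (4 %| b)%Z ->
  (16 %| b ^+ 2 * d - a ^+ 2)%Z -> reducible_at 2 (E_ C2 a b d) 2 ->
  (2 ^+ 8 %| b ^+ 2 * d - a ^+ 2)%Z && (8 %| a - 2)%Z.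
Proof.
move=> a2 a4 b2 b4 w16 [x [y [z [Ex Ey Ez /(_ erefl) K]]]].
have [a' Ea {a2 a4}a'2] := odd_halves a2 a4.
have [m Em {b2 b4}m2] := odd_halves b2 b4.
have [t Et] : exists t, m ^+ 2 * d - a' ^+ 2 = 4 * t.
  case/dvdzP: w16 => t Et; exists t; apply: (@mulfI _ 4) => //.
  by transitivity (t * 16); [rewrite -Et Ea Em|]; ring.
have {}Ex : a' ^+ 2 + 3 * (m ^+ 2 * d) = 4 * x.
  apply: (@mulfI _ 64) => //; transitivity (2 ^+ 4 * (2%:Z ^+ 4 * x));
      last by ring.
  by rewrite -Ex /= Ea Em; ring.
have {}Ey : a' * (a' ^+ 2 - 9 * (m ^+ 2 * d)) = 8 * y.
  apply: (mulfI (expf_neq0 9 (isT : (2 : int) != 0)));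
      transitivity (2 ^+ 6 * (2%:Z ^+ 6 * y)); last by ring.
  by rewrite -Ey /= Ea Em; ring.
have {}Ez : m ^+ 2 * d * (m ^+ 2 * d - a' ^+ 2) ^+ 2 = 2 ^+ 12 * z.
  apply: (mulfI (expf_neq0 12 (isT : (2 : int) != 0)));
      transitivity (2 ^+ 12 * (2%:Z ^+ 12 * z)); last by ring.
  by rewrite -Ez /= Ea Em; ring.
have /dvdzP[s Es] : (2 ^+ 6 %| m ^+ 2 * d - a' ^+ 2)%Z.
  rewrite -(@dvdz_pexp2r _ _ 2) // -exprM.
  apply: (@prime_power_gauss 2 (m ^+ 2 * d)) => //; last first.
    by apply/dvdzP; exists z; rewrite Ez mulrC.
  apply: contra a'2 => md; apply: (@prime_dvdzX 2 _ 2 isT).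
  have d4t : (2 %| 4 * t)%Z by rewrite dvdz_mulr.
  have := dvdz_lincomb 1 (- 1) md d4t; congr (_ %| _)%Z; rewrite -Et; ring.
have {}Ex : x = a' ^+ 2 + 48 * s.
  apply: (@mulfI _ 4) => //; rewrite -Ex.
  transitivity (4 * a' ^+ 2 + 3 * (m ^+ 2 * d - a' ^+ 2)); first by ring.
  by rewrite Es; ring.
have {}Ey : y = - a' ^+ 3 - 72 * (s * a').
  apply: (@mulfI _ 8) => //; rewrite -Ey.
  transitivity (a' * (- 8 * a' ^+ 2 - 9 * (m ^+ 2 * d - a' ^+ 2)));
      first by ring.
  by rewrite Es; ring.
apply/andP; split.
  apply/dvdzP; exists s; transitivity (4 * (m ^+ 2 * d - a' ^+ 2)).
    by rewrite Ea Em; ring.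
  by rewrite Es; ring.
have [k Ek] := odd_rep a'2.
case: K => [[i [j [_ Ej]]]|[i [Ei _]]]; last first.
  by exfalso; move: Ei; rewrite Ex Ek; clear; lia.
have [q Eq] : exists q, 4 * j + 3 = 4 * q - (2 * k + 1).
  exists (- 2 * k ^+ 3 - 3 * k ^+ 2 - k - 18 * (s * a')).
  by rewrite -Ej Ey Ek; ring.
by rewrite Ea Ek; move: Eq; clear; lia.
Qed.

Lemma minimal_C2 (a b d c f : int) : squarefree d -> squarefree (gcdz a b) ->
  discriminant (E_ C2 a b d) != 0 ->
  global_minimal_model (to_rat (E_ C2 a b d)) (E' C2 a b d c f).
Proof.
move=> sqf sqfab D0; have irr := odd_irreducible_C2 sqf sqfab.
have [c1|nc1] := boolP ((8 %| b)%Z && (4 %| a - 3)%Z).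
  have [b8 a3] := andP c1; have a2 : ~~ (2 %| a)%Z by lia.
  have Eu : u_ C2 a b d c f = 2.
    rewrite /= !dvdz_v2; move: (b ^+ 2 * d - a ^+ 2) => w.
    by do ?case: ifPn => //; lia.
  have Es : s_ C2 a b d c f = 1.
    by rewrite /s_ Eu /= !dvdz_v2; do ?case: ifPn => //; lia.
  case/dvdzP: (b8) => k Ek.
  have irr2 : ~ reducible_at 2 (E_ C2 a b d) 2.
    apply: (@irreducible2_unit_c4 _ 2 (96 * k ^+ 2 * d) a 2) => //.
    by rewrite /= Ek; ring.
  rewrite /E' Eu Es.
  (* For [t = 0] the constant coefficient is [r ((a + r)^2 - b^2 d) / 64] with [64 | b^2 d], so an
     odd [r] must be [- a] modulo 8: 1 when [a] is 7 and -3 when [a] is 3 modulo 8. *)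
  have [[e Ee]|[e Ee]] : (exists e, a = 8 * e + 7) \/ (exists e, a = 8 * e + 3).
    have [a7|a7] := boolP (8 %| a - 7)%Z; [left|right].
      by exists (a %/ 8)%Z; lia.
    by exists (a %/ 8)%Z; lia.
  - have -> : r_ C2 a b = 1 by rewrite /= !dvdz_v2; do ?case: ifPn => //; lia.
    apply: (global_minimal_model_criterion (u := 2) (r := 1) (s := 1)) => //;
        last first.
      exact: odd_irreducibleP irr irr2.
    rewrite Ee Ek /=; split; apply/dvdzP.
    + by exists 1.
    + by exists (4 * e + 4); ring.
    + by exists 0; ring.
    + by exists (4 * e ^+ 2 + 9 * e + 5 - 4 * k ^+ 2 * d); ring.
    + by exists (e ^+ 2 + 2 * e + 1 - k ^+ 2 * d); ring.
  - have -> : r_ C2 a b = -3 by rewrite /= !dvdz_v2; do ?case: ifPn => //; lia.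
    apply: (global_minimal_model_criterion (u := 2) (r := -3) (s := 1)) => //;
        last first.
      exact: odd_irreducibleP irr irr2.
    rewrite Ee Ek /=; split; apply/dvdzP.
    + by exists 1.
    + by exists (4 * e - 1); ring.
    + by exists 0; ring.
    + by exists (4 * e ^+ 2 - 3 * e - 4 * k ^+ 2 * d); ring.
    + by exists (- 3 * e ^+ 2 + 3 * k ^+ 2 * d); ring.
have r0 : r_ C2 a b = 0 by rewrite /= !dvdz_v2; do ?case: ifPn => //; lia.
have [c2|nc2] := boolP [&& (2 %| a)%Z, ~~ (4 %| a)%Z, (2 %| b)%Z, ~~ (4 %| b)%Z
    & (16 %| b ^+ 2 * d - a ^+ 2)%Z]; last first.
  have Eu : u_ C2 a b d c f = 1.
    rewrite /= !dvdz_v2; move: (b ^+ 2 * d - a ^+ 2) nc2 => w nc2.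
    by do ?case: ifPn => //; lia.
  rewrite /E' r0 /s_ Eu /=.
  apply: (@global_minimal_scaling (E_ C2 a b d) 1 isT D0 (integral_scaling1 _)).
  apply: odd_irreducibleP irr _ =>
      /(reducible2_C2_u1 sqf sqfab)[c1|[a2 a4 b2 b4 w16]].
    by rewrite c1 in nc1.
  by rewrite a2 a4 b2 b4 w16 in nc2.
have /and5P[a2 a4 b2 b4 w16] := c2.
have [a' Ea a'2] := odd_halves a2 a4; have [m Em m2] := odd_halves b2 b4.
have [c3|nc3] := boolP ((2 ^+ 8 %| b ^+ 2 * d - a ^+ 2)%Z && (8 %| a - 2)%Z).
  have Eu : u_ C2 a b d c f = 4.
    rewrite /= !dvdz_v2; move: (b ^+ 2 * d - a ^+ 2) c2 c3.
    by clear=> w c2 c3; do ?case: ifPn => //; lia.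
  have Es : s_ C2 a b d c f = 2.
    by rewrite /s_ Eu /= !dvdz_v2; do ?case: ifPn => //; lia.
  have /andP[/dvdzP[t Et] /dvdzP[k Ek]] := c3.
  rewrite /E' r0 Eu Es.
  (* With [s = 2] the coefficients become [(a - 2) / 8] and [- (b^2 d - a^2) / 256], the origin of
     the two conditions for [u = 4]. *)
  apply: (global_minimal_model_criterion (u := 4) (r := 0) (s := 2)) => //.
    split; apply/dvdzP; rewrite /=.
    + by exists 1.
    + exists k; transitivity (2 * (a - 2)); first by ring.
      by rewrite Ek; ring.
    + by exists 0; ring.
    + exists (- t); transitivity (- (b ^+ 2 * d - a ^+ 2)); first by ring.
      by rewrite Et; ring.
    + by exists 0; ring.
  apply: odd_irreducibleP irr _.
  apply: (@irreducible2_unit_c4 _ 4 (24 * t) a' 2) => //.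
  transitivity (64 * a ^+ 2 + 48 * (b ^+ 2 * d - a ^+ 2)); first by rewrite /=;
      ring.
  by rewrite Et Ea; ring.
have Eu : u_ C2 a b d c f = 2.
  rewrite /= !dvdz_v2; move: (b ^+ 2 * d - a ^+ 2) c2 nc3.
  by clear=> w c2 nc3; do ?case: ifPn => //; lia.
have Es : s_ C2 a b d c f = 2.
  by rewrite /s_ Eu /= !dvdz_v2; move: b2 b4; clear=> b2 b4;
    do ?case: ifPn => //; lia.
rewrite /E' r0 Eu Es.
apply: (global_minimal_model_criterion (u := 2) (r := 0) (s := 2)) => //.
  case/dvdzP: w16 => t Et; split; apply/dvdzP; rewrite /=.
  + by exists 2.
  + by exists (a' - 1); rewrite Ea; ring.
  + by exists 0; ring.
  + exists (- t); transitivity (- (b ^+ 2 * d - a ^+ 2)); first by ring.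
    by rewrite Et; ring.
  + by exists 0; ring.
apply: odd_irreducibleP irr _ => /(reducible2_C2_u2 a2 a4 b2 b4 w16).
by rewrite (negPf nc3).
Qed.

Theorem theorem6p1 (T : torsion_type) (a b d c f g : int)
    (hP : parameter_conditions T a b d)
    (hdec : power_decomposition T a c f g) :
  global_minimal_model (to_rat (E_ T a b d)) (E' T a b d c f).
Proof.
case: hP => D0; case: T D0 hdec => D0 hdec.
- by case=> _ _ sqfd sqfab; exact: minimal_C2.
- by case=> _ cbf; exact: minimal_C3_0.
- case: hdec => Ea c0 [f0 _] copfg [sqff sqfg] [cop _].
  by apply: minimal_C3 cop Ea _ _ copfg sqff sqfg D0; rewrite lt0r_neq0.
- case: hdec => Ea c0 sqff [cop _].
  by apply: minimal_C4 cop Ea _ sqff D0; rewrite lt0r_neq0.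
- by case=> cop _; exact: minimal_C5.
- by case=> cop _; exact: minimal_C6.
- by case=> cop _; exact: minimal_C7.
- by case=> cop _; exact: minimal_C8.
- by case=> cop _; exact: minimal_C9.
- by case=> cop _; exact: minimal_C10.
- by case=> cop _; exact: minimal_C12.
- by case=> cop a2 _ sqfd; exact: minimal_C2xC2.
- by case=> cop _; exact: minimal_C2xC4.
- by case=> cop _; exact: minimal_C2xC6.
- by case=> cop _; exact: minimal_C2xC8.
Qed.
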